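(* Let $k$ be a perfect field of characteristic $p>2$, and let $G$ be an affine algebraic $k$-supergroup scheme with first Frobenius kernel $G_1$. Then there exists an étale group scheme $\pi_0(G)=\pi_0(G/G_1)$, and a normal subsupergroup scheme $G^0$ of $G$ such that $G/G^0\cong\pi_0(G)$. If $G$ is finite, then $G\cong G^0\rtimes\pi_0(G)$, and $G^0$ is infinitesimal.
   Context: An affine $k$-supergroup scheme $G$ is a functor from commutative $k$-superalgebras ($\mathbb{Z}/2$-graded, $ab=(-1)^{\overline a\,\overline b}ba$) to groups, represented by a commutative Hopf superalgebra $k[G]$; $G$ is algebraic if $k[G]$ is finitely generated, finite if $k[G]$ is finite-dimensional, and infinitesimal if it is finite and the augmentation ideal $I_\varepsilon$ of $k[G]$ is nilpotent. An ordinary affine group scheme is regarded as a supergroup scheme with purely even coordinate algebra. The first Frobenius kernel $G_1$ is the normal subsupergroup scheme defined by the ideal $\sum_{f\in I_\varepsilon}k[G]f^p$. For a normal subsupergroup scheme $N$ of $G$, $G/N$ is the quotient affine supergroup scheme (the sheaf quotient of $A\mapsto G(A)/N(A)$). The quotient $G/G_1$ has coordinate algebra $\{f^p:f\in k[G]\}\subset k[G]$, which is purely even, so $G/G_1$ is an ordinary affine algebraic group scheme. A finite group scheme is étale if its coordinate algebra is a separable $k$-algebra. For an ordinary affine algebraic group scheme $H$, $\pi_0(H)$ is its maximal étale quotient (component group), with coordinate algebra the largest separable subalgebra of $k[H]$. *)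

(* Defs.v *)
From HB Require Import structures.
From mathcomp Require Import all_boot all_order all_algebra all_field.

Set Implicit Arguments.
Unset Strict Implicit.
Unset Printing Implicit Defensive.

Import GRing.Theory.
Local Open Scope ring_scope.

(* Superalgebras are supercommutative throughout, and nonzero because [algType]
   is: a representable functor has exactly one point over the zero algebra, so
   leaving it out of the test algebras loses nothing. *)
Record superAlgebra (k : fieldType) := SuperAlgebra {
  sa_alg :> algType k;
  parity : bool -> sa_alg -> Prop;
  parity0 : forall i, parity i 0;
  parity_lin : forall i (c : k) a b,
    parity i a -> parity i b -> parity i (c *: a + b);
  parity1 : parity false 1;
  parityM : forall i j a b,
    parity i a -> parity j b -> parity (i (+) j) (a * b);
  parity_split : forall a,
    exists a0 a1, [/\ parity false a0, parity true a1 & a = a0 + a1];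
  parity_direct : forall a, parity false a -> parity true a -> a = 0;
  super_comm : forall i j a b,
    parity i a -> parity j b -> a * b = (-1) ^+ (i && j) * (b * a)
}.

Record saHom (k : fieldType) (A B : superAlgebra k) := SaHom {
  sa_fun :> A -> B;
  sa_linear : linear sa_fun;
  sa_monoid : monoid_morphism sa_fun;
  sa_parity : forall i a, parity i a -> parity i (sa_fun a)
}.

HB.instance Definition _ (k : fieldType) (A B : superAlgebra k)
    (f : saHom A B) :=
  GRing.isLinear.Build k A B *:%R (sa_fun f) (sa_linear f).
HB.instance Definition _ (k : fieldType) (A B : superAlgebra k)
    (f : saHom A B) :=
  GRing.isMonoidMorphism.Build A B (sa_fun f) (sa_monoid f).

Program Definition sa_id (k : fieldType) (A : superAlgebra k) : saHom A A :=
  @SaHom k A A id _ _ _.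
Next Obligation. by []. Qed.
Next Obligation. by []. Qed.
Next Obligation. by []. Qed.

Program Definition sa_comp (k : fieldType) (A B C : superAlgebra k)
    (g : saHom B C) (f : saHom A B) : saHom A C :=
  @SaHom k A C (fun a => g (f a)) _ _ _.
Next Obligation. by move=> k A B C g f c a b; rewrite !linearP. Qed.
Next Obligation.
by move=> k A B C g f; split=> [|a b]; rewrite ?rmorph1 ?rmorphM.
Qed.
Next Obligation. by move=> k A B C g f i a /sa_parity/sa_parity; exact. Qed.

Program Definition sa_base (k : fieldType) : superAlgebra k :=
  @SuperAlgebra k k^o (fun i a => i = false \/ a = 0) _ _ _ _ _ _ _.
Next Obligation. by right. Qed.
Next Obligation.
move=> k i c a b [i0|a0]; first by left.
by case=> [i0|b0]; [left | right; rewrite a0 b0 scaler0 addr0].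
Qed.
Next Obligation. by left. Qed.
Next Obligation.
move=> k i j a b [i0|a0]; last by right; rewrite a0 mul0r.
by case=> [j0|b0]; [left; rewrite i0 j0 | right; rewrite b0 mulr0].
Qed.
Next Obligation.
by move=> k a; exists a, 0; split; [left|right|rewrite addr0].
Qed.
Next Obligation. by move=> k a _ []. Qed.
Next Obligation.
move=> k i j a b [i0|a0]; last by rewrite a0 mul0r !mulr0.
by move=> _; rewrite i0 expr0 mul1r mulrC.
Qed.

Record groupFunctor (k : fieldType) := GroupFunctor {
  gf_obj :> superAlgebra k -> groupType;
  gf_map : forall A B, saHom A B -> gf_obj A -> gf_obj B;
  gf_mapM : forall A B (f : saHom A B) (x y : gf_obj A),
    gf_map f (x * y)%g = (gf_map f x * gf_map f y)%g;
  gf_map_id : forall A (x : gf_obj A), gf_map (sa_id A) x = x;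
  gf_map_comp : forall A B C (g : saHom B C) (f : saHom A B) (x : gf_obj A),
    gf_map (sa_comp g f) x = gf_map g (gf_map f x)
}.

(* An affine supergroup scheme is a group functor G with a natural bijection
   G(A) = Hom(k[G], A).  By Yoneda, the group structure on the functor is the
   same datum as the Hopf superalgebra structure on the representing k[G]. *)
Record supergroup (k : fieldType) := Supergroup {
  sg_functor :> groupFunctor k;
  coord_alg : superAlgebra k;
  pt : forall A, sg_functor A -> saHom coord_alg A;
  elt : forall A, saHom coord_alg A -> sg_functor A;
  ptK : forall A, cancel (@pt A) (@elt A);
  eltK : forall A, cancel (@elt A) (@pt A);
  pt_nat : forall A B (f : saHom A B) (x : sg_functor A),
    pt (gf_map f x) = sa_comp f (pt x)
}.

Record sgHom (k : fieldType) (G H : supergroup k) := SgHom {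
  sg_app :> forall A : superAlgebra k, G A -> H A;
  sg_appM : forall (A : superAlgebra k) (x y : G A),
    sg_app (x * y)%g = (sg_app x * sg_app y)%g;
  sg_app_nat : forall (A B : superAlgebra k) (f : saHom A B) (x : G A),
    sg_app (gf_map f x) = gf_map f (sg_app x)
}.

(* The image of the universal point of G, that is, of the identity of k[G]. *)
Definition comorphism (k : fieldType) (G H : supergroup k) (q : sgHom G H) :
    saHom (coord_alg H) (coord_alg G) :=
  pt (q (coord_alg G) (elt (sa_id (coord_alg G)))).

Definition counit (k : fieldType) (G : supergroup k) :
    saHom (coord_alg G) (sa_base k) :=
  pt (1%g : G (sa_base k)).

Definition finite_dim (k : fieldType) (A : lmodType k) : Prop :=
  exists (n : nat) (b : 'I_n -> A),
    forall a, exists c : 'I_n -> k, a = \sum_(i < n) c i *: b i.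

Definition finitely_generated (k : fieldType) (A : algType k) : Prop :=
  exists (n : nat) (b : 'I_n -> A), forall S : A -> Prop,
    S 1 ->
    (forall (c : k) x y, S x -> S y -> S (c *: x + y)) ->
    (forall x y, S x -> S y -> S (x * y)) ->
    (forall i, S (b i)) ->
    forall a, S a.

(* A commutative algebra is separable when it is a finite product of finite
   separable field extensions of k. *)
Definition separable_algebra (k : fieldType) (A : algType k) : Prop :=
  exists (n : nat) (L : 'I_n -> fieldExtType k)
         (f : forall i, {lrmorphism A -> L i}),
    (forall i, separable 1%AS {:L i}) /\
    (forall y : (forall i, L i), exists! a, forall i, f i a = y i).

Definition sg_algebraic (k : fieldType) (G : supergroup k) : Prop :=
  finitely_generated (coord_alg G).

Definition sg_finite (k : fieldType) (G : supergroup k) : Prop :=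
  finite_dim (coord_alg G).

Definition infinitesimal (k : fieldType) (G : supergroup k) : Prop :=
  sg_finite G /\
  exists n : nat, forall f : 'I_n -> coord_alg G,
    (forall i, counit G (f i) = 0) -> \prod_(i < n) f i = 0.

Definition ordinary (k : fieldType) (G : supergroup k) : Prop :=
  forall f : coord_alg G, parity true f -> f = 0.

Definition etale (k : fieldType) (G : supergroup k) : Prop :=
  [/\ ordinary G, sg_finite G & separable_algebra (coord_alg G)].

Definition subfunctor (k : fieldType) (G : supergroup k) :=
  forall A : superAlgebra k, G A -> Prop.

Definition hom_image (k : fieldType) (N G : supergroup k) (i : sgHom N G) :
    subfunctor G :=
  fun A g => exists n : N A, i A n = g.

Definition zero_locus (k : fieldType) (G : supergroup k)
    (I : coord_alg G -> Prop) : subfunctor G :=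
  fun A g => forall f, I f -> pt g f = 0.

(* A subsupergroup scheme is presented by a closed immersion N -> G. *)
Definition closed_immersion (k : fieldType) (N G : supergroup k)
    (i : sgHom N G) : Prop :=
  forall a, exists f, comorphism i f = a.

Definition normal_sub (k : fieldType) (N G : supergroup k) (i : sgHom N G) :
    Prop :=
  closed_immersion i /\
  forall (A : superAlgebra k) (g : G A) (n : N A),
    hom_image i (g * i A n * g^-1)%g.

Definition frobenius_ideal (k : fieldType) (p : nat) (G : supergroup k) :
    coord_alg G -> Prop :=
  fun x => exists (n : nat) (a f : 'I_n -> coord_alg G),
    (forall i, counit G (f i) = 0) /\ x = \sum_(i < n) a i * f i ^+ p.

Definition frobenius_kernel (k : fieldType) (p : nat) (G : supergroup k) :
    subfunctor G :=
  zero_locus (@frobenius_ideal k p G).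

(* B is regarded as a right A-module through f. *)
Definition balanced (k : fieldType) (A B : superAlgebra k) (f : saHom A B)
    (M : lmodType A) (T : zmodType) (t : B -> M -> T) : Prop :=
  [/\ forall b b' m, t (b + b') m = t b m + t b' m,
      forall b m m', t b (m + m') = t b m + t b m'
    & forall b a m, t (b * f a) m = t b (a *: m)].

Definition is_tensor (k : fieldType) (A B : superAlgebra k) (f : saHom A B)
    (M : lmodType A) (T : zmodType) (t : B -> M -> T) : Prop :=
  balanced f t /\
  forall (U : zmodType) (u : B -> M -> U), balanced f u ->
    exists h : {additive T -> U},
      (forall b m, h (t b m) = u b m) /\
      forall h' : {additive T -> U}, (forall b m, h' (t b m) = u b m) ->
        h' =1 h.

Definition flat (k : fieldType) (A B : superAlgebra k) (f : saHom A B) : Prop :=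
  forall (M M' : lmodType A) (j : {linear M -> M'}), injective j ->
  forall (T T' : zmodType) (t : B -> M -> T) (t' : B -> M' -> T'),
    is_tensor f t -> is_tensor f t' ->
  forall h : {additive T -> T'}, (forall b m, h (t b m) = t' b (j m)) ->
    injective h.

Definition faithfully_flat (k : fieldType) (A B : superAlgebra k)
    (f : saHom A B) : Prop :=
  flat f /\
  forall (M : lmodType A) (T : zmodType) (t : B -> M -> T),
    is_tensor f t -> (forall z : T, z = 0) -> forall m : M, m = 0.

(* F is the polynomial superalgebra A[x_1..x_n | y_1..y_m], with the x_i even
   and the y_j odd. *)
Definition polynomial_superalgebra (k : fieldType) (A F : superAlgebra k)
    (f : saHom A F) (n m : nat) (x : 'I_n -> F) (y : 'I_m -> F) : Prop :=
  [/\ forall i, parity false (x i),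
      forall j, parity true (y j)
    & forall (C : superAlgebra k) (g : saHom A C)
             (c : 'I_n -> C) (d : 'I_m -> C),
        (forall i, parity false (c i)) -> (forall j, parity true (d j)) ->
      let extends (h : saHom F C) :=
        [/\ forall a, h (f a) = g a, forall i, h (x i) = c i
          & forall j, h (y j) = d j] in
      exists h : saHom F C, extends h /\ forall h', extends h' -> h' =1 h].

Definition finitely_presented (k : fieldType) (A B : superAlgebra k)
    (f : saHom A B) : Prop :=
  exists (F : superAlgebra k) (u : saHom A F) (n m : nat)
         (x : 'I_n -> F) (y : 'I_m -> F) (v : saHom F B),
  [/\ polynomial_superalgebra u x y,
      forall a, v (u a) = f a,
      forall b, exists z, v z = b
    & exists (l : nat) (g : 'I_l -> F), forall z,
        v z = 0 <-> exists a : 'I_l -> F, z = \sum_(i < l) a i * g i].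

Definition fppf (k : fieldType) (A B : superAlgebra k) (f : saHom A B) : Prop :=
  faithfully_flat f /\ finitely_presented f.

(* Q is the fppf sheafification of A |-> G(A)/N(A).  As Q is representable it is
   already a sheaf, so the condition is that the map of presheaves G/N -> Q is
   injective and locally surjective. *)
Definition is_quotient (k : fieldType) (G Q : supergroup k)
    (N : subfunctor G) (q : sgHom G Q) : Prop :=
  (forall (A : superAlgebra k) (g : G A), q A g = 1%g <-> N A g) /\
  (forall (A : superAlgebra k) (x : Q A),
     exists (B : superAlgebra k) (f : saHom A B) (g : G B),
       fppf f /\ q B g = gf_map f x).

(* The coordinate description of the quotient by the first Frobenius kernel:
   k[Q] is the subalgebra of p-th powers in k[G]. *)
Definition is_frobenius_quotient (k : fieldType) (p : nat)
    (G Q : supergroup k) (q : sgHom G Q) : Prop :=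
  [/\ ordinary Q,
      forall (A : superAlgebra k) (g : G A),
        q A g = 1%g <-> frobenius_kernel p g,
      injective (comorphism q)
    & forall x : coord_alg G,
        (exists a, comorphism q a = x) <-> (exists f, x = f ^+ p)].

(* k[P] is the largest separable subalgebra of k[H]. *)
Definition is_component_group (k : fieldType) (H P : supergroup k)
    (r : sgHom H P) : Prop :=
  [/\ etale P,
      injective (comorphism r)
    & forall (S : algType k) (s : {lrmorphism S -> coord_alg H}),
        separable_algebra S -> injective s ->
        forall a, exists b, comorphism r b = s a].

(* The isomorphism from the semidirect product to G is required to carry the
   canonical inclusion of N and the canonical projection onto P to the given
   maps i and q. *)
Definition is_semidirect_product (k : fieldType) (N P G : supergroup k)
    (i : sgHom N G) (q : sgHom G P) : Prop :=
  exists (act : forall A : superAlgebra k, P A -> N A -> N A)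
         (theta : forall A : superAlgebra k, N A * P A -> G A),
  [/\ [/\ forall A (n : N A), act A 1%g n = n,
          forall A (h h' : P A) (n : N A),
            act A (h * h')%g n = act A h (act A h' n),
          forall A (h : P A) (n n' : N A),
            act A h (n * n')%g = (act A h n * act A h n')%g
        & forall A B (f : saHom A B) (h : P A) (n : N A),
            gf_map f (act A h n) = act B (gf_map f h) (gf_map f n)],
      [/\ forall A, bijective (@theta A),
          forall A B (f : saHom A B) (n : N A) (h : P A),
            gf_map f (theta A (n, h)) = theta B (gf_map f n, gf_map f h)
        & forall A (n n' : N A) (h h' : P A),
            theta A (n * act A h n', h * h')%g =
            (theta A (n, h) * theta A (n', h'))%g],
      forall A (n : N A), theta A (n, 1%g) = i A n
    & forall A (n : N A) (h : P A), q A (theta A (n, h)) = h].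

(* Main.v *)
(* Let O = k[G] and let R be the intersection of the subalgebras O^(p^n).  As intersections
   of subspaces commute with tensor products over k, R is an even Hopf subalgebra of O, and
   P = Spec R is the component group.

   Because k is perfect, O^p is a finitely generated commutative algebra, hence noetherian,
   and the Frobenius is bijective on R.  The ideals generated by successive p-th roots of
   x in R stabilise, so x generates an ideal generated by an idempotent; by noetherianity
   again there is an idempotent e of R with x e = eps(x) e for all x in R.  Cutting O by e
   gives G^0, and for points u, g of P the idempotent (u g^-1)(e) is the locus where they
   agree.  Points over finite extensions of k, which exist by the Nullstellensatz, are
   linearly independent on R and bounded in number by the length of the coproduct of e;
   a maximal family over a finite extension L therefore meets all components.  It follows
   that R is finite-dimensional and separable, and that every A-point of P lifts to G over
   the fppf cover A -> A (x) L, by gluing the chosen points along these idempotents.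

   A representing quotient Q of G by its Frobenius kernel has k[Q] containing O^p by
   faithfully flat descent; R lies in k[Q], and contains every separable subalgebra of it
   since separable algebras over k are perfect.

   If G is finite, then R = O^(p^n) for large n, and f |-> (f^(p^n))^(1/p^n) is a Hopf
   retraction of O onto R; it splits G -> P, and it forces G^0 to be infinitesimal. *)
Require Import Defs.
From HB Require Import structures.
From mathcomp Require Import all_boot all_order all_algebra all_field.
From mathcomp Require Import generic_quotient boolp classical_sets ring.

Set Implicit Arguments.
Unset Strict Implicit.
Unset Printing Implicit Defensive.

Import GRing.Theory.
Local Open Scope ring_scope.

(** * Superalgebras *)

(** The assumption [p > 2] enters through odd elements: they square to zero, so a p-th power depends
    on the even part alone, and raising to the p-th power is additive and multiplicative although
    the algebra is not commutative. The p-th powers thus form a commutative algebra to which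
    Hilbert's basis theorem and the Nullstellensatz apply; points of the superalgebra itself are
    recovered by extracting p-th roots in finite extensions of [k], which are again perfect. An
    algebraic closure would give all points at once, but need not give a finitely presented cover. A
    finite separable extension has a primitive element, so [A (x) L] is free over [A] on its powers
    and is presented by its minimal polynomial. Tensor products are needed over an arbitrary base,
    not only over [k]: a representing quotient [Q] comes with an unspecified flat cover [B], and
    descending p-th powers from it takes place in [B (x) B] and [B (x) k[G]] over [k[Q]]. Identities
    between points are checked on universal points, in algebras that embed into tensor powers of
    [k[G]] or on which the Frobenius is injective. *)

Section SuperBasics.
Variables (k : fieldType) (A : superAlgebra k).
Implicit Types (a b : A) (i j : bool).

Lemma parityZ i (c : k) a : parity i a -> parity i (c *: a).
Proof. by move=> pa; rewrite -[_ *: _]addr0; apply/parity_lin/parity0. Qed.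

Lemma parityD i a b : parity i a -> parity i b -> parity i (a + b).
Proof. by rewrite -[X in X + b]scale1r; apply: parity_lin. Qed.

Lemma parityN i a : parity i a -> parity i (- a).
Proof. by rewrite -scaleN1r; apply: parityZ. Qed.

Lemma parity_sum i (I : Type) (r : seq I) (P : pred I) (F : I -> A) :
  (forall x, P x -> parity i (F x)) -> parity i (\sum_(x <- r | P x) F x).
Proof. by move=> PF; elim/big_ind: _ => //; [exact: parity0 | exact: parityD]. Qed.

Fact spart_ex a : exists f : bool -> A,
  (forall i, parity i (f i)) /\ a = f false + f true.
Proof.
have [a0 [a1 [p0 p1 ->]]] := parity_split a.
by exists (fun i => if i then a1 else a0); split=> // -[].
Qed.

Definition spart i a : A := projT1 (cid (spart_ex a)) i.

Lemma spart_parity i a : parity i (spart i a).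
Proof. by rewrite /spart; case: cid => f []. Qed.

Lemma spartE a : a = spart false a + spart true a.
Proof. by rewrite /spart; case: cid => f []. Qed.

Lemma spart_unique a (f : bool -> A) : (forall i, parity i (f i)) ->
  a = f false + f true -> forall i, spart i a = f i.
Proof.
move=> pf; rewrite {1}(spartE a) => /eqP; rewrite -subr_eq0 => /eqP e.
have e' : spart false a - f false = f true - spart true a.
  by apply/eqP; rewrite -subr_eq0 -e opprB addrACA -opprD.
have p0 : parity false (spart false a - f false).
  by apply: parityD; [exact: spart_parity | apply: parityN].
have p1 : parity true (f true - spart true a).
  by apply: parityD => //; apply: parityN; exact: spart_parity.
have z : spart false a - f false = 0 by apply: parity_direct => //; rewrite e'.
move: (z); rewrite {1}e' => /eqP; rewrite subr_eq0 => /eqP z1.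
by case; [rewrite z1 | apply/eqP; rewrite -subr_eq0 z].
Qed.

Lemma spart_id i a : parity i a -> spart i a = a.
Proof.
move=> pa; rewrite (@spart_unique a (fun j => if i == j then a else 0)) ?eqxx //.
  by move=> j; case: eqP => [<-|_] //; exact: parity0.
by case: i {pa}; rewrite ?add0r ?addr0.
Qed.

Lemma spart_neg i a : parity i a -> spart (~~ i) a = 0.
Proof.
move=> pa; rewrite (@spart_unique a (fun j => if i == j then a else 0)).
- by case: i {pa}.
- by move=> j; case: eqP => [<-|_] //; exact: parity0.
- by case: i {pa}; rewrite ?add0r ?addr0.
Qed.

Fact spart_is_linear i : linear (spart i).
Proof.
move=> c a b; apply: (@spart_unique _ (fun i => c *: spart i a + spart i b)).
  by move=> j; apply: parity_lin; exact: spart_parity.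
by rewrite {1}(spartE a) {1}(spartE b) scalerDr addrACA.
Qed.
HB.instance Definition _ i := GRing.isLinear.Build k A A *:%R (spart i)
  (spart_is_linear i).

Lemma even_central a b : parity false a -> a * b = b * a.
Proof.
move=> pa; rewrite (spartE b) mulrDr mulrDl.
by congr (_ + _); rewrite (super_comm pa (spart_parity _ _)) expr0 mul1r.
Qed.

Lemma parity_exp a n : parity false a -> parity false (a ^+ n).
Proof.
move=> pa; elim: n => [|n IH]; first by rewrite expr0; exact: parity1.
by rewrite exprS; have := parityM pa IH.
Qed.

Lemma odd_sqr a : (2 : k) != 0 -> parity true a -> a * a = 0.
Proof.
move=> two pa; have := super_comm pa pa; rewrite /= expr1 mulN1r => /eqP.
rewrite -addr_eq0 -mulr2n -scaler_nat scaler_eq0 (negPf two) /=.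
by move/eqP.
Qed.

(* a s(b), where s is the parity involution *)
Lemma oddM_spart a b : parity true a ->
  a * b = (spart false b - spart true b) * a.
Proof.
move=> pa; rewrite {1}(spartE b) mulrDr mulrDl mulNr.
rewrite (super_comm pa (spart_parity false b)) expr0 mul1r.
by rewrite (super_comm pa (spart_parity true b)) expr1 mulN1r.
Qed.

End SuperBasics.

Lemma saHom_spart (k : fieldType) (A B : superAlgebra k) (f : saHom A B) i a :
  spart i (f a) = f (spart i a).
Proof.
apply: (@spart_unique _ _ _ (fun i => f (spart i a))).
  by move=> j; apply/sa_parity/spart_parity.
by rewrite -raddfD -spartE.
Qed.

Lemma saHom_ext (k : fieldType) (A B : superAlgebra k) (f g : saHom A B) :
  f =1 g -> f = g.
Proof.
case: f g => [f lf mf pf] [g lg mg pg] /= /funext fg; case: _ / fg in lg mg pg *.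
by congr SaHom; exact: Prop_irrelevance.
Qed.

Lemma saHom_inj_parity (k : fieldType) (A B : superAlgebra k) (f : saHom A B) :
  injective f -> forall i a, parity i (f a) -> parity i a.
Proof.
move=> injf i a pa; suff -> : a = spart i a by exact: spart_parity.
by apply: injf; rewrite -saHom_spart spart_id.
Qed.

Section SaHomOps.
Variables (k : fieldType) (A B : superAlgebra k) (f : saHom A B).
Lemma saHomZ c a : f (c *: a) = c *: f a. Proof. exact: linearZ. Qed.
Lemma saHomM a b : f (a * b) = f a * f b. Proof. exact: rmorphM. Qed.
Lemma saHomD a b : f (a + b) = f a + f b. Proof. exact: raddfD. Qed.
Lemma saHom_sum (I : Type) (r : seq I) (P : pred I) F :
  f (\sum_(i <- r | P i) F i) = \sum_(i <- r | P i) f (F i).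
Proof. exact: raddf_sum. Qed.
Lemma saHomX a n : f (a ^+ n) = f a ^+ n. Proof. exact: rmorphXn. Qed.
End SaHomOps.

(** * Maximal proper submodules and separating functionals *)

Section Separation.
Variables (R : nzRingType) (V : lmodType R).

Definition submod (W : V -> Prop) :=
  W 0 /\ forall (c : R) x y, W x -> W y -> W (c *: x + y).

Lemma submodD W : submod W -> forall x y, W x -> W y -> W (x + y).
Proof. by move=> [_ h] x y Wx Wy; rewrite -[x]scale1r; apply: h. Qed.
Lemma submodZ W : submod W -> forall c x, W x -> W (c *: x).
Proof. by move=> [h0 h] c x Wx; rewrite -[_ *: _]addr0; apply: h. Qed.
Lemma submodN W : submod W -> forall x, W x -> W (- x).
Proof. by move=> sW x Wx; rewrite -scaleN1r; apply: submodZ. Qed.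
Lemma submodB W : submod W -> forall x y, W x -> W y -> W (x - y).
Proof. by move=> sW x y Wx Wy; apply/(submodD sW) => //; apply: submodN. Qed.
Lemma submod_sum W : submod W -> forall (I : Type) (r : seq I) (P : pred I) F,
  (forall i, P i -> W (F i)) -> W (\sum_(i <- r | P i) F i).
Proof.
by move=> sW I r P F h; elim/big_ind: _ => //; [case: sW | exact: submodD].
Qed.

(** By Zorn, [M] is maximal among the submodules that contain [W] and avoid [v], so adjoining any
    further [x] captures [v]. Over a field this gives a hyperplane; over a commutative ring with
    [v = 1] it gives a maximal ideal. *)
Lemma maximal_submod (W : V -> Prop) (v : V) : submod W -> ~ W v ->
  exists M : V -> Prop, [/\ submod M, forall x, W x -> M x, ~ M v
    & forall x, ~ M x -> exists c y, M y /\ v = c *: x + y].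
Proof.
move=> sW Wv.
pose good (X : set V) := X = set0 \/ [/\ submod X, W `<=` X & ~ X v]%classic.
have [F Fg totF|M [gM maxM]] := @Zorn_bigcup V good.
  have [[X [FX nX]]|h] := pselect (exists X, F X /\ X <> set0); last first.
    left; apply/seteqP; split=> // x [X FX Xx]; apply: h; exists X; split=> // X0.
    by rewrite X0 in Xx.
  right; have [//|[sX WX Xv]] := Fg _ FX; split; last first.
  - by move=> [Y FY Yv]; have [Y0|[]//] := Fg _ FY; rewrite Y0 in Yv.
  - by move=> x Wx; exists X => //; exact: WX.
  split; first by exists X => //; case: sX.
  move=> c x y [X1 F1 X1x] [X2 F2 X2y].
  have [X0|[s1 _ _]] := Fg _ F1; first by rewrite X0 in X1x.
  have [X0|[s2 _ _]] := Fg _ F2; first by rewrite X0 in X2y.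
  have [h|h] := totF _ _ F1 F2.
    by exists X2 => //; apply: s2.2 => //; exact: h.
  by exists X1 => //; apply: s1.2 => //; exact: h.
have gW : good W by right; split.
have [sM WM Mv] : [/\ submod M, W `<=` M & ~ M v]%classic.
  case: gM => // M0; exfalso; apply: (maxM W) => //; rewrite M0.
  split=> // /(_ 0); case: sW => W0 _ h; exact: h.
exists M; split=> // x Mx; apply: contrapT => h.
pose N z := exists c y, M y /\ z = c *: x + y.
have MN z : M z -> N z by move=> Mz; exists 0, z; rewrite scale0r add0r.
have Nx : N x by exists 1, 0; rewrite scale1r addr0; split=> //; exact: sM.1.
apply: (maxM N); first by split=> // NM; exact/Mx/NM.
right; split=> [|y /WM /MN //|Nv]; last exact: h.
split; first exact/MN/sM.1.
move=> d z z' [c [y [My ->]]] [c' [y' [My' ->]]].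
exists (d * c + c'), (d *: y + y'); split; first exact: sM.2.
by rewrite scalerDr scalerA scalerDl addrACA.
Qed.

End Separation.

(** A maximal [M] avoiding [v] is a complement of the line [k v], and [f] is the coordinate along
    [v]. *)
Lemma separation (k : fieldType) (V : lmodType k) (W : V -> Prop) (v : V) :
  submod W -> ~ W v ->
  exists f : {linear V -> k^o}, (forall x, W x -> f x = 0) /\ f v = 1.
Proof.
move=> sW Wv; have [M [sM WM Mv maxM]] := maximal_submod sW Wv.
have ex x : exists c : k, M (x - c *: v).
  have [Mx|Mx] := pselect (M x); first by exists 0; rewrite scale0r subr0.
  have [c [y [My e]]] := maxM x Mx.
  have c0 : c != 0.
    by apply/eqP => c0; apply: Mv; rewrite e c0 scale0r add0r.
  exists c^-1; rewrite e scalerDr scalerA mulVf // scale1r opprD addNKr.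
  exact/(submodN sM)/(submodZ sM).
have uniq x c c' : M (x - c *: v) -> M (x - c' *: v) -> c = c'.
  move=> h h'; have := submodB sM h' h.
  rewrite opprB addrC addrA subrK -scalerBl => h2.
  apply/eqP; rewrite -subr_eq0; apply/eqP; apply: contrapT => /eqP n0.
  by apply: Mv; have := submodZ sM (c - c')^-1 h2; rewrite scalerA mulVf // scale1r.
pose f x : k^o := projT1 (cid (ex x)).
have fP x : M (x - f x *: v) by rewrite /f; case: cid.
have lf : linear f.
  move=> c x y; apply: (uniq (c *: x + y)) => //.
  rewrite (_ : _ - _ = c *: (x - f x *: v) + (y - f y *: v)); first exact: sM.2.
  by rewrite scalerBr scalerA addrACA scalerDl opprD.
pose F : {linear V -> k^o} := HB.pack f (GRing.isLinear.Build k V k^o *:%R f lf).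
exists F; split=> [x Wx|].
  by apply: (uniq x) => //=; rewrite scale0r subr0; exact: WM.
by apply: (uniq v) => //=; rewrite scale1r subrr; exact: sM.1.
Qed.

(** * Tensor products *)

Section TensorModule.
Local Open Scope quotient_scope.
Variables (k : fieldType) (A B : superAlgebra k) (f : saHom A B) (M : lmodType A).

Definition fsum (U : zmodType) (u : B -> M -> U) (s : seq (B * M)) : U :=
  \sum_(x <- s) u x.1 x.2.

(* Formal sums are identified when all balanced maps agree on them, so that the universal
   property holds by construction. *)
Definition trel : rel (seq (B * M)) := fun s s' =>
  `[< forall (U : zmodType) (u : B -> M -> U), balanced f u ->
        fsum u s = fsum u s' >].

Fact trel_refl : reflexive trel. Proof. by move=> s; apply/asboolP. Qed.
Fact trel_sym : symmetric trel.
Proof.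
by move=> s t; apply/asboolP/asboolP => h U u bu; rewrite h.
Qed.
Fact trel_trans : transitive trel.
Proof.
move=> s t r /asboolP h1 /asboolP h2; apply/asboolP => U u bu.
by rewrite h1 // h2.
Qed.
Canonical trel_equiv := EquivRel trel trel_refl trel_sym trel_trans.

Definition tensor := {eq_quot trel}.
HB.instance Definition _ := Choice.on tensor.
HB.instance Definition _ := EqQuotient.on tensor.

Lemma tensor_eqP (s t : seq (B * M)) :
  (forall (U : zmodType) (u : B -> M -> U), balanced f u -> fsum u s = fsum u t)
  <-> \pi_tensor s = \pi_tensor t.
Proof.
split=> [h|/eqmodP/asboolP //]; by apply/eqmodP/asboolP.
Qed.

Lemma fsum_repr (U : zmodType) (u : B -> M -> U) s : balanced f u ->
  fsum u (repr (\pi_tensor s)) = fsum u s.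
Proof. by move=> bu; apply (tensor_eqP _ s) => //; rewrite reprK. Qed.

Lemma balanced0l (U : zmodType) (u : B -> M -> U) m : balanced f u -> u 0 m = 0.
Proof. by case=> h _ _; apply/(addIr (u 0 m)); rewrite -h !add0r. Qed.
Lemma balanced0r (U : zmodType) (u : B -> M -> U) b : balanced f u -> u b 0 = 0.
Proof. by case=> _ h _; apply/(addIr (u b 0)); rewrite -h !add0r. Qed.
Lemma balancedNl (U : zmodType) (u : B -> M -> U) b m :
  balanced f u -> u (- b) m = - u b m.
Proof.
move=> bu; case: (bu) => h _ _; apply/(addIr (u b m)).
by rewrite -h !addNr (balanced0l _ bu).
Qed.

Definition tzero : tensor := \pi_tensor [::].
Definition tadd (x y : tensor) : tensor := \pi_tensor (repr x ++ repr y).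
Definition topp (x : tensor) : tensor :=
  \pi_tensor [seq (- y.1, y.2) | y <- repr x].

Lemma fsum_cat (U : zmodType) (u : B -> M -> U) s t :
  fsum u (s ++ t) = fsum u s + fsum u t.
Proof. by rewrite /fsum big_cat. Qed.

Lemma fsum_opp (U : zmodType) (u : B -> M -> U) s : balanced f u ->
  fsum u [seq (- y.1, y.2) | y <- s] = - fsum u s.
Proof.
move=> bu; rewrite /fsum big_map -sumrN; apply: eq_bigr => i _ /=.
exact: balancedNl.
Qed.

Fact taddA : associative tadd.
Proof.
move=> x y z; apply/tensor_eqP => U u bu.
by rewrite !fsum_cat !fsum_repr // !fsum_cat addrA.
Qed.
Fact taddC : commutative tadd.
Proof.
by move=> x y; apply/tensor_eqP => U u bu; rewrite !fsum_cat addrC.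
Qed.
Fact tadd0 : left_id tzero tadd.
Proof.
move=> x; rewrite -[RHS]reprK; apply/tensor_eqP => U u bu.
by rewrite fsum_cat fsum_repr // /fsum big_nil add0r.
Qed.
Fact taddN : left_inverse tzero topp tadd.
Proof.
move=> x; apply/tensor_eqP => U u bu.
by rewrite fsum_cat fsum_repr // fsum_opp // addNr /fsum big_nil.
Qed.
HB.instance Definition _ := GRing.isZmodule.Build tensor taddA taddC tadd0 taddN.

Definition tens (b : B) (m : M) : tensor := \pi_tensor [:: (b, m)].

Definition tlift (U : zmodType) (u : B -> M -> U) (x : tensor) : U :=
  fsum u (repr x).

Lemma tlift_tens (U : zmodType) (u : B -> M -> U) b m : balanced f u ->
  tlift u (tens b m) = u b m.
Proof. by move=> bu; rewrite /tlift fsum_repr // /fsum big_seq1. Qed.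

Lemma tliftD (U : zmodType) (u : B -> M -> U) x y : balanced f u ->
  tlift u (x + y) = tlift u x + tlift u y.
Proof. by move=> bu; rewrite /tlift fsum_repr // fsum_cat. Qed.

Lemma tlift0 (U : zmodType) (u : B -> M -> U) : balanced f u -> tlift u 0 = 0.
Proof. by move=> bu; rewrite /tlift fsum_repr // /fsum big_nil. Qed.

Lemma eq_tlift (U : zmodType) (u v : B -> M -> U) x :
  (forall b m, u b m = v b m) -> tlift u x = tlift v x.
Proof. by move=> h; apply: eq_bigr => i _; exact: h. Qed.

Lemma tlift_add (U : zmodType) (u v : B -> M -> U) x :
  tlift (fun b m => u b m + v b m) x = tlift u x + tlift v x.
Proof. exact: big_split. Qed.

Lemma balanced_tens : balanced f tens.
Proof.
have addE (x y : tensor) : x + y = tadd x y by [].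
split=> [b b' m|b m m'|b a m]; rewrite ?addE; apply/tensor_eqP => U u bu;
  by rewrite ?fsum_cat ?fsum_repr // /fsum !big_seq1 /=; case: bu.
Qed.

Lemma tensorE (x : tensor) : x = \sum_(y <- repr x) tens y.1 y.2.
Proof.
rewrite -[LHS]reprK; elim: (repr x) => [|[b m] s IH]; first by rewrite big_nil.
rewrite big_cons -IH; have addE (y z : tensor) : y + z = tadd y z by [].
rewrite addE; apply/tensor_eqP => U u bu.
by rewrite fsum_cat !fsum_repr // /fsum big_cons big_seq1.
Qed.

Lemma tensor_ind (P : tensor -> Prop) : P 0 ->
  (forall x y, P x -> P y -> P (x + y)) -> (forall b m, P (tens b m)) ->
  forall x, P x.
Proof. by move=> P0 PD Pt x; rewrite (tensorE x); elim/big_ind: _. Qed.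

Lemma tlift_additive (U : zmodType) (u : B -> M -> U) : balanced f u ->
  exists h : {additive tensor -> U}, h =1 tlift u.
Proof.
move=> bu; have hz : zmod_morphism (tlift u).
  move=> x y; apply/eqP; rewrite eq_sym subr_eq.
  by rewrite -(tliftD _ _ bu) subrK.
pose F : {additive tensor -> U} :=
  HB.pack (tlift u) (GRing.isZmodMorphism.Build tensor U (tlift u) hz).
by exists F.
Qed.

Lemma tensor_is_tensor : is_tensor f tens.
Proof.
split=> [|U u bu]; first exact: balanced_tens.
have [h hE] := tlift_additive bu; exists h; split=> [b m|h' h'E x].
  by rewrite hE tlift_tens.
by elim/tensor_ind: x => [|x y IHx IHy|b m];
  rewrite ?raddf0 ?raddfD ?IHx ?IHy // h'E hE tlift_tens.
Qed.

End TensorModule.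

(** * Submodules, quotient modules and faithful flatness *)

Section SubModule.
Variables (R : nzRingType) (V : lmodType R) (W : V -> Prop) (sW : submod W).

Definition smod_pred of submod W : {pred V} := [pred x | `[< W x >]].
Fact smod_pred_closed : submod_closed (smod_pred sW).
Proof.
split; first by apply/asboolP; exact: sW.1.
by move=> c x y /asboolP Wx /asboolP Wy; apply/asboolP; exact: sW.2.
Qed.
HB.instance Definition _ := GRing.isSubmodClosed.Build R V (smod_pred sW)
  smod_pred_closed.
Definition smod := {x : V | smod_pred sW x}.
HB.instance Definition _ := SubType.on smod.
HB.instance Definition _ := Choice.on smod.
HB.instance Definition _ := [SubChoice_isSubLmodule of smod by <:].

Lemma smodP (x : smod) : W (val x). Proof. exact/asboolP/(valP x). Qed.
Lemma smod_ex x : W x -> exists y : smod, val y = x.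
Proof. by move=> /asboolP Wx; exists (exist _ x Wx). Qed.
End SubModule.

Section QuotModule.
Local Open Scope quotient_scope.
Variables (R : nzRingType) (V : lmodType R) (W : V -> Prop) (sW : submod W).

Definition qrel of submod W : rel V := fun x y => `[< W (x - y) >].
Fact qrel_refl : reflexive (qrel sW).
Proof. by move=> x; apply/asboolP; rewrite subrr; exact: sW.1. Qed.
Fact qrel_sym : symmetric (qrel sW).
Proof.
by move=> x y; apply/asboolP/asboolP => h; rewrite -opprB; exact: submodN.
Qed.
Fact qrel_trans : transitive (qrel sW).
Proof.
move=> y x z /asboolP h1 /asboolP h2; apply/asboolP.
by rewrite -(subrK y x) -addrA; exact: submodD.
Qed.
Canonical qrel_equiv := EquivRel (qrel sW) qrel_refl qrel_sym qrel_trans.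
Definition qmod := {eq_quot qrel sW}.
HB.instance Definition _ := Choice.on qmod.
HB.instance Definition _ := EqQuotient.on qmod.

Lemma qmod_eq x y : \pi_qmod x = \pi_qmod y <-> W (x - y).
Proof. by split=> [/eqmodP/asboolP|h]; [|apply/eqmodP/asboolP]. Qed.
Lemma qmod_repr x : W (repr (\pi_qmod x) - x).
Proof. by apply/qmod_eq; rewrite reprK. Qed.

Definition qadd (x y : qmod) : qmod := \pi_qmod (repr x + repr y).
Definition qopp (x : qmod) : qmod := \pi_qmod (- repr x).
Definition qscale (c : R) (x : qmod) : qmod := \pi_qmod (c *: repr x).
Lemma qaddE x y : qadd (\pi_qmod x) (\pi_qmod y) = \pi_qmod (x + y).
Proof. by apply/qmod_eq; rewrite opprD addrACA; apply: submodD => //; exact: qmod_repr. Qed.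
Lemma qoppE x : qopp (\pi_qmod x) = \pi_qmod (- x).
Proof. by apply/qmod_eq; rewrite -opprD; apply: submodN => //; exact: qmod_repr. Qed.
Lemma qscaleE c x : qscale c (\pi_qmod x) = \pi_qmod (c *: x).
Proof. by apply/qmod_eq; rewrite -scalerBr; apply: submodZ => //; exact: qmod_repr. Qed.

Fact qaddA : associative qadd.
Proof.
move=> x y z; rewrite -[x]reprK -[y]reprK -[z]reprK.
move: (repr x) (repr y) (repr z) => {x y z} x y z.
by rewrite (qaddE y z) (qaddE x (y + z)) (qaddE x y) (qaddE (x + y) z) addrA.
Qed.
Fact qaddC : commutative qadd.
Proof.
move=> x y; rewrite -[x]reprK -[y]reprK; move: (repr x) (repr y) => {x y} x y.
by rewrite (qaddE x y) (qaddE y x) addrC.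
Qed.
Fact qadd0 : left_id (\pi_qmod 0) qadd.
Proof. by move=> x; rewrite -[x]reprK (qaddE 0 (repr x)) add0r. Qed.
Fact qaddN : left_inverse (\pi_qmod 0) qopp qadd.
Proof.
move=> x; rewrite -[x]reprK; move: (repr x) => {}x.
by rewrite (qoppE x) (qaddE (- x) x) addNr.
Qed.
HB.instance Definition _ := GRing.isZmodule.Build qmod qaddA qaddC qadd0 qaddN.
Fact qscaleA c d v : qscale c (qscale d v) = qscale (c * d) v.
Proof.
rewrite -[v]reprK; move: (repr v) => {}v.
by rewrite (qscaleE d v) (qscaleE c (d *: v)) (qscaleE (c * d) v) scalerA.
Qed.
Fact qscale1 : left_id 1 qscale.
Proof. by move=> x; rewrite -[x]reprK (qscaleE 1 (repr x)) scale1r. Qed.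
Fact qscaleDr : right_distributive qscale +%R.
Proof.
move=> c x y; rewrite -[x]reprK -[y]reprK; move: (repr x) (repr y) => {x y} x y.
rewrite -[_ + _]/(qadd (\pi_qmod x) (\pi_qmod y)) (qaddE x y) (qscaleE c (x + y)).
by rewrite (qscaleE c x) (qscaleE c y) scalerDr -(qaddE (c *: x) (c *: y)).
Qed.
Fact qscaleDl v : {morph qscale^~ v : a b / a + b}.
Proof.
move=> c d; rewrite -[v]reprK; move: (repr v) => {}v /=.
by rewrite (qscaleE (c + d) v) (qscaleE c v) (qscaleE d v) scalerDl
  -(qaddE (c *: v) (d *: v)).
Qed.
HB.instance Definition _ := GRing.Zmodule_isLmodule.Build R qmod
  qscaleA qscale1 qscaleDr qscaleDl.

Lemma qmod_ex : exists h : {linear V -> qmod},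
  (forall x, h x = 0 <-> W x) /\ forall y, exists x, h x = y.
Proof.
have hl : linear (fun x => \pi_qmod x : qmod).
  move=> c x y; by rewrite -(qaddE (c *: x) y) -(qscaleE c x).
pose F : {linear V -> qmod} := HB.pack (fun x => \pi_qmod x : qmod)
  (GRing.isLinear.Build R V qmod *:%R (fun x => \pi_qmod x : qmod) hl).
exists F; split=> [x|]; last by move=> y; exists (repr y); exact: reprK.
by rewrite -[X in W X]subr0; exact: qmod_eq.
Qed.
End QuotModule.

(** The submodule [N = A v] has [B (x) N = 0]: by flatness this tensor product embeds into
    [B (x) V], where its generators become [b f(a) (x) v = 0]. Faithfulness then gives [N = 0]. *)
Lemma faithfully_flat_inj (k : fieldType) (A B : superAlgebra k) (f : saHom A B)
    (V : lmodType A) (v : V) :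
  faithfully_flat f -> tens f 1 v = 0 -> v = 0.
Proof.
move=> [fl ff] v0.
have sW : submod (fun x => exists a : A, x = a *: v).
  split; first by exists 0; rewrite scale0r.
  by move=> c _ _ [a ->] [b ->]; exists (c * a + b); rewrite scalerDl scalerA.
pose N := smod sW; pose j : {linear N -> V} := val.
have bu : balanced f (fun b (m : N) => tens f b (j m)).
  case: (balanced_tens f V) => h1 h2 h3.
  by split=> *; rewrite ?raddfD ?linearZ ?h1 ?h2 ?h3.
have [h hE] := tlift_additive bu.
have hinj : injective h.
  apply: (fl _ _ j val_inj _ _ _ _ (tensor_is_tensor f N) (tensor_is_tensor f V)).
  by move=> b m; rewrite hE tlift_tens.
(* Left multiplication by [b] is well defined on the tensor product, so [1 (x) v = 0] propagates to
   every [b (x) v]. *)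
have lmul b : balanced f (fun b' (m : V) => tens f (b * b') m).
  case: (balanced_tens f V) => h1 h2 h3.
  by split=> *; rewrite ?mulrDr ?mulrA ?h1 ?h2 ?h3.
have T0 : forall z : tensor f N, z = 0.
  move=> z; apply: hinj; rewrite raddf0.
  elim/tensor_ind: z => [|x y IHx IHy|b m]; rewrite ?raddf0 ?raddfD ?IHx ?IHy ?addr0 //.
  rewrite hE tlift_tens //; have [a e] := smodP m; rewrite [j m]e.
  case: (balanced_tens f V) => _ _ <-.
  have [g gE] := tlift_additive (lmul (b * f a)).
  by have := gE (tens f 1 v); rewrite tlift_tens // mulr1 v0 raddf0.
have [w we] := smod_ex sW (ex_intro _ 1 (esym (scale1r v))).
by rewrite -we (ff _ _ _ (tensor_is_tensor f N) T0 w) raddf0.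
Qed.

Lemma faithfully_flat_injective (k : fieldType) (A B : superAlgebra k) (f : saHom A B) :
  faithfully_flat f -> injective f.
Proof.
move=> ff; apply: raddf_inj => a fa.
apply: (faithfully_flat_inj (V := A^o) ff).
case: (balanced_tens f A^o) => _ _ h.
have := h 1 a 1; rewrite mul1r fa => e.
rewrite -[a : A^o]mulr1 -[a * 1]/(a *: (1 : A^o)) -e.
exact: balanced0l (balanced_tens f _).
Qed.

(** * Tensor products of superalgebras *)

Section ParityInvolution.
Variables (k : fieldType) (A : superAlgebra k).

Lemma spartM i (a b : A) :
  spart i (a * b) = spart false a * spart i b + spart true a * spart (~~ i) b.
Proof.
pose F i := spart false a * spart i b + spart true a * spart (~~ i) b.
apply: (@spart_unique _ _ _ F) => [j|]; rewrite /F.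
  have := parityM (spart_parity false a) (spart_parity j b).
  have := parityM (spart_parity true a) (spart_parity (~~ j) b).
  by rewrite /= negbK; exact: (fun h1 h2 => parityD h2 h1).
rewrite [in LHS](spartE a) [in LHS](spartE b) mulrDl !mulrDr.
by rewrite [X in _ + X]addrC addrACA.
Qed.

(** The [j]-th power of the sign automorphism. The index is the parity of the element being moved
    past, so that Koszul signs need no case analysis; see [pinv_comm]. *)
Definition pinv (j : bool) (a : A) : A :=
  spart false a + (if j then - spart true a else spart true a).

Fact pinv_is_linear j : linear (pinv j).
Proof.
move=> c a b; rewrite /pinv !linearP /= scalerDr -addrA [RHS]addrACA addrA.
by case: j; rewrite ?scalerN ?opprD.
Qed.
HB.instance Definition _ j := GRing.isLinear.Build k A A *:%R (pinv j)
  (pinv_is_linear j).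

Lemma pinv_false a : pinv false a = a.
Proof. by rewrite /pinv -spartE. Qed.

Lemma spart_pinv i j a : spart i (pinv j a) = if i && j then - spart i a else spart i a.
Proof.
have sj : parity true (if j then - spart true a else spart true a).
  by case: j; [apply: parityN|]; exact: spart_parity.
rewrite /pinv raddfD /=; case: i; rewrite ?(spart_id sj) ?(spart_neg sj).
  by rewrite (spart_neg (spart_parity false a)) add0r.
by rewrite spart_id ?addr0 //; exact: spart_parity.
Qed.

Lemma pinvM j a b : pinv j (a * b) = pinv j a * pinv j b.
Proof.
apply/esym; rewrite [LHS]spartE !spartM !spart_pinv /pinv !spartM /=.
by case: j; rewrite ?mulrNN ?mulrN ?mulNr // opprD.
Qed.

Lemma pinv1 j : pinv j 1 = 1.
Proof.
rewrite /pinv (spart_id (parity1 A)) (spart_neg (parity1 A)).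
by case: j; rewrite ?oppr0 addr0.
Qed.

Lemma pinv_comp i j a : pinv i (pinv j a) = pinv (i (+) j) a.
Proof.
rewrite {1}/pinv !spart_pinv /= /pinv.
by case: i; case: j; rewrite ?opprK.
Qed.

Lemma pinv_parity i j a : parity i a -> pinv j a = (-1) ^+ (i && j) * a.
Proof.
rewrite mulr_sign => pa; case: i pa => pa; rewrite /pinv (spart_id pa).
  by rewrite (spart_neg pa) add0r.
by rewrite (spart_neg pa); case: j; rewrite ?oppr0 addr0.
Qed.

Lemma parity_pinv i j a : parity i a -> parity i (pinv j a).
Proof.
move=> pa; rewrite (pinv_parity _ pa) mulr_sign.
by case: ifP => // _; exact: parityN.
Qed.

Lemma pinv_comm j a b : parity j b -> b * a = pinv j a * b.
Proof.
case: j => pb; last by rewrite pinv_false even_central.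
exact: oddM_spart.
Qed.
End ParityInvolution.

Lemma saHom_pinv (k : fieldType) (A B : superAlgebra k) (f : saHom A B) j a :
  f (pinv j a) = pinv j (f a).
Proof. by rewrite /pinv raddfD /= !saHom_spart; case: j; rewrite ?raddfN. Qed.

Section Restriction.
Variables (k : fieldType) (C B : superAlgebra k) (f : saHom C B).
(** A copy of [B] with the left [C]-module structure through [f], so that [tensor] applies to two
    superalgebras over [C]. *)
Definition restr of saHom C B : Type := B.
HB.instance Definition _ := GRing.Zmodule.on (restr f).
Definition rscale (c : C) (b : restr f) : restr f := (f c * (b : B))%R.
Fact rscaleA c d v : rscale c (rscale d v) = rscale (c * d) v.
Proof. by rewrite /rscale rmorphM mulrA. Qed.
Fact rscale1 : left_id 1 rscale.
Proof. by move=> x; rewrite /rscale rmorph1 mul1r. Qed.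
Fact rscaleDr : right_distributive rscale +%R.
Proof. by move=> c x y; rewrite /rscale mulrDr. Qed.
Fact rscaleDl v : {morph rscale^~ v : a b / a + b}.
Proof. by move=> c d; rewrite /rscale rmorphD mulrDl. Qed.
HB.instance Definition _ := GRing.Zmodule_isLmodule.Build C (restr f)
  rscaleA rscale1 rscaleDr rscaleDl.
End Restriction.

Section SuperTensor.
Variables (k : fieldType) (C B B' : superAlgebra k).
Variables (f : saHom C B) (f' : saHom C B').

Local Notation D := (tensor f (restr f')).
Definition pur (b : B) (b' : B') : D := tens f b (b' : restr f').

Lemma purDl b c b' : pur (b + c) b' = pur b b' + pur c b'.
Proof. by case: (balanced_tens f (restr f')) => h _ _; exact: h. Qed.
Lemma purDr b b' c' : pur b (b' + c') = pur b b' + pur b c'.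
Proof. by case: (balanced_tens f (restr f')) => _ h _; exact: h. Qed.
Lemma purM b c b' : pur (b * f c) b' = pur b (f' c * b').
Proof. by case: (balanced_tens f (restr f')) => _ _ h; exact: h. Qed.
Lemma pur0l b' : pur 0 b' = 0.
Proof. exact: (balanced0l _ (balanced_tens f _)). Qed.
Lemma pur0r b : pur b 0 = 0.
Proof. exact: (balanced0r _ (balanced_tens f _)). Qed.
Lemma purNl b b' : pur (- b) b' = - pur b b'.
Proof. exact: (balancedNl _ _ (balanced_tens f _)). Qed.
Lemma purNr b b' : pur b (- b') = - pur b b'.
Proof. by apply/(addIr (pur b b')); rewrite -purDr !addNr pur0r. Qed.

Lemma pur_ind (P : D -> Prop) : P 0 -> (forall x y, P x -> P y -> P (x + y)) ->
  (forall i j b b', parity i b -> parity j b' -> P (pur b b')) ->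
  forall x, P x.
Proof.
move=> P0 PD Ph; apply: tensor_ind => // b b'.
rewrite -/(pur b b') (spartE b) (spartE b') purDl !purDr.
have h i j := Ph i j _ _ (spart_parity i b) (spart_parity j b').
by apply: (PD); apply: (PD); apply: h.
Qed.

(** The product of [b (x) b'] and [a (x) a'] with its Koszul sign, written without homogeneity: the
    odd part of [b'] passes [a] at the cost of the sign automorphism. *)
Definition smul1 (b : B) (b' : B') (a : B) (a' : restr f') : D :=
  pur (b * a) (spart false b' * a') + pur (b * pinv true a) (spart true b' * a').

Definition smul (x y : D) : D :=
  tlift (fun b (b' : restr f') => tlift (smul1 b b') y) x.

Lemma smul1_homog b j (b' : B') a (a' : B') : parity j b' ->
  smul1 b b' a a' = pur (b * pinv j a) (b' * a').
Proof.
case: j => pb; rewrite /smul1 (spart_id pb) (spart_neg pb) mul0r pur0r.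
  by rewrite add0r.
by rewrite addr0 pinv_false.
Qed.

Fact smul1_balanced b b' : balanced f (smul1 b b').
Proof.
split=> [a c a'|a a' c'|a c a'].
- by rewrite /smul1 raddfD !mulrDr !purDl addrACA.
- by rewrite /smul1 !mulrDr !purDr addrACA.
have -> : (c *: a' : restr f') = f' c * (a' : B') by [].
rewrite /smul1 pinvM -saHom_pinv.
rewrite !mulrA !purM.
rewrite !mulrA (pinv_comm (f' c) (spart_parity true b')) -saHom_pinv.
by rewrite -(even_central (f' c) (spart_parity false b')).
Qed.

Lemma smul1Dl b c b' a a' :
  smul1 (b + c) b' a a' = smul1 b b' a a' + smul1 c b' a a'.
Proof. by rewrite /smul1 !mulrDl !purDl addrACA. Qed.
Lemma smul1Dr b b' c' a a' :
  smul1 b (b' + c') a a' = smul1 b b' a a' + smul1 b c' a a'.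
Proof. by rewrite /smul1 !raddfD /= !mulrDl !purDr addrACA. Qed.

(** Splitting [c] by parity makes its effect on the parts of [b'] explicit. The odd part exchanges
    the two summands of [smul1], and the sign lost in this way is recovered when [f c1] moves past
    [a]. *)
Fact smul_balanced (y : D) :
  balanced f (fun b (b' : restr f') => tlift (smul1 b b') y).
Proof.
split=> [b c b'|b b' c'|b c b'].
- by rewrite -tlift_add; apply: eq_tlift => a a'; rewrite smul1Dl.
- by rewrite -tlift_add; apply: eq_tlift => a a'; rewrite smul1Dr.
have -> : (c *: b' : restr f') = f' c * (b' : B') by [].
apply: eq_tlift => a a'; rewrite (spartE c) !raddfD /= mulrDr mulrDl smul1Dl smul1Dr.
set c0 := spart false c; set c1 := spart true c.
have pc0 : parity false (f c0) by apply/sa_parity/spart_parity.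
have pc1 : parity true (f c1) by apply/sa_parity/spart_parity.
have pd0 : parity false (f' c0) by apply/sa_parity/spart_parity.
have pd1 : parity true (f' c1) by apply/sa_parity/spart_parity.
congr (_ + _); rewrite /smul1 !spartM.
  rewrite (spart_id pd0) (spart_neg pd0) !mul0r !addr0.
  rewrite -![f' c0 * _ * _]mulrA -!purM -!mulrA.
  by rewrite !(even_central _ pc0).
rewrite (spart_id pd1) (spart_neg pd1) !mul0r !add0r addrC.
rewrite -![f' c1 * _ * _]mulrA -!purM -!mulrA.
rewrite !(pinv_comm _ pc1) pinv_comp /= pinv_false.
by [].
Qed.

Lemma smul_pur b j (b' : B') a (a' : B') : parity j b' ->
  smul (pur b b') (pur a a') = pur (b * pinv j a) (b' * a').
Proof.
move=> pb; rewrite /smul tlift_tens; last exact: smul_balanced.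
rewrite tlift_tens; last exact: smul1_balanced.
exact: smul1_homog.
Qed.

Lemma smulDl : left_distributive smul +%R.
Proof. by move=> x y z; exact: (tliftD _ _ (smul_balanced z)). Qed.
Lemma smulDr : right_distributive smul +%R.
Proof.
move=> x y z; rewrite /smul -tlift_add; apply: eq_tlift => b b'.
exact: (tliftD _ _ (smul1_balanced b b')).
Qed.
Lemma smul0l x : smul 0 x = 0.
Proof. by apply: (addIr (smul 0 x)); rewrite -smulDl !add0r. Qed.
Lemma smul0r x : smul x 0 = 0.
Proof. by apply: (addIr (smul x 0)); rewrite -smulDr !add0r. Qed.
Let smulE := (smul0l, smul0r, smulDl, smulDr).

Definition sone : D := pur 1 1.

Fact smulA : associative smul.
Proof.
elim/pur_ind=> [|x x' IH IH'|i j b b' pb pb'] y z; first by rewrite !smul0l.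
  by rewrite !smulDl IH IH'.
elim/pur_ind: y => [|x x' IH IH'|i1 j1 a a' pa pa'].
- by rewrite !smulE.
- by rewrite !smulE IH IH'.
elim/pur_ind: z => [|x x' IH IH'|i2 j2 c c' pc pc'].
- by rewrite !smulE.
- by rewrite !smulE IH IH'.
rewrite (smul_pur _ _ _ pa') (smul_pur _ _ _ pb') (smul_pur _ _ _ pb').
by rewrite (smul_pur _ _ _ (parityM pb' pa')) pinvM pinv_comp !mulrA.
Qed.
Fact smul1l : left_id sone smul.
Proof.
elim/pur_ind=> [|x x' IH IH'|i j b b' pb pb']; rewrite ?smulE ?IH ?IH' //.
by rewrite (smul_pur _ _ _ (parity1 B')) pinv_false !mul1r.
Qed.
Fact smul1r : right_id sone smul.
Proof.
elim/pur_ind=> [|x x' IH IH'|i j b b' pb pb']; rewrite ?smulE ?IH ?IH' //.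
by rewrite (smul_pur _ _ _ pb') pinv1 !mulr1.
Qed.

Definition sscale (c : k) (x : D) : D :=
  tlift (fun b (b' : restr f') => pur (c *: b) b') x.
Fact sscale_balanced c : balanced f (fun b (b' : restr f') => pur (c *: b) b').
Proof.
split=> [b d b'|b b' d'|b d b']; first by rewrite scalerDr purDl.
  by rewrite purDr.
by rewrite scalerAl purM.
Qed.
Lemma sscale_pur c b b' : sscale c (pur b b') = pur (c *: b) b'.
Proof. by rewrite /sscale tlift_tens //; exact: sscale_balanced. Qed.
Fact sscaleDr : right_distributive sscale +%R.
Proof. by move=> c x y; exact: (tliftD _ _ (sscale_balanced c)). Qed.
Lemma sscale0 c : sscale c 0 = 0.
Proof. exact: (tlift0 (sscale_balanced c)). Qed.
Let sscaleE := (smulE, sscale0, sscaleDr).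
Fact sscaleA c d v : sscale c (sscale d v) = sscale (c * d) v.
Proof.
elim/pur_ind: v => [|x y IH IH'|i j b b' _ _]; rewrite ?sscaleE ?IH ?IH' //.
by rewrite !sscale_pur scalerA.
Qed.
Fact sscale1 : left_id 1 sscale.
Proof.
elim/pur_ind => [|x y IH IH'|i j b b' _ _]; rewrite ?sscaleE ?IH ?IH' //.
by rewrite !sscale_pur scale1r.
Qed.
Fact sscaleDl v : {morph sscale^~ v : a b / a + b}.
Proof.
move=> c d; rewrite /= /sscale -tlift_add; apply: eq_tlift => b b'.
by rewrite scalerDl purDl.
Qed.
Fact sscaleAl c u v : sscale c (smul u v) = smul (sscale c u) v.
Proof.
elim/pur_ind: u => [|x x' IH IH'|i j b b' pb pb']; [by rewrite !sscaleE|by rewrite !sscaleE IH IH'|].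
elim/pur_ind: v => [|x x' IH IH'|i1 j1 a a' pa pa']; [by rewrite !sscaleE|by rewrite !sscaleE IH IH'|].
by rewrite !sscale_pur !(smul_pur _ _ _ pb') sscale_pur scalerAl.
Qed.
Fact sscaleAr c u v : sscale c (smul u v) = smul u (sscale c v).
Proof.
elim/pur_ind: u => [|x x' IH IH'|i j b b' pb pb']; [by rewrite !sscaleE|by rewrite !sscaleE IH IH'|].
elim/pur_ind: v => [|x x' IH IH'|i1 j1 a a' pa pa']; [by rewrite !sscaleE|by rewrite !sscaleE IH IH'|].
by rewrite !sscale_pur !(smul_pur _ _ _ pb') sscale_pur linearZ scalerAr.
Qed.

(* The hypothesis is a parameter of the type, since the zero ring is not an [algType]. *)
Definition stens_of of sone != 0 : Type := D.
Variable nz : sone != 0.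
Local Notation T := (stens_of nz).
HB.instance Definition _ := GRing.Zmodule.on T.
HB.instance Definition _ := GRing.Zmodule_isNzRing.Build T
  smulA smul1l smul1r smulDl smulDr nz.
HB.instance Definition _ := GRing.Zmodule_isLmodule.Build k T
  sscaleA sscale1 sscaleDr sscaleDl.
HB.instance Definition _ := GRing.Lmodule_isLalgebra.Build k T sscaleAl.
HB.instance Definition _ := GRing.Lalgebra_isAlgebra.Build k T sscaleAr.

Definition sparity (i : bool) (x : T) : Prop :=
  forall P : T -> Prop, P 0 -> (forall x y, P x -> P y -> P (x + y)) ->
    (forall i1 j1 b b', parity i1 b -> parity j1 b' -> i1 (+) j1 = i ->
        P (pur b b')) -> P x.

Lemma sparity_ind i (P : T -> Prop) : P 0 ->
  (forall x y, P x -> P y -> P (x + y)) ->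
  (forall i1 j1 b b', parity i1 b -> parity j1 b' -> i1 (+) j1 = i ->
        P (pur b b')) -> forall x, sparity i x -> P x.
Proof. by move=> P0 PD Ph x; apply. Qed.
Lemma sparity_pur i j b b' : parity i b -> parity j b' ->
  sparity (i (+) j) (pur b b').
Proof. by move=> pb pb' P P0 PD Ph; exact: Ph pb pb' _. Qed.
Fact sparity0 i : sparity i 0. Proof. by []. Qed.
Lemma sparityD i a b : sparity i a -> sparity i b -> sparity i (a + b).
Proof. by move=> ha hb P P0 PD Ph; apply: (PD); [exact: ha | exact: hb]. Qed.
Fact sparity_lin i (c : k) (a b : T) :
  sparity i a -> sparity i b -> sparity i (c *: a + b).
Proof.
move=> ha; apply: sparityD; move: a ha.
apply: sparity_ind => [|x y hx hy|i1 j1 x x' px px' <-].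
- by rewrite scaler0.
- by rewrite scalerDr; exact: sparityD.
- rewrite [_ *: _](sscale_pur c x x').
  by apply: sparity_pur => //; exact: parityZ.
Qed.
Fact sparity1 : sparity false 1.
Proof. exact: (sparity_pur (parity1 B) (parity1 B')). Qed.
Lemma stensM b j (b' : B') a (a' : B') : parity j b' ->
  (pur b b' : T) * (pur a a' : T) = pur (b * pinv j a) (b' * a').
Proof. exact: smul_pur. Qed.
Fact sparityM i j (a b : T) :
  sparity i a -> sparity j b -> sparity (i (+) j) (a * b).
Proof.
move=> ha hb; move: a ha; apply: sparity_ind => [|x y hx hy|i1 j1 x x' px px' <-].
- by rewrite mul0r.
- by rewrite mulrDl; exact: sparityD.
move: b hb; apply: sparity_ind => [|y z hx hy|i2 j2 y y' py py' <-].
- by rewrite mulr0.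
- by rewrite mulrDr; exact: sparityD.
rewrite (stensM _ _ _ px') addbACA; apply: sparity_pur; last exact: parityM.
by apply: parityM => //; exact: parity_pinv.
Qed.
Fact sparity_split (a : T) :
  exists a0 a1, [/\ sparity false a0, sparity true a1 & a = a0 + a1].
Proof.
elim/pur_ind: a => [|x y [x0 [x1 [h0 h1 ->]]] [y0 [y1 [g0 g1 ->]]]|i j b b' pb pb'].
- by exists 0, 0; split; rewrite ?addr0 //; exact: sparity0.
- exists (x0 + y0), (x1 + y1); rewrite addrACA.
  by split=> //; exact: sparityD.
have := sparity_pur pb pb'; case: (i (+) j) => h.
  by exists 0, (pur b b'); rewrite add0r; split=> //; exact: sparity0.
by exists (pur b b'), 0; rewrite addr0; split=> //; exact: sparity0.
Qed.

(** Directness of the grading is not visible from generation by pure tensors; this projection onto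
    the part of parity [i] exhibits it. *)
Definition sproj (i : bool) (x : T) : T :=
  tlift (fun b (b' : restr f') =>
    pur (spart false b) (spart i (b' : B')) +
    pur (spart true b) (spart (~~ i) (b' : B'))) x.
Fact sproj_balanced i : balanced f (fun b (b' : restr f') =>
    pur (spart false b) (spart i (b' : B')) +
    pur (spart true b) (spart (~~ i) (b' : B'))).
Proof.
split=> [b c b'|b b' c'|b c b'].
- by rewrite !raddfD /= !purDl addrACA.
- by rewrite !raddfD /= !purDr addrACA.
have -> : (c *: b' : restr f') = f' c * (b' : B') by [].
rewrite !spartM negbK !saHom_spart !purDl !purDr !purM.
by rewrite [X in _ = _ + X]addrC [RHS]addrACA.
Qed.
Lemma sproj_sparity i j x : sparity i x -> sproj j x = if i == j then x else 0.
Proof.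
move: x; apply: sparity_ind => [|a b ha hb|i1 j1 b b' pb pb' <-].
- by rewrite /sproj (tlift0 (sproj_balanced j)); case: ifP.
- rewrite /sproj (tliftD _ _ (sproj_balanced j)) -!/(sproj _ _) ha hb.
  by case: ifP; rewrite ?addr0.
rewrite /sproj tlift_tens; last exact: sproj_balanced.
case: i1 pb => pb; rewrite (spart_id pb) (spart_neg pb) pur0l ?addr0 ?add0r;
case: j; case: j1 pb' => pb' /=; by rewrite ?(spart_id pb') ?(spart_neg pb') ?pur0r.
Qed.
Fact sparity_direct (a : T) : sparity false a -> sparity true a -> a = 0.
Proof. by move=> /(sproj_sparity true) /= h /(sproj_sparity true) /= <-. Qed.

Fact stens_comm i j (a b : T) :
  sparity i a -> sparity j b -> a * b = (-1) ^+ (i && j) * (b * a).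
Proof.
move=> ha hb; move: a ha; apply: sparity_ind => [|x y hx hy|i1 j1 x x' px px' <-].
- by rewrite mul0r !mulr0.
- by rewrite mulrDl hx hy !mulrDr.
move: b hb; apply: sparity_ind => [|y z hx hy|i2 j2 y y' py py' <-].
- by rewrite mul0r !mulr0.
- by rewrite mulrDr hx hy mulrDl mulrDr.
rewrite (stensM _ _ _ px') (stensM _ _ _ py') (pinv_parity _ px) (pinv_parity _ py).
move: (super_comm px' py') (super_comm px py).
by case: i1 {px}; case: i2 {py}; case: j1 {px'}; case: j2 {py'};
   rewrite /= ?expr0 ?expr1 ?(mul1r, mulN1r, mulrN, mulNr) => -> ->;
   rewrite ?(purNl, purNr, opprK).
Qed.

Definition stens : superAlgebra k :=
  @SuperAlgebra k T sparity sparity0 sparity_lin sparity1 sparityM sparity_split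
    sparity_direct stens_comm.
End SuperTensor.

Section Coproduct.
Variables (k : fieldType) (C B B' : superAlgebra k).
Variables (f : saHom C B) (f' : saHom C B') (nz : sone f f' != 0).
Local Notation T := (stens nz).

Definition tpur (b : B) (b' : B') : T := pur f f' b b'.
Lemma tpurZ c b b' : c *: tpur b b' = tpur (c *: b) b'.
Proof. exact: sscale_pur. Qed.

Fact inl_linear : linear (fun b => tpur b 1).
Proof.
by move=> c a b; rewrite tpurZ; exact: purDl.
Qed.
Fact inl_monoid : monoid_morphism (fun b => tpur b 1).
Proof.
split=> // a b; rewrite [RHS](stensM nz _ _ _ (parity1 B')).
by rewrite pinv_false mulr1.
Qed.
Fact inl_parity i b : parity i b -> parity i (tpur b 1).
Proof. by move=> pb; have := @sparity_pur _ _ _ _ _ _ nz _ _ _ _ pb (parity1 B'); rewrite addbF. Qed.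
Definition sinl : saHom B T := SaHom inl_linear inl_monoid inl_parity.

Fact inr_linear : linear (tpur 1).
Proof.
move=> c a b; rewrite tpurZ [LHS]purDr.
congr (_ + _); rewrite /tpur -[c *: a]mul1r -scalerAr scalerAl.
have -> : c *: (1 : B) = 1 * f (c *: 1) by rewrite mul1r linearZ /= rmorph1.
by rewrite purM linearZ /= rmorph1.
Qed.
Fact inr_monoid : monoid_morphism (tpur 1).
Proof.
split=> // a b; rewrite /tpur (spartE a) mulrDl !purDr mulrDl.
rewrite [X in _ = X + _](stensM nz _ _ _ (spart_parity _ a)).
rewrite [X in _ = _ + X](stensM nz _ _ _ (spart_parity _ a)).
by rewrite !pinv1 !mul1r.
Qed.
Fact inr_parity i b : parity i b -> parity i (tpur 1 b).
Proof. by move=> pb; have := @sparity_pur _ _ _ _ _ _ nz _ _ _ _ (parity1 B) pb. Qed.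
Definition sinr : saHom B' T := SaHom inr_linear inr_monoid inr_parity.

Lemma tpurE b b' : tpur b b' = sinl b * sinr b'.
Proof.
rewrite [RHS](stensM nz _ _ _ (parity1 B')).
by rewrite pinv_false mulr1 mul1r.
Qed.

Lemma sinl_sinr c : sinl (f c) = sinr (f' c).
Proof. by rewrite /= /tpur -[f c]mul1r purM mulr1. Qed.

Lemma stens_ind (P : T -> Prop) : P 0 ->
  (forall x y, P x -> P y -> P (x + y)) ->
  (forall b b', P (tpur b b')) -> forall x, P x.
Proof. by move=> P0 PD Pt; apply: pur_ind => // *; exact: Pt. Qed.

Lemma stensE (x : T) : exists n (a : 'I_n -> B) (b : 'I_n -> B'),
  x = \sum_(i < n) tpur (a i) (b i).
Proof.
elim/stens_ind: x => [|x y [n [a [b ->]]] [m [c [d ->]]]|b b'].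
- by exists 0%N, (fun=> 0), (fun=> 0); rewrite big_ord0.
- exists (n + m)%N, (fun i => match split i with inl j => a j | inr j => c j end).
  exists (fun i => match split i with inl j => b j | inr j => d j end).
  rewrite big_split_ord /=; congr (_ + _); apply: eq_bigr => i _.
    by rewrite (unsplitK (inl i)).
  by rewrite (unsplitK (inr i)).
- by exists 1%N, (fun=> b), (fun=> b'); rewrite big_ord1.
Qed.

Section Copairing.
Variables (E : superAlgebra k) (u : saHom B E) (v : saHom B' E).
Hypothesis uv : forall c, u (f c) = v (f' c).

Let w b (b' : restr f') : E := u b * v b'.
Let w_balanced : balanced f w.
Proof.
split=> [b c b'|b b' c'|b c b']; rewrite /w.
- by rewrite rmorphD mulrDl.
- by rewrite raddfD mulrDr.
have -> : (c *: b' : restr f') = f' c * (b' : B') by [].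
by rewrite !rmorphM /= uv mulrA.
Qed.
Let wl (x : T) : E := tlift w x.
Let wl_tpur b b' : wl (tpur b b') = u b * v b'.
Proof. exact: tlift_tens. Qed.
Let wlD : {morph wl : x y / x + y}. Proof. by move=> x y; exact: tliftD. Qed.
Let wl0 : wl 0 = 0. Proof. exact: tlift0. Qed.

Fact copair_linear : linear wl.
Proof.
move=> c x y; rewrite wlD; congr (_ + _).
elim/stens_ind: x => [|x x' IH IH'|b b']; first by rewrite scaler0 wl0 scaler0.
  by rewrite scalerDr !wlD scalerDr IH IH'.
rewrite tpurZ !wl_tpur linearZ.
by rewrite scalerAl.
Qed.
Fact copair_monoid : monoid_morphism wl.
Proof.
split; first by rewrite [1]/(tpur 1 1) wl_tpur !rmorph1 mulr1.
elim/pur_ind=> [|x x' IH IH'|i j b b' pb pb'] y; first by rewrite !(mul0r, wl0).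
  by rewrite !(mulrDl, wlD) IH IH'.
elim/stens_ind: y => [|x x' IH IH'|a a']; first by rewrite !(mulr0, wl0).
  by rewrite !(mulrDr, wlD) IH IH'.
rewrite [_ * _ in LHS](stensM nz _ _ _ pb') -!/(tpur _ _) !wl_tpur !rmorphM /= !mulrA.
congr (_ * _); rewrite -!mulrA; congr (_ * _).
by rewrite /= saHom_pinv [RHS](pinv_comm _ (sa_parity v pb')).
Qed.
Fact copair_parity i x : parity i x -> parity i (wl x).
Proof.
move: x; apply: (@sparity_ind _ _ _ _ _ _ nz i (fun x => parity i (wl x))).
- by rewrite wl0; exact: parity0.
- by move=> x y hx hy; rewrite wlD; exact: parityD.
move=> i1 j1 b b' pb pb' <-; rewrite wl_tpur.
by apply: parityM; exact: sa_parity.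
Qed.
Definition copair : saHom T E := SaHom copair_linear copair_monoid copair_parity.
Lemma copairE b b' : copair (tpur b b') = u b * v b'.
Proof. exact: wl_tpur. Qed.
Lemma copair_inl b : copair (sinl b) = u b.
Proof. by rewrite copairE rmorph1 mulr1. Qed.
Lemma copair_inr b : copair (sinr b) = v b.
Proof. by rewrite copairE rmorph1 mul1r. Qed.
End Copairing.

Lemma stens_hom_ext (E : superAlgebra k) (g h : saHom T E) :
  (forall b, g (sinl b) = h (sinl b)) -> (forall b, g (sinr b) = h (sinr b)) ->
  g = h.
Proof.
move=> h1 h2; apply: saHom_ext; elim/stens_ind=> [|x y IH IH'|b b'].
- by rewrite !raddf0.
- by rewrite !raddfD /= IH IH'.
- by rewrite tpurE !rmorphM /= -!/(sinl _) -!/(sinr _) h1 h2.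
Qed.
End Coproduct.

(** The multiplication map of [B] is balanced and sends [1 (x) 1] to 1. *)
Lemma sone_neq0_diag (k : fieldType) (C B : superAlgebra k) (f : saHom C B) :
  sone f f != 0.
Proof.
have bw : balanced f (fun b (b' : restr f) => (b : B) * (b' : B)).
  split=> [b c b'|b b' c'|b c b']; first by rewrite mulrDl.
    by rewrite mulrDr.
  by rewrite -mulrA.
apply/eqP => h; have := tlift_tens 1 (1 : restr f) bw.
rewrite -/(pur f f 1 1) -/(sone f f) h (tlift0 bw) mulr1 => /eqP.
by rewrite eq_sym oner_eq0.
Qed.

(** * Tensor products over the base field *)

Section BaseTensor.
Variable k : fieldType.

Section Unit.
Variable A : superAlgebra k.
Fact unit_linear : linear (fun c : sa_base k => (c : k)%:A : A).
Proof. by move=> c a b; rewrite scalerDl scalerA. Qed.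
Fact unit_monoid : monoid_morphism (fun c : sa_base k => (c : k)%:A : A).
Proof.
by split=> [|a b]; [rewrite scale1r | rewrite -scalerAl mul1r scalerA].
Qed.
Fact unit_parity i (c : sa_base k) : parity i c -> parity i ((c : k)%:A : A).
Proof.
case=> [->|->]; first exact/parityZ/parity1.
by rewrite scale0r; exact: parity0.
Qed.
Definition sa_unit : saHom (sa_base k) A := SaHom unit_linear unit_monoid unit_parity.
End Unit.

Lemma sa_unit_unique (A : superAlgebra k) (f : saHom (sa_base k) A) c :
  f c = (c : k)%:A.
Proof.
have -> : c = c *: (1 : k^o) by rewrite -[RHS]/(c * 1) mulr1.
by rewrite linearZ /= rmorph1 [X in _ = X *: _]mulr1.
Qed.

Variables A B : superAlgebra k.

Lemma zero_submod (V : lmodType k) : submod (fun x : V => x = 0).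
Proof. by split=> // c x y -> ->; rewrite scaler0 addr0. Qed.

Lemma restr_unitE c (b : B) :
  (c *: (b : restr (sa_unit B)) : restr (sa_unit B)) = (c : k) *: b.
Proof. by rewrite -[LHS]/((c : k)%:A * b) -scalerAl mul1r. Qed.

(** Contraction of a tensor factor by a functional replaces the choice of bases in the independence
    arguments over [k]. *)
Lemma ktens_contrl (phi : {linear A -> k^o}) :
  exists h : {additive tensor (sa_unit A) (restr (sa_unit B)) -> B},
    forall a b, h (pur _ _ a b) = (phi a : k) *: b.
Proof.
have bw : balanced (sa_unit A) (fun a (b : restr (sa_unit B)) => (phi a : k) *: (b : B)).
  split=> [a c b|a b c|a c b].
  - by rewrite raddfD scalerDl.
  - by rewrite scalerDr.
  - by rewrite restr_unitE scalerA /= -scalerAr mulr1 linearZ /= mulrC.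
have [h hE] := tlift_additive bw; exists h => a b.
by rewrite hE tlift_tens.
Qed.

Lemma ktens_contrr (psi : {linear B -> k^o}) :
  exists h : {additive tensor (sa_unit A) (restr (sa_unit B)) -> A},
    forall a b, h (pur _ _ a b) = (psi b : k) *: a.
Proof.
have bw : balanced (sa_unit A) (fun a (b : restr (sa_unit B)) => (psi b : k) *: a).
  split=> [a c b|a b c|a c b].
  - by rewrite scalerDr.
  - by rewrite raddfD scalerDl.
  - by rewrite restr_unitE linearZ /= -scalerAr mulr1 scalerA mulrC.
have [h hE] := tlift_additive bw; exists h => a b.
by rewrite hE tlift_tens.
Qed.

Lemma one_not_zero (D : superAlgebra k) : ~ (1 : D) = 0.
Proof. exact/eqP/oner_neq0. Qed.

Lemma sone_neq0_base : sone (sa_unit A) (sa_unit B) != 0.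
Proof.
have [phi [_ phi1]] := separation (zero_submod A) (@one_not_zero A).
have [h hE] := ktens_contrl phi.
apply/eqP => e; have := hE 1 1; rewrite -/(sone _ _) e raddf0 phi1 scale1r.
by move/esym/one_not_zero.
Qed.

Definition ktens : superAlgebra k := stens sone_neq0_base.
Definition kpur (a : A) (b : B) : ktens := tpur sone_neq0_base a b.
Definition kinl : saHom A ktens := sinl sone_neq0_base.
Definition kinr : saHom B ktens := sinr sone_neq0_base.
Lemma kpurE a b : kpur a b = kinl a * kinr b. Proof. exact: tpurE. Qed.

Fact kcopair_compat (E : superAlgebra k) (u : saHom A E) (v : saHom B E) c :
  u (sa_unit A c) = v (sa_unit B c).
Proof. by rewrite !linearZ /= !rmorph1. Qed.
Definition kcopair (E : superAlgebra k) (u : saHom A E) (v : saHom B E) :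
  saHom ktens E := copair sone_neq0_base (kcopair_compat u v).
Lemma kcopairE E u v a b : @kcopair E u v (kpur a b) = u a * v b.
Proof. exact: copairE. Qed.
Lemma kcopair_inlE E (u : saHom A E) (v : saHom B E) a : kcopair u v (kinl a) = u a.
Proof. exact: copair_inl. Qed.
Lemma kcopair_inrE E (u : saHom A E) (v : saHom B E) b : kcopair u v (kinr b) = v b.
Proof. exact: copair_inr. Qed.
Lemma ktens_hom_ext E (g h : saHom ktens E) :
  sa_comp g kinl = sa_comp h kinl -> sa_comp g kinr = sa_comp h kinr -> g = h.
Proof.
move=> e1 e2; apply: stens_hom_ext => b.
  exact: (congr1 (fun f : saHom A E => f b) e1).
exact: (congr1 (fun f : saHom B E => f b) e2).
Qed.
Lemma kcopair_inl E (u : saHom A E) v : sa_comp (@kcopair E u v) kinl = u.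
Proof. by apply: saHom_ext => a; exact: copair_inl. Qed.
Lemma kcopair_inr E (u : saHom A E) v : sa_comp (@kcopair E u v) kinr = v.
Proof. by apply: saHom_ext => a; exact: copair_inr. Qed.

Definition indep (V : lmodType k) n (a : 'I_n -> V) :=
  forall c : 'I_n -> k, \sum_(i < n) c i *: a i = 0 -> forall i, c i = 0.

(** If some [b i] were outside [W], contracting with a functional that kills [W] and takes the value
    1 at [b i] would give a nontrivial relation between the [a i]. *)
Lemma ktens_indep_l n (a : 'I_n -> A) (b : 'I_n -> B) m (c : 'I_m -> A)
    (d : 'I_m -> B) (W : B -> Prop) :
  indep a -> submod W -> (forall j, W (d j)) ->
  \sum_(i < n) kpur (a i) (b i) = \sum_(j < m) kpur (c j) (d j) ->
  forall i, W (b i).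
Proof.
move=> ia sW Wd e i; apply: contrapT => Wb.
have [psi [psiW psib]] := separation sW Wb.
have [h hE] := ktens_contrr psi.
have := congr1 h e; rewrite !raddf_sum (eq_bigr _ (fun i _ => hE _ _)).
rewrite (eq_bigr _ (fun i _ => hE _ _)) [RHS]big1 => [/ia/(_ i)/eqP|j _].
  by rewrite psib oner_eq0.
by rewrite (psiW _ (Wd j)) scale0r.
Qed.

Lemma ktens_indep_r n (a : 'I_n -> A) (b : 'I_n -> B) m (c : 'I_m -> A)
    (d : 'I_m -> B) (W : A -> Prop) :
  indep b -> submod W -> (forall j, W (c j)) ->
  \sum_(i < n) kpur (a i) (b i) = \sum_(j < m) kpur (c j) (d j) ->
  forall i, W (a i).
Proof.
move=> ib sW Wc e i; apply: contrapT => Wa.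
have [phi [phiW phia]] := separation sW Wa.
have [h hE] := ktens_contrl phi.
have := congr1 h e; rewrite !raddf_sum (eq_bigr _ (fun i _ => hE _ _)).
rewrite (eq_bigr _ (fun i _ => hE _ _)) [RHS]big1 => [/ib/(_ i)/eqP|j _].
  by rewrite phia oner_eq0.
by rewrite (phiW _ (Wc j)) scale0r.
Qed.

Lemma kpurZl c a b : kpur (c *: a) b = c *: kpur a b.
Proof. by rewrite !kpurE linearZ /= scalerAl. Qed.
Lemma kpurZr c a b : kpur a (c *: b) = c *: kpur a b.
Proof. by rewrite !kpurE linearZ /= scalerAr. Qed.

Lemma dependent_lift (V : lmodType k) n (a : 'I_n.+1 -> V) c i :
  \sum_j c j *: a j = 0 -> c i != 0 ->
  exists d : 'I_n -> k, a i = \sum_j d j *: a (lift i j).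
Proof.
move=> ec ci; exists (fun j => - ((c i)^-1 * c (lift i j))).
apply: (scalerI ci); move: ec; rewrite (bigD1_ord i) //= => /eqP.
rewrite addr_eq0 => /eqP ->; rewrite scaler_sumr -sumrN; apply: eq_bigr => j _.
by rewrite scalerA mulrN mulrA divff // mul1r scaleNr.
Qed.

(** In a representation of minimal length both families are independent, since a relation on either
    side would allow one term to be distributed over the others. *)
Lemma ktens_min (x : ktens) : exists n (a : 'I_n -> A) (b : 'I_n -> B),
  [/\ x = \sum_(i < n) kpur (a i) (b i), indep a & indep b].
Proof.
pose rep n := exists (a : 'I_n -> A) (b : 'I_n -> B),
  x = \sum_(i < n) kpur (a i) (b i).
have ex : exists n, `[< rep n >] by have [n h] := stensE x; exists n; apply/asboolP.
case: (ex_minnP ex) => n /asboolP [a [b e]] minn.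
case: n a b e minn => [|n] a b e minn.
  by exists 0%N, a, b; split=> // c _ [].
have nrep : ~ rep n by move=> /asboolP /minn; rewrite ltnn.
exists n.+1, a, b; split=> // c ec i; apply/eqP; apply: contraT => ci; exfalso; apply: nrep.
- have [d ai] := dependent_lift ec ci.
  exists (fun j => a (lift i j)), (fun j => b (lift i j) + d j *: b i).
  rewrite e (bigD1_ord i) //= {1}ai kpurE raddf_sum mulr_suml -big_split.
  by apply: eq_bigr => j _; rewrite -kpurE kpurZl !kpurE raddfD mulrDr addrC -!kpurE kpurZr.
- have [d bi] := dependent_lift ec ci.
  exists (fun j => a (lift i j) + d j *: a i), (fun j => b (lift i j)).
  rewrite e (bigD1_ord i) //= {1}bi kpurE raddf_sum mulr_sumr -big_split.
  by apply: eq_bigr => j _; rewrite -kpurE kpurZr !kpurE raddfD mulrDl addrC -!kpurE kpurZl.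
Qed.
End BaseTensor.

Section TensorMap.
Variables (k : fieldType) (A A' B B' : superAlgebra k).
Variables (u : saHom A A') (v : saHom B B').

Definition ktmap : saHom (ktens A B) (ktens A' B') :=
  kcopair (sa_comp (kinl A' B') u) (sa_comp (kinr A' B') v).
Lemma ktmapE a b : ktmap (kpur a b) = kpur (u a) (v b).
Proof. by rewrite kcopairE [RHS]kpurE. Qed.

(** In a representation with independent families the images [u (a i)] stay independent, so a zero
    image forces every [v (b i)] to vanish. *)
Lemma ktmap_inj : injective u -> injective v -> injective ktmap.
Proof.
move=> iu iv; apply: raddf_inj => x.
have [n [a [b [-> ia ib]]]] := ktens_min x.
rewrite raddf_sum (eq_bigr _ (fun i _ => ktmapE _ _)) => e; apply: big1 => i _.
have iua : indep (fun i => u (a i)).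
  move=> c h; apply: ia; apply: iu; rewrite raddf0 raddf_sum -[RHS]h.
  by apply: eq_bigr => j _; exact: linearZ.
have : v (b i) = 0.
  have h := @ktens_indep_l _ _ _ n (fun i => u (a i)) (fun i => v (b i)) 0%N
    (fun=> 0) (fun=> 0) _ iua (zero_submod B').
  by apply: h => [[]//|]; rewrite big_ord0 -[RHS]e.
by move=> h; rewrite (iv (b i) 0) ?raddf0 // kpurE raddf0 mulr0.
Qed.
End TensorMap.

Section Hom.
Variable k : fieldType.
Implicit Types A B C D X : superAlgebra k.

Lemma sa_compA A B C D (h : saHom C D) (g : saHom B C) (f : saHom A B) :
  sa_comp h (sa_comp g f) = sa_comp (sa_comp h g) f.
Proof. exact: saHom_ext. Qed.
Lemma sa_comp1 A B (f : saHom A B) : sa_comp f (sa_id A) = f.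
Proof. exact: saHom_ext. Qed.
Lemma sa_1comp A B (f : saHom A B) : sa_comp (sa_id B) f = f.
Proof. exact: saHom_ext. Qed.
Lemma sa_comp_unit A B (f : saHom A B) : sa_comp f (sa_unit A) = sa_unit B.
Proof. by apply: saHom_ext => c; rewrite sa_unit_unique. Qed.

Lemma sa_comp_kcopair A B C D (h : saHom C D) (u : saHom A C) (v : saHom B C) :
  sa_comp h (kcopair u v) = kcopair (sa_comp h u) (sa_comp h v).
Proof.
apply: ktens_hom_ext; apply: saHom_ext => b.
  transitivity (h (u b)); first exact: (congr1 h (kcopair_inlE u v b)).
  exact: (esym (kcopair_inlE (sa_comp h u) (sa_comp h v) b)).
transitivity (h (v b)); first exact: (congr1 h (kcopair_inrE u v b)).
exact: (esym (kcopair_inrE (sa_comp h u) (sa_comp h v) b)).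
Qed.

Lemma kcopair_ktmap A B A' B' C (u : saHom A A') (v : saHom B B')
    (x : saHom A' C) (y : saHom B' C) :
  sa_comp (kcopair x y) (ktmap u v) = kcopair (sa_comp x u) (sa_comp y v).
Proof.
by rewrite /ktmap sa_comp_kcopair !sa_compA kcopair_inl kcopair_inr.
Qed.

Lemma ktmap_inl A B A' B' (u : saHom A A') (v : saHom B B') :
  sa_comp (ktmap u v) (kinl A B) = sa_comp (kinl A' B') u.
Proof. exact: kcopair_inl. Qed.
Lemma ktmap_inr A B A' B' (u : saHom A A') (v : saHom B B') :
  sa_comp (ktmap u v) (kinr A B) = sa_comp (kinr A' B') v.
Proof. exact: kcopair_inr. Qed.

Section Factor.
Variables (B X A : superAlgebra k) (j : saHom X A) (f : saHom B A).
Hypotheses (ij : injective j) (fj : forall b, exists x, j x = f b).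
Let g b := projT1 (cid (fj b)).
Let gE b : j (g b) = f b. Proof. exact: projT2 (cid (fj b)). Qed.
Fact factor_linear : linear g.
Proof. by move=> c a b; apply: ij; rewrite linearP /= !gE linearP. Qed.
Fact factor_monoid : monoid_morphism g.
Proof.
split; first by apply: ij; rewrite gE !rmorph1.
by move=> a b; apply: ij; rewrite rmorphM /= !gE rmorphM.
Qed.
Fact factor_parity i b : parity i b -> parity i (g b).
Proof. by move=> pb; apply: (saHom_inj_parity ij); rewrite gE; exact: sa_parity. Qed.
Definition factor : saHom B X := SaHom factor_linear factor_monoid factor_parity.
Lemma factorE : sa_comp j factor = f. Proof. by apply: saHom_ext => b; exact: gE. Qed.
End Factor.

Lemma sa_comp_inj A B C (j : saHom B C) (f g : saHom A B) : injective j ->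
  sa_comp j f = sa_comp j g -> f = g.
Proof.
move=> ij e; apply: saHom_ext => a; apply: ij.
exact: (congr1 (fun h : saHom A C => h a) e).
Qed.
End Hom.

(** * Even Hopf subalgebras and their group functors *)

Section EvenAlgebra.
Variables (k : fieldType) (T : comAlgType k).
Definition eparity (i : bool) (a : T) := i = false \/ a = 0.
Fact eparity0 i : eparity i 0. Proof. by right. Qed.
Fact eparity_lin i (c : k) a b :
  eparity i a -> eparity i b -> eparity i (c *: a + b).
Proof.
move=> [i0|a0]; first by left.
by case=> [i0|b0]; [left | right; rewrite a0 b0 scaler0 addr0].
Qed.
Fact eparity1 : eparity false 1. Proof. by left. Qed.
Fact eparityM i j a b : eparity i a -> eparity j b -> eparity (i (+) j) (a * b).
Proof.
move=> [i0|a0]; last by right; rewrite a0 mul0r.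
by case=> [j0|b0]; [left; rewrite i0 j0 | right; rewrite b0 mulr0].
Qed.
Fact eparity_split a : exists a0 a1,
  [/\ eparity false a0, eparity true a1 & a = a0 + a1].
Proof. by exists a, 0; split; [left|right|rewrite addr0]. Qed.
Fact eparity_direct a : eparity false a -> eparity true a -> a = 0.
Proof. by move=> _ []. Qed.
Fact esuper_comm i j a b :
  eparity i a -> eparity j b -> a * b = (-1) ^+ (i && j) * (b * a).
Proof.
move=> [i0|a0]; last by rewrite a0 mul0r !mulr0.
by move=> _; rewrite i0 expr0 mul1r mulrC.
Qed.
Definition sa_even : superAlgebra k :=
  SuperAlgebra eparity0 eparity_lin eparity1 eparityM eparity_split
    eparity_direct esuper_comm.
End EvenAlgebra.

Record evenSub (k : fieldType) (A : superAlgebra k) := EvenSub {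
  es_pred :> A -> Prop;
  es1 : es_pred 1;
  es_lin : forall (c : k) x y, es_pred x -> es_pred y -> es_pred (c *: x + y);
  esM : forall x y, es_pred x -> es_pred y -> es_pred (x * y);
  es_even : forall x, es_pred x -> parity false x
}.

Section EvenSubType.
Variables (k : fieldType) (A : superAlgebra k) (S : evenSub A).

Definition es_bool : {pred A} := [pred x | `[< S x >]].
Fact es_closed : subalg_closed es_bool.
Proof.
split; first by apply/asboolP; exact: es1.
- by move=> c x y /asboolP hx /asboolP hy; apply/asboolP; exact: es_lin.
- by move=> x y /asboolP hx /asboolP hy; apply/asboolP; exact: esM.
Qed.
HB.instance Definition _ := GRing.isSubalgClosed.Build k A es_bool es_closed.
Definition esub := {x : A | es_bool x}.
HB.instance Definition _ := SubType.on esub.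
HB.instance Definition _ := Choice.on esub.
HB.instance Definition _ := [SubChoice_isSubAlgebra of esub by <:].
Lemma esubP (x : esub) : S (val x). Proof. exact/asboolP/(valP x). Qed.
Fact esub_comm : @commutative esub esub *%R.
Proof.
by move=> x y; apply: val_inj; rewrite !rmorphM; exact/even_central/es_even/esubP.
Qed.
HB.instance Definition _ := GRing.PzRing_hasCommutativeMul.Build esub esub_comm.
Definition esub_sa : superAlgebra k := sa_even esub.

Fact incl_linear : linear (val : esub_sa -> A). Proof. exact: linearP. Qed.
Fact incl_monoid : monoid_morphism (val : esub_sa -> A).
Proof. by split=> [|x y]; rewrite ?rmorph1 ?rmorphM. Qed.
Fact incl_parity i (x : esub_sa) : parity i x -> parity i (val x).
Proof.
case=> [->|->]; first exact/es_even/esubP.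
by rewrite raddf0; exact: parity0.
Qed.
Definition incl : saHom esub_sa A := SaHom incl_linear incl_monoid incl_parity.
Lemma incl_inj : injective incl. Proof. exact: val_inj. Qed.
Lemma inclP x : S (incl x). Proof. exact: esubP. Qed.
Lemma incl_ex x : S x -> exists y, incl y = x.
Proof. by move=> /asboolP Sx; exists (exist _ x Sx). Qed.
End EvenSubType.

Section Points.
Variables (k : fieldType) (G : supergroup k).
Local Notation O := (coord_alg G).

Lemma pt_inj A : injective (@pt k G A). Proof. exact: can_inj (@ptK k G A). Qed.

Lemma gf_map_elt A B (f : saHom A B) (u : saHom O A) :
  gf_map f (elt u) = elt (sa_comp f u).
Proof. by apply: pt_inj; rewrite pt_nat !eltK. Qed.

Lemma gf_map1 A B (f : saHom A B) : gf_map f (1%g : G A) = 1%g.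
Proof.
apply: (mulgI (gf_map f (1%g : G A))).
by rewrite -gf_mapM !mulg1.
Qed.

Lemma gf_mapV A B (f : saHom A B) (x : G A) : gf_map f x^-1%g = (gf_map f x)^-1%g.
Proof.
by apply: (mulgI (gf_map f x)); rewrite -gf_mapM !mulgV gf_map1.
Qed.

Definition comult : saHom O (ktens O O) :=
  pt ((elt (kinl O O) : G _) * elt (kinr O O))%g.
Definition antipode : saHom O O := pt ((elt (sa_id O) : G _)^-1)%g.

Lemma ptM A (x y : G A) : pt (x * y)%g = sa_comp (kcopair (pt x) (pt y)) comult.
Proof.
by rewrite -pt_nat gf_mapM !gf_map_elt kcopair_inl kcopair_inr !ptK.
Qed.
Lemma ptV A (x : G A) : pt (x^-1)%g = sa_comp (pt x) antipode.
Proof. by rewrite -pt_nat gf_mapV gf_map_elt sa_comp1 ptK. Qed.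
Lemma pt1 A : pt (1%g : G A) = sa_comp (sa_unit A) (counit G).
Proof. by rewrite -pt_nat gf_map1. Qed.

Lemma pt1E A f : pt (1%g : G A) f = ((counit G f : k)%:A).
Proof. by rewrite pt1. Qed.

Lemma ptME x n (a b : 'I_n -> O) : comult x = \sum_(i < n) kpur (a i) (b i) ->
  forall A (g h : G A), pt (g * h)%g x = \sum_(i < n) pt g (a i) * pt h (b i).
Proof.
move=> e A g h; rewrite ptM -[LHS]/(kcopair (pt g) (pt h) (comult x)) e raddf_sum; apply: eq_bigr => i _.
exact: kcopairE.
Qed.
End Points.

(** Stability under [comult] is expressed inside [O (x) O]; by [ktmap_inj] the tensor square of the
    subalgebra embeds there, which determines the restricted comultiplication. *)
Record hopfSub (k : fieldType) (G : supergroup k) := HopfSub {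
  hs_even :> evenSub (coord_alg G);
  hs_comult : forall x, hs_even x ->
    exists n (a b : 'I_n -> coord_alg G), [/\ forall i, hs_even (a i),
      forall i, hs_even (b i) & comult G x = \sum_(i < n) kpur (a i) (b i)];
  hs_antipode : forall x, hs_even x -> hs_even (antipode G x)
}.

Section HopfSubGroup.
Variables (k : fieldType) (G : supergroup k) (S : hopfSub G).
Local Notation O := (coord_alg G).
Local Notation E := (esub_sa S).
Local Notation i := (incl S).

Let tinj := ktmap_inj (@incl_inj _ _ S) (@incl_inj _ _ S).
Fact hs_comult_ex (x : E) : exists t, ktmap i i t = sa_comp (comult G) i x.
Proof.
have [n [a [b [Sa Sb e]]]] := hs_comult (inclP x).
have [a' a'E] := choice (fun j => incl_ex (Sa j)).
have [b' b'E] := choice (fun j => incl_ex (Sb j)).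
exists (\sum_(j < n) kpur (a' j) (b' j)).
rewrite -[RHS]/(comult G (i x)) e raddf_sum; apply: eq_bigr => j _.
by rewrite -a'E -b'E; exact: ktmapE.
Qed.
Fact hs_antipode_ex (x : E) : exists t, i t = sa_comp (antipode G) i x.
Proof. exact/incl_ex/hs_antipode/inclP. Qed.

Definition sub_comult : saHom E (ktens E E) := factor tinj hs_comult_ex.
Definition sub_antipode : saHom E E := factor (@incl_inj _ _ S) hs_antipode_ex.

Definition hpt (A : superAlgebra k) : Type := saHom E A.
HB.instance Definition _ A := gen_eqMixin (hpt A).
HB.instance Definition _ A := gen_choiceMixin (hpt A).

Definition hmul A (x y : hpt A) : hpt A := sa_comp (kcopair x y) sub_comult.
Definition hinv A (x : hpt A) : hpt A := sa_comp x sub_antipode.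
Definition hone A : hpt A := sa_comp (sa_unit A) (sa_comp (counit G) i).

Definition res A (g : G A) : hpt A := sa_comp (pt g) i.
Definition hmap A B (f : saHom A B) (x : hpt A) : hpt B := sa_comp f x.

Lemma hmapM A B (f : saHom A B) (x y : hpt A) :
  hmap f (hmul x y) = hmul (hmap f x) (hmap f y).
Proof. by rewrite /hmap /hmul sa_compA sa_comp_kcopair. Qed.
Lemma hmapV A B (f : saHom A B) (x : hpt A) : hmap f (hinv x) = hinv (hmap f x).
Proof. by rewrite /hmap /hinv sa_compA. Qed.
Lemma hmap1 A B (f : saHom A B) : hmap f (hone A) = hone B.
Proof. by rewrite /hmap /hone sa_compA sa_comp_unit. Qed.

Lemma resM A (g h : G A) : res (g * h)%g = hmul (res g) (res h).
Proof.
rewrite /res /hmul ptM -kcopair_ktmap -!sa_compA; congr sa_comp.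
by rewrite factorE.
Qed.
Lemma resV A (g : G A) : res (g^-1)%g = hinv (res g).
Proof. by rewrite /res /hinv ptV -!sa_compA factorE. Qed.
Lemma res1 A : res (1%g : G A) = hone A.
Proof. by rewrite /res /hone pt1 -sa_compA. Qed.
Lemma res_map A B (f : saHom A B) (g : G A) : res (gf_map f g) = hmap f (res g).
Proof. by rewrite /res pt_nat -sa_compA. Qed.
Lemma res_elt A (u : saHom O A) : res (elt u) = sa_comp u i.
Proof. by rewrite /res eltK. Qed.

(** Associativity is inherited from [G]. It holds for the three universal points, since over
    [O (x) O (x) O], into which their algebra embeds, they are restrictions of points of [G];
    naturality carries it to arbitrary points. The unit and inverse laws are obtained in the same
    way. *)
Fact hmulA A : associative (@hmul A).
Proof.
pose T := ktens (ktens E E) E; pose T' := ktens (ktens O O) O.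
pose J : saHom T T' := ktmap (ktmap i i) i.
have iJ : injective J := ktmap_inj tinj (@incl_inj _ _ S).
pose ux : hpt T := sa_comp (kinl _ _) (kinl E E).
pose uy : hpt T := sa_comp (kinl _ _) (kinr E E).
pose uz : hpt T := kinr (ktens E E) E.
have ex : hmap J ux = res (elt (sa_comp (kinl _ _) (kinl O O))).
  rewrite res_elt /hmap /ux [LHS]sa_compA ktmap_inl -[RHS]sa_compA.
  by rewrite -(ktmap_inl i i) sa_compA.
have ey : hmap J uy = res (elt (sa_comp (kinl _ _) (kinr O O))).
  rewrite res_elt /hmap /uy [LHS]sa_compA ktmap_inl -[RHS]sa_compA.
  by rewrite -(ktmap_inr i i) sa_compA.
have ez : hmap J uz = res (elt (kinr (ktens O O) O)).
  by rewrite res_elt /hmap /uz ktmap_inr.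
have univ : hmul ux (hmul uy uz) = hmul (hmul ux uy) uz.
  apply: (sa_comp_inj iJ); rewrite -!/(hmap J _) !hmapM ex ey ez.
  by rewrite -!resM mulgA.
move=> x y z; pose h : saHom T A := kcopair (kcopair x y) z.
have hx : x = hmap h ux by rewrite /hmap /ux sa_compA !kcopair_inl.
have hy : y = hmap h uy by rewrite /hmap /uy sa_compA kcopair_inl kcopair_inr.
have hz : z = hmap h uz by rewrite /hmap /uz kcopair_inr.
by have := congr1 (hmap h) univ; rewrite !hmapM -hx -hy -hz.
Qed.

Let incl_res : i = res (elt (sa_id O)).
Proof. by rewrite res_elt sa_1comp. Qed.

Fact hmul1 A : left_id (hone A) (@hmul A).
Proof.
have univ : hmul (hone E) (sa_id E : hpt E) = sa_id E.
  apply: (sa_comp_inj (@incl_inj _ _ S)); rewrite -!/(hmap i _) hmapM hmap1.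
  rewrite ![hmap i (sa_id E)]sa_comp1.
  by rewrite incl_res -res1 -resM mul1g.
by move=> x; have := congr1 (hmap x) univ; rewrite hmapM hmap1 /hmap sa_comp1.
Qed.
Fact hmulV A : left_inverse (hone A) (@hinv A) (@hmul A).
Proof.
have univ : hmul (hinv (sa_id E : hpt E)) (sa_id E : hpt E) = hone E.
  apply: (sa_comp_inj (@incl_inj _ _ S)); rewrite -!/(hmap i _) hmapM hmapV hmap1.
  rewrite ![hmap i (sa_id E)]sa_comp1.
  by rewrite incl_res -resV -resM mulVg res1.
by move=> x; have := congr1 (hmap x) univ; rewrite hmapM hmapV hmap1 /hmap sa_comp1.
Qed.
End HopfSubGroup.

Section HopfSubSupergroup.
Variables (k : fieldType) (G : supergroup k) (S : hopfSub G).
Local Notation O := (coord_alg G).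
Local Notation E := (esub_sa S).

Lemma hmul_inj A (x y z : hpt S A) : hmul x y = hmul x z -> y = z.
Proof.
by move/(congr1 (hmul (hinv x))); rewrite !hmulA !hmulV !hmul1.
Qed.
Fact hmulr1 A : right_id (hone S A) (@hmul _ _ S A).
Proof. by move=> x; apply: (hmul_inj (x := hinv x)); rewrite hmulA hmulV hmul1. Qed.
Fact hmulrV A : right_inverse (hone S A) (@hinv _ _ S A) (@hmul _ _ S A).
Proof.
by move=> x; apply: (hmul_inj (x := hinv x)); rewrite hmulA hmulV hmul1 hmulr1.
Qed.
HB.instance Definition _ A := isGroup.Build (hpt S A) (@hmulA _ _ S A)
  (@hmul1 _ _ S A) (@hmulr1 A) (@hmulV _ _ S A) (@hmulrV A).

Definition hgf : groupFunctor k :=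
  @GroupFunctor k (fun A => hpt S A : groupType) (@hmap k G S)
    (@hmapM k G S) (fun A x => sa_1comp x)
    (fun A B C g f x => esym (sa_compA g f x)).

Definition hsg : supergroup k :=
  @Supergroup k hgf E (fun A x => x) (fun A x => x) (fun A x => erefl)
    (fun A x => erefl) (fun A B f x => erefl).

Definition hproj : sgHom G hsg :=
  @SgHom k G hsg (fun A g => res S g : hsg A) (@resM k G S) (@res_map k G S).

Lemma hproj_comorphism : comorphism hproj = incl S.
Proof. by rewrite /comorphism /= res_elt sa_1comp. Qed.

Lemma pt_comorphism (G1 Q : supergroup k) (q : sgHom G1 Q) A (g : G1 A) :
  pt (q A g) = sa_comp (pt g) (comorphism q).
Proof.
by rewrite /comorphism -pt_nat -sg_app_nat gf_map_elt sa_comp1 ptK.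
Qed.

Section FactorThrough.
Variables (Q : supergroup k) (q : sgHom G Q).
Hypotheses (iq : injective (comorphism q))
  (Sq : forall x, S x -> exists a, comorphism q a = x).

Fact through_ex (x : E) : exists a, comorphism q a = incl S x.
Proof. exact/Sq/inclP. Qed.
Definition through_alg : saHom E (coord_alg Q) := factor iq through_ex.
Definition through_app A (x : Q A) : hsg A := sa_comp (pt x) through_alg.

Lemma through_q A (g : G A) : through_app (q A g) = res S g.
Proof. by rewrite /through_app pt_comorphism -sa_compA factorE. Qed.
Fact through_nat A B (f : saHom A B) (x : Q A) :
  through_app (gf_map f x) = gf_map f (through_app x).
Proof. by rewrite /through_app pt_nat -sa_compA. Qed.
(** A point of [Q] need not lift to [G], so multiplicativity is tested on the universal pair over
    [C (x) C]. That algebra embeds into [O (x) O], where the pair does come from [G]. *)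
Fact throughM A (x y : Q A) :
  through_app (x * y)%g = (through_app x * through_app y)%g.
Proof.
pose C := coord_alg Q; pose c := comorphism q.
pose j := ktmap c c; have ij : injective j := ktmap_inj iq iq.
pose ux : Q (ktens C C) := elt (kinl C C).
pose uy : Q (ktens C C) := elt (kinr C C).
have ex : gf_map j ux = q _ (elt (kinl O O)).
  by apply: pt_inj; rewrite gf_map_elt eltK pt_comorphism eltK ktmap_inl.
have ey : gf_map j uy = q _ (elt (kinr O O)).
  by apply: pt_inj; rewrite gf_map_elt eltK pt_comorphism eltK ktmap_inr.
have univ : through_app (ux * uy)%g = (through_app ux * through_app uy)%g.
  apply: (sa_comp_inj ij).
  change (@gf_map k hsg _ _ j (through_app (ux * uy)%g) =
    @gf_map k hsg _ _ j (through_app ux * through_app uy)%g).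
  rewrite -through_nat !gf_mapM -!through_nat ex ey -sg_appM !through_q.
  exact: resM.
pose h : saHom (ktens C C) A := kcopair (pt x) (pt y).
have hx : x = gf_map h ux by rewrite gf_map_elt kcopair_inl ptK.
have hy : y = gf_map h uy by rewrite gf_map_elt kcopair_inr ptK.
have := congr1 (@gf_map k hsg _ _ h) univ.
by rewrite gf_mapM -!through_nat gf_mapM -hx -hy.
Qed.
Definition through : sgHom Q hsg := SgHom throughM through_nat.

Lemma through_comorphism (x : E) : comorphism q (comorphism through x) = incl S x.
Proof.
rewrite -[LHS]/(sa_comp (comorphism q) (comorphism through) x).
have <- : incl S = sa_comp (comorphism q) (comorphism through).
  rewrite -hproj_comorphism /comorphism.
  rewrite -[pt (q _ _)]/(comorphism q) /= /through_app eltK sa_1comp factorE.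
  by rewrite res_elt sa_1comp.
by [].
Qed.
End FactorThrough.
End HopfSubSupergroup.

(** * Kernels cut out by an idempotent *)

Section Cut.
Variables (k : fieldType) (A : superAlgebra k) (e : A).
Hypotheses (pe : parity false e) (ee : e * e = e) (e0 : e != 0).

(** The quotient of [A] by [1 - e] is realised as the ideal [A e] with unit [e], which avoids a
    quotient type. The hypotheses are arguments because the ring structure depends on them. *)
Definition cut_pred of parity false e & e * e = e & e != 0 : {pred A} :=
  [pred x | x * e == x].
Local Notation P := (cut_pred pe ee e0).
Fact cut_closed : submod_closed P.
Proof.
split; first by rewrite inE /= mul0r.
by move=> c x y /eqP hx /eqP hy; rewrite inE /= mulrDl -scalerAl hx hy.
Qed.
HB.instance Definition _ := GRing.isSubmodClosed.Build k A P cut_closed.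
Definition cut := {x : A | P x}.
HB.instance Definition _ := SubType.on cut.
HB.instance Definition _ := Choice.on cut.
HB.instance Definition _ := [SubChoice_isSubLmodule of cut by <:].

Lemma cutP (x : cut) : val x * e = val x. Proof. exact/eqP/(valP x). Qed.
Fact cut_of_subproof x : P (x * e).
Proof. by apply/eqP; rewrite -mulrA ee. Qed.
Definition cut_of (x : A) : cut := exist _ (x * e) (cut_of_subproof x).
Fact cut_mul_subproof (x y : cut) : P (val x * val y).
Proof. by apply/eqP; rewrite -mulrA cutP. Qed.
Definition cut_mul (x y : cut) : cut := exist _ (val x * val y) (cut_mul_subproof x y).
Fact cut_one_subproof : P e. Proof. exact/eqP. Qed.
Definition cut_one : cut := exist _ e cut_one_subproof.
Fact cut_mulA : associative cut_mul.
Proof. by move=> x y z; apply: val_inj; rewrite /= mulrA. Qed.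
Fact cut_mul1 : left_id cut_one cut_mul.
Proof. by move=> x; apply: val_inj; rewrite /= even_central // cutP. Qed.
Fact cut_mulr1 : right_id cut_one cut_mul.
Proof. by move=> x; apply: val_inj; rewrite /= cutP. Qed.
Fact cut_mulDl : left_distributive cut_mul +%R.
Proof. by move=> x y z; apply: val_inj; rewrite /= mulrDl. Qed.
Fact cut_mulDr : right_distributive cut_mul +%R.
Proof. by move=> x y z; apply: val_inj; rewrite /= mulrDr. Qed.
Fact cut_one_neq0 : cut_one != 0.
Proof. by apply: contra e0 => /eqP /(congr1 val) /= ->. Qed.
HB.instance Definition _ := GRing.Zmodule_isNzRing.Build cut cut_mulA cut_mul1
  cut_mulr1 cut_mulDl cut_mulDr cut_one_neq0.
Fact cut_scaleAl (c : k) (x y : cut) : c *: (x * y) = (c *: x) * y.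
Proof. by apply: val_inj; rewrite /= scalerAl. Qed.
HB.instance Definition _ := GRing.Lmodule_isLalgebra.Build k cut cut_scaleAl.
Fact cut_scaleAr (c : k) (x y : cut) : c *: (x * y) = x * (c *: y).
Proof. by apply: val_inj; rewrite /= scalerAr. Qed.
HB.instance Definition _ := GRing.Lalgebra_isAlgebra.Build k cut cut_scaleAr.

Definition cut_parity i (x : cut) : Prop := parity i (val x).
Fact cut_parity0 i : cut_parity i 0. Proof. exact: parity0. Qed.
Fact cut_parity_lin i (c : k) a b :
  cut_parity i a -> cut_parity i b -> cut_parity i (c *: a + b).
Proof. exact: parity_lin. Qed.
Fact cut_parity1 : cut_parity false 1. Proof. exact: pe. Qed.
Fact cut_parityM i j a b :
  cut_parity i a -> cut_parity j b -> cut_parity (i (+) j) (a * b).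
Proof. exact: parityM. Qed.
Fact cut_parity_split a : exists a0 a1,
  [/\ cut_parity false a0, cut_parity true a1 & a = a0 + a1].
Proof.
exists (cut_of (spart false (val a))), (cut_of (spart true (val a))).
split.
- exact: (parityM (spart_parity false (val a)) pe).
- exact: (parityM (spart_parity true (val a)) pe).
- by apply: val_inj; rewrite /= -mulrDl -spartE cutP.
Qed.
Fact cut_parity_direct a : cut_parity false a -> cut_parity true a -> a = 0.
Proof. by move=> h0 h1; apply: val_inj; rewrite (parity_direct h0 h1). Qed.
Fact cut_comm i j a b :
  cut_parity i a -> cut_parity j b -> a * b = (-1) ^+ (i && j) * (b * a).
Proof.
move=> ha hb; apply: val_inj; rewrite !mulr_sign.
have := super_comm ha hb; rewrite mulr_sign => h.
by case: ifP h => _ h; rewrite ?raddfN /= h.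
Qed.
Definition cut_sa : superAlgebra k :=
  SuperAlgebra cut_parity0 cut_parity_lin cut_parity1 cut_parityM
    cut_parity_split cut_parity_direct cut_comm.

Fact cut_of_linear : linear (cut_of : A -> cut_sa).
Proof. by move=> c x y; apply: val_inj; rewrite /= mulrDl scalerAl. Qed.
Fact cut_of_monoid : monoid_morphism (cut_of : A -> cut_sa).
Proof.
split=> [|x y]; apply: val_inj => /=; first exact: mul1r.
by rewrite mulrA -[x * e * y]mulrA (even_central y pe) mulrA -!mulrA ee.
Qed.
Fact cut_of_parity i a : parity i a -> parity i (cut_of a : cut_sa).
Proof. by move=> pa; have := parityM pa pe; rewrite addbF. Qed.
Definition cut_proj : saHom A cut_sa := SaHom cut_of_linear cut_of_monoid cut_of_parity.
Lemma cut_projE x : val (cut_proj x) = x * e. Proof. by []. Qed.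
Lemma cut_proj_val (x : cut_sa) : cut_proj (val x) = x.
Proof. by apply: val_inj; rewrite /= cutP. Qed.

Section CutHom.
Variables (B : superAlgebra k) (f : saHom A B).
Hypothesis fe : f e = 1.
Fact cut_hom_linear : linear (fun x : cut_sa => f (val x)).
Proof. by move=> c x y; rewrite linearP. Qed.
Fact cut_hom_monoid : monoid_morphism (fun x : cut_sa => f (val x)).
Proof. by split=> // x y; rewrite -rmorphM. Qed.
Fact cut_hom_parity i (x : cut_sa) : parity i x -> parity i (f (val x)).
Proof. exact: (@sa_parity _ _ _ f i (val x)). Qed.
Definition cut_hom : saHom cut_sa B := SaHom cut_hom_linear cut_hom_monoid cut_hom_parity.
End CutHom.
End Cut.

Section Kernel.
Variables (k : fieldType) (G : supergroup k) (S : hopfSub G) (e : coord_alg G).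
Local Notation O := (coord_alg G).
Hypotheses (Se : S e) (ee : e * e = e) (epse : counit G e = 1)
  (absorb : forall x, S x -> x * e = (counit G x : k) *: e).

Fact idem_even : parity false e. Proof. exact: es_even Se. Qed.
Fact idem_neq0 : e != 0.
Proof.
by apply/eqP => e0; have /eqP := epse; rewrite e0 raddf0 eq_sym oner_eq0.
Qed.

(** If [g] sends [e] to 1, then it sends [x] to the same value as [x * e], and absorption turns this
    into the counit of [x]. *)
Lemma res_eq1 A (g : G A) : res S g = hone S A <-> pt g e = 1.
Proof.
split=> h.
  have [e' ee'] := incl_ex Se.
  rewrite -ee' -[LHS]/(res S g e') h -[LHS]/(sa_unit A (counit G (incl S e'))).
  by rewrite ee' epse rmorph1.
apply: saHom_ext => x; rewrite -[LHS]/(pt g (incl S x)) -[RHS]/((counit G (incl S x) : k)%:A).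
rewrite -[LHS]mulr1 -h -rmorphM (absorb (inclP x)).
by rewrite -[LHS]/(pt g _) linearZ /= h.
Qed.

Definition ker_pred A : {pred (G A)} := [pred g | `[< pt g e = 1 >]].
Fact ker_closed A : group_closed (@ker_pred A).
Proof.
split; first by apply/asboolP/res_eq1; rewrite res1.
move=> x y /asboolP/res_eq1 hx /asboolP/res_eq1 hy; apply/asboolP/res_eq1.
by rewrite resM resV hx hy -[hmul _ _]/(1 * 1^-1 : hsg S A)%g mulgV.
Qed.
Definition ker A := {g : G A | ker_pred g}.
HB.instance Definition _ A := SubType.on (ker A).
HB.instance Definition _ A := Choice.on (ker A).
HB.instance Definition _ A := SubChoice_isSubGroup.Build (G A) (@ker_pred A) (ker A)
  (@ker_closed A).

Lemma kerP A (x : ker A) : pt (val x) e = 1. Proof. exact/asboolP/(valP x). Qed.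
Definition Ker A (g : G A) (h : pt g e = 1) : ker A :=
  exist _ g (introT (asboolP _) h).

Fact ker_map_subproof A B (f : saHom A B) (x : ker A) : pt (gf_map f (val x)) e = 1.
Proof. by rewrite pt_nat /= kerP rmorph1. Qed.
Definition ker_map A B (f : saHom A B) (x : ker A) : ker B :=
  Ker (ker_map_subproof f x).
Fact ker_mapM A B (f : saHom A B) (x y : ker A) :
  ker_map f (x * y)%g = (ker_map f x * ker_map f y)%g.
Proof. by apply: val_inj; exact: gf_mapM. Qed.
Fact ker_map_id A (x : ker A) : ker_map (sa_id A) x = x.
Proof. by apply: val_inj; exact: gf_map_id. Qed.
Fact ker_map_comp A B C (g : saHom B C) (f : saHom A B) (x : ker A) :
  ker_map (sa_comp g f) x = ker_map g (ker_map f x).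
Proof. by apply: val_inj; exact: gf_map_comp. Qed.
Definition ker_gf : groupFunctor k :=
  @GroupFunctor k (fun A => ker A : groupType) ker_map ker_mapM ker_map_id ker_map_comp.

Local Notation E := (cut_sa idem_even ee idem_neq0).
Local Notation proj := (cut_proj idem_even ee idem_neq0).
Definition ker_pt A (x : ker_gf A) : saHom E A := cut_hom idem_even ee idem_neq0 (kerP x).
Fact ker_elt_subproof A (f : saHom E A) : pt (elt (sa_comp f proj)) e = 1.
Proof.
rewrite eltK /= (_ : cut_of _ _ _ _ = 1) ?rmorph1 //.
by apply: val_inj; rewrite /= ee.
Qed.
Definition ker_elt A (f : saHom E A) : ker_gf A := Ker (ker_elt_subproof f).
Fact ker_ptK A : cancel (@ker_pt A) (@ker_elt A).
Proof.
move=> x; apply: val_inj; apply: pt_inj; rewrite /= eltK.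
by apply: saHom_ext => y; rewrite /= rmorphM /= kerP mulr1.
Qed.
Fact ker_eltK A : cancel (@ker_elt A) (@ker_pt A).
Proof.
move=> f; apply: saHom_ext => y; rewrite /= eltK.
exact: (congr1 f (cut_proj_val y)).
Qed.
Fact ker_pt_nat A B (f : saHom A B) (x : ker_gf A) :
  ker_pt (gf_map f x) = sa_comp f (ker_pt x).
Proof. by apply: saHom_ext => y; rewrite /= pt_nat. Qed.
Definition ker_sg : supergroup k :=
  @Supergroup k ker_gf E ker_pt ker_elt ker_ptK ker_eltK ker_pt_nat.

Definition ker_incl : sgHom ker_sg G :=
  @SgHom k ker_sg G (fun A (x : ker A) => val x) (fun A x y => erefl)
    (fun A B f x => erefl).

Lemma ker_comorphism f : comorphism ker_incl f = proj f.
Proof. by rewrite /comorphism /= eltK sa_1comp. Qed.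

Lemma ker_image A (g : G A) : hom_image ker_incl g <-> pt g e = 1.
Proof.
split=> [[n <-]|h]; first exact: kerP.
by exists (Ker h).
Qed.

Lemma ker_hproj A (g : G A) : hproj S A g = 1%g <-> hom_image ker_incl g.
Proof. by rewrite ker_image; exact: res_eq1. Qed.

Lemma ker_normal : normal_sub ker_incl.
Proof.
split=> [a|A g n].
  by exists (val a); rewrite ker_comorphism cut_proj_val.
apply/ker_hproj; rewrite sg_appM sg_appM.
have -> : hproj S A (ker_incl A n) = 1%g by apply/ker_hproj; exists n.
by rewrite mulg1 -sg_appM mulgV; exact: res1.
Qed.
End Kernel.

(** * Noetherian rings and the Nullstellensatz *)

Section Noetherian.
Variable H : comNzRingType.

Definition comb (x : nat -> H) n y := exists h : nat -> H, y = \sum_(i < n) h i * x i.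

(** A sequence form of the ascending chain condition: it applies directly to the sequences chosen
    below, without ideals as objects. *)
Definition noetherian := forall x : nat -> H, exists n, comb x n (x n).

Lemma comb0 x n : comb x n 0.
Proof. by exists (fun=> 0); rewrite big1 // => i _; rewrite mul0r. Qed.
Lemma combD x n y z : comb x n y -> comb x n z -> comb x n (y + z).
Proof.
move=> [h ->] [g ->]; exists (fun i => h i + g i).
by rewrite -big_split; apply: eq_bigr => i _; rewrite mulrDl.
Qed.
Lemma combM x n a y : comb x n y -> comb x n (a * y).
Proof.
move=> [h ->]; exists (fun i => a * h i); rewrite mulr_sumr.
by apply: eq_bigr => i _; rewrite mulrA.
Qed.
Lemma comb_sum x n (I : Type) (r : seq I) (P : pred I) F :
  (forall i, P i -> comb x n (F i)) -> comb x n (\sum_(i <- r | P i) F i).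
Proof.
by move=> h; elim/big_ind: _ => //; [exact: comb0 | move=> *; exact: combD].
Qed.
Lemma comb_mem x n i : (i < n)%N -> comb x n (x i).
Proof.
move=> lt; exists (fun j => (j == i)%:R).
rewrite (bigD1 (Ordinal lt)) //= eqxx mul1r big1 ?addr0 // => j.
by rewrite -val_eqE /= => /negPf ->; rewrite mul0r.
Qed.
Lemma comb_trans x n y m z : (forall i, (i < n)%N -> comb y m (x i)) ->
  comb x n z -> comb y m z.
Proof. by move=> h [g ->]; apply: comb_sum => i _; exact/combM/h. Qed.
Lemma comb_le x m n z : (m <= n)%N -> comb x m z -> comb x n z.
Proof.
by move=> le; apply: comb_trans => i lt; apply: comb_mem; exact: leq_trans le.
Qed.
Lemma comb_eq x y n z : (forall i, (i < n)%N -> x i = y i) ->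
  comb x n z -> comb y n z.
Proof. by move=> e; apply: comb_trans => i lt; rewrite e //; exact: comb_mem. Qed.
End Noetherian.

Lemma field_noetherian (F : fieldType) : noetherian F.
Proof.
move=> x; have [x0|x0] := eqVneq (x 0%N) 0.
  by exists 0%N; rewrite x0; exact: comb0.
exists 1%N, (fun=> x 1%N / x 0%N).
by rewrite big_ord1 mulfVK.
Qed.

Lemma noetherian_surj (H H' : comNzRingType) (f : {rmorphism H -> H'}) :
  (forall y, exists x, f x = y) -> noetherian H -> noetherian H'.
Proof.
move=> fs nH y; have [x xE] := choice (fun n => fs (y n)).
have [n [h e]] := nH x; exists n, (fun i => f (h i)).
rewrite -xE e rmorph_sum; apply: eq_bigr => i _.
by rewrite rmorphM xE.
Qed.

(* Hilbert's basis theorem, with successive generators of minimal degree. *)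
Lemma poly_noetherian (H : comNzRingType) : noetherian H -> noetherian {poly H}.
Proof.
move=> nH f; apply: contrapT => /forallNP nf.
pose I q := exists n, comb f n q.
have ID q r : I q -> I r -> I (q + r).
  move=> [n hq] [m hr]; exists (maxn n m); apply: combD.
    exact: comb_le (leq_maxl _ _) hq.
  exact: comb_le (leq_maxr _ _) hr.
have IM a q : I q -> I (a * q) by move=> [n hq]; exists n; exact: combM.
pose good (s : seq {poly H}) := forall i, I (nth 0 s i).
pose next s q := [/\ I q, ~ comb (nth 0 s) (size s) q
  & forall r, I r -> ~ comb (nth 0 s) (size s) r -> (size q <= size r)%N].
have step s : exists q, good s -> next s q.
  have [gs|ngs] := pselect (good s); last by exists 0.
  have [N hN] : exists N, forall i, (i < size s)%N -> comb f N (nth 0 s i).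
    elim: (size s) => [|n [N hN]]; first by exists 0%N.
    have [m hm] := gs n; exists (maxn N m) => i.
    rewrite ltnS leq_eqVlt => /orP[/eqP ->|/hN h].
      exact: comb_le (leq_maxr _ _) hm.
    exact: comb_le (leq_maxl _ _) h.
  pose P m := `[< exists q, [/\ I q, ~ comb (nth 0 s) (size s) q & size q = m] >].
  have exP : exists m, P m.
    exists (size (f N)); apply/asboolP; exists (f N); split=> //.
      by exists N.+1; exact: comb_mem.
    by move=> /(comb_trans hN); exact: nf.
  case: (ex_minnP exP) => m /asboolP [q [Iq nq sq]] minm.
  exists q => _; split=> // r Ir nr; rewrite sq; apply: minm.
  by apply/asboolP; exists r.
have [nx nxP] := choice step.
pose L := fix L n := if n is m.+1 then rcons (L m) (nx (L m)) else [::].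
have sL n : size (L n) = n by elim: n => //= n IH; rewrite size_rcons IH.
pose g n := nx (L n).
have Lg n i : (i < n)%N -> nth 0 (L n) i = g i.
  elim: n => //= n IH; rewrite ltnS nth_rcons sL leq_eqVlt => /orP[/eqP ->|lt].
    by rewrite ltnn eqxx.
  by rewrite lt IH.
have gL n : good (L n).
  elim: n => [|n IH] i; first by exists 0%N; rewrite nth_nil; exact: comb0.
  rewrite /= nth_rcons sL; case: ltnP => _; first exact: IH.
  case: eqP => _; last by exists 0%N; exact: comb0.
  by have [] := nxP _ IH.
have gI n : I (g n) by have [] := nxP _ (gL n).
have gn n : ~ comb g n (g n).
  have [_ h _] := nxP _ (gL n); move=> c; apply: h; rewrite sL.
  by apply: comb_eq c => i lt; rewrite Lg.
have gmin n r : I r -> ~ comb g n r -> (size (g n) <= size r)%N.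
  have [_ _ h] := nxP _ (gL n); move=> Ir nr; apply: h => //; rewrite sL => c.
  by apply: nr; apply: comb_eq c => i lt; rewrite Lg.
have gle i n : (i <= n)%N -> (size (g i) <= size (g n))%N.
  by move=> le; apply: gmin => // c; apply: (gn n); exact: comb_le le c.
have [n [h hE]] := nH (fun n => lead_coef (g n)).
have gn0 : g n != 0 by apply/eqP => e; apply: (gn n); rewrite e; exact: comb0.
(* Degrees increase along [g] by [gle], so the shifts align all terms with [g n], and [t] has the
   same leading term as [g n]. *)
pose t := \sum_(i < n) (h i)%:P * 'X^(size (g n) - size (g i)) * g i.
have ct : comb g n t by apply: comb_sum => i _; exact/combM/comb_mem.
have It : I t.
  rewrite /t; elim/big_ind: _ => [|q r|i _]; [by exists 0%N; exact: comb0|exact: ID|].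
  exact: IM.
have nq : ~ comb g n (g n - t).
  by move=> c; apply: (gn n); rewrite -(subrK t (g n)); exact: combD.
have Iq : I (g n - t) by rewrite -mulN1r; apply: ID => //; exact: IM.
have := gmin n _ Iq nq; rewrite leqNgt => /negP; apply.
have sg : (0 < size (g n))%N by rewrite size_poly_gt0.
rewrite -(prednK sg) ltnS; apply/leq_sizeP => j le.
have [lt|ge] := ltnP (size (g n)).-1 j.
  have lej : (size (g n) <= j)%N by rewrite -(prednK sg).
  rewrite coefB coef_sum nth_default // big1 ?subrr // => i _.
  have le' := gle i n (ltnW (ltn_ord i)).
  rewrite -mulrA coefCM coefXnM; case: ltnP => _; first by rewrite mulr0.
  rewrite nth_default ?mulr0 // leq_subRL ?subnK //.
  exact: leq_trans (leq_subr _ _) lej.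
have -> : j = (size (g n)).-1 by apply/eqP; rewrite eqn_leq ge le.
apply/eqP; rewrite coefB subr_eq0; apply/eqP; rewrite -[LHS]/(lead_coef _) hE.
rewrite coef_sum; apply: eq_bigr => i _.
have sgi : (0 < size (g i))%N.
  rewrite size_poly_gt0; apply/eqP => e; apply: (gn i).
  by rewrite e; exact: comb0.
have le' := gle i n (ltnW (ltn_ord i)).
have -> : (size (g n)).-1 = (size (g n) - size (g i) + (size (g i)).-1)%N.
  by rewrite -!subn1 addnBA // subnK.
by rewrite -mulrA coefCM coefXnM ltnNge leq_addr addKn.
Qed.

Definition generates n (H T : nzRingType) (f : H -> T) (b : 'I_n -> T) :=
  forall S : T -> Prop, (forall x, S (f x)) -> (forall x y, S x -> S y -> S (x + y)) ->
    (forall x y, S x -> S y -> S (x * y)) -> (forall i, S (b i)) -> forall a, S a.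

(** Adjoining the first generator to the coefficients leaves one generator fewer; this is the
    induction step for both [noetherian_gen] and [zariski_alg]. *)
Lemma generates_poly n (H T : comNzRingType) (f : {rmorphism H -> T}) (b : 'I_n.+1 -> T)
    (cf : commr_rmorph f (b ord0)) :
  generates f b -> generates (horner_morph cf) (fun i => b (lift ord0 i)).
Proof.
move=> gen S Sf SD SM Sb.
apply: gen => // [x|i]; first by rewrite -(horner_morphC cf); exact: Sf.
have [->|[j ->]] : i = ord0 \/ exists j, i = lift ord0 j.
  by case: (unliftP ord0 i) => [j ->|->]; [right; exists j|left].
  by rewrite -(horner_morphX cf); exact: Sf.
exact: Sb.
Qed.

Lemma noetherian_gen n (H T : comNzRingType) (f : {rmorphism H -> T}) (b : 'I_n -> T) :
  noetherian H -> generates f b -> noetherian T.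
Proof.
elim: n H f b => [|n IH] H f b nH gen.
  apply: (noetherian_surj (f := f)) => // y.
  apply: (gen (fun y => exists x, f x = y)) => [x|x y' [u <-] [v <-]|x y' [u <-] [v <-]|[]//].
  - by exists x.
  - by exists (u + v); rewrite rmorphD.
  - by exists (u * v); rewrite rmorphM.
have cf : commr_rmorph f (b ord0) by move=> x; exact: mulrC.
exact: (IH _ (horner_morph cf : {rmorphism _ -> _}) _ (poly_noetherian nH) (generates_poly gen)).
Qed.

(** When the principal ideals increase, the ideal generated by the first terms is generated by the
    last of them. *)
Lemma comb_chain (R : comNzRingType) (x : nat -> R) n :
  (forall i, (i <= n)%N -> exists c, x i = c * x n) -> comb x n.+1 (x n.+1) ->
  exists h, x n.+1 = h * x n.
Proof.
move=> ch [h e].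
have [c cE] := choice (fun i : 'I_n.+1 => ch i (ltn_ord i)).
exists (\sum_(i < n.+1) h i * c i); rewrite e mulr_suml.
by apply: eq_bigr => i _; rewrite {1}cE mulrA.
Qed.

Lemma fg_noetherian (k : fieldType) (B : comAlgType k) : finitely_generated B -> noetherian B.
Proof.
move=> [n [b gen]]; apply: (@noetherian_gen n k B (in_alg B) b (@field_noetherian k)).
move=> S Sk SD SM Sb; apply: gen => // [|c x y hx hy].
  by have := Sk 1; rewrite /= scale1r.
by apply: (SD) => //; rewrite -mulr_algl; apply: (SM) => //; exact: Sk.
Qed.

(** * Integral elements and Zariski's lemma *)

Section Integral.
Variables (A : comNzRingType) (K : fieldType) (f : {rmorphism A -> K}).

Lemma integral_exp u n : integralOver f u -> integralOver f (u ^+ n).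
Proof.
move=> iu; elim: n => [|n IH]; first exact: integral1.
by rewrite exprS; exact: integral_mul.
Qed.
Lemma integral_bigsum (I : Type) (r : seq I) (P : pred I) F :
  (forall i, P i -> integralOver f (F i)) ->
  integralOver f (\sum_(i <- r | P i) F i).
Proof.
move=> h; elim/big_ind: _ => //; [exact: integral0 | move=> *; exact: integral_add].
Qed.

(* Clearing the leading coefficient of an algebraic equation. *)
Lemma integral_lead (q : {poly A}) b :
  map_poly f q != 0 -> root (map_poly f q) b ->
  exists a, f a != 0 /\ integralOver f (f a * b).
Proof.
set Q := map_poly f q => Q0 rb; pose m := (size Q).-1.
have sQ : (1 < size Q)%N := root_size_gt1 Q0 rb.
have mE : m.+1 = size Q by rewrite prednK // (ltn_trans _ sQ).
exists q`_m; have la : f q`_m = lead_coef Q by rewrite -coef_map.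
set l := f q`_m; have l0 : l != 0 by rewrite /l la lead_coef_eq0.
split=> //; pose R := \poly_(i < m) (f (q`_i * q`_m ^+ (m.-1 - i))).
pose P := 'X^m + R.
have sP : (size R < size ('X^m : {poly K}))%N.
  by rewrite size_polyXn ltnS size_poly.
apply: (@integral_root_monic _ _ _ _ P).
- by rewrite monicE lead_coefDl // lead_coefXn.
- rewrite /root hornerD hornerXn horner_poly.
  have m0 : (0 < m)%N by rewrite -ltnS mE.
  suff -> : (l * b) ^+ m + \sum_(i < m) f (q`_i * q`_m ^+ (m.-1 - i)) * (l * b) ^+ i
     = l ^+ m.-1 * Q.[b] by rewrite (rootP rb) mulr0.
  rewrite [Q.[b]]horner_coef -mE big_ord_recr /= mulrDr mulr_sumr addrC; congr (_ + _).
    apply: eq_bigr => i _; rewrite rmorphM rmorphXn exprMn -/l coef_map /=.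
    have e : (m.-1 - i + i = m.-1)%N by rewrite subnK // -ltnS prednK.
    rewrite -[in RHS]e exprD -/l.
    by move: (l ^+ (_ - _)) (l ^+ i) (b ^+ i) => x y z; ring.
  by rewrite exprMn -{1}(prednK m0) exprSr -!mulrA coef_map.
apply/integral_poly => i; rewrite coefD coefXn coef_poly; apply: integral_add.
  by case: eqP => _; [exact: integral1 | exact: integral0].
by case: ifP => _; [exact: integral_id | exact: integral0].
Qed.

(** Dividing an equation of [w] by the largest possible power of [X] leaves [f d + w q(w) = 0] with
    [f d] nonzero, so [f d / w = - q(w)] is integral. *)
Lemma integral_inv w : w != 0 -> integralOver f w ->
  exists d, f d != 0 /\ integralOver f (f d / w).
Proof.
move=> w0 iw; case: (iw) => p mp rw; set P := map_poly f p in rw.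
have exi : exists i, P`_i != 0.
  exists (size P).-1; rewrite -/(lead_coef P) (monicP (monic_map f mp)).
  exact: oner_neq0.
case: (ex_minnP exi) => i Pi mini; exists p`_i; split; first by rewrite -coef_map.
have e : P = ((P`_i)%:P + drop_poly i.+1 P * 'X) * 'X^i.
  apply/polyP => j; rewrite coefMXn; case: ltnP => lt.
    by apply/eqP; apply: contraT => /mini; rewrite leqNgt lt.
  rewrite coefD coefC coefMX coef_drop_poly subn_eq0.
  case: leqP => h.
    by rewrite addr0; congr (P`_ _); apply/eqP; rewrite eqn_leq h lt.
  by rewrite add0r addnS -addSn prednK ?subn_gt0 // subnK.
move: rw; rewrite e /root hornerM hornerXn mulf_eq0 expf_eq0 (negPf w0) andbF orbF.
rewrite hornerD hornerC hornerMX addr_eq0 coef_map /= => /eqP ->.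
rewrite -mulNr mulfK //; apply: integral_opp.
apply: integral_horner iw; apply/integral_poly => j.
by rewrite coef_drop_poly coef_map; exact: integral_id.
Qed.
End Integral.

Section Step.
Variables (A : comNzRingType) (K : fieldType) (f : {rmorphism A -> K}).
Variables (f' : {rmorphism {poly A} -> K}).
Hypothesis f'C : forall a, f' a%:P = f a.
Local Notation b := (f' 'X).

Lemma stepE r : f' r = \sum_(i < size r) f r`_i * b ^+ i.
Proof.
rewrite -{1}[r]coefK poly_def rmorph_sum; apply: eq_bigr => i _.
by rewrite -mul_polyC rmorphM /= f'C rmorphXn.
Qed.

Lemma stepE' r : f' r = (map_poly f r).[b].
Proof.
rewrite stepE (@horner_coef_wide _ (size r)) ?size_poly //.
by apply: eq_bigr => i _; rewrite coef_map.
Qed.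

(** Once [M] is at least the number of coefficients of [r], each power of [b] in [f' r] is absorbed
    into a power of the integral element [l * b]. *)
Lemma integral_clear (l : K) : integralOver f l -> integralOver f (l * b) ->
  forall r : {poly A}, exists M, forall M', (M <= M')%N -> integralOver f (l ^+ M' * f' r).
Proof.
move=> il ilb r; exists (size r) => M' le.
rewrite stepE mulr_sumr; apply: integral_bigsum => i _.
have -> : l ^+ M' * (f r`_i * b ^+ i) = f r`_i * (l ^+ (M' - i) * (l * b) ^+ i).
  rewrite exprMn mulrCA; congr (_ * _); rewrite mulrA -exprD subnK //.
  exact: leq_trans (ltnW (ltn_ord i)) le.
by apply: integral_mul; [exact: integral_id | apply: integral_mul; exact: integral_exp].
Qed.

Lemma integral_clear_seq (l : K) : integralOver f l -> integralOver f (l * b) ->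
  forall (r : nat -> {poly A}) n, exists M, forall i, (i < n)%N ->
    integralOver f (l ^+ M * f' (r i)).
Proof.
move=> il ilb r; elim=> [|n [M IH]]; first by exists 0%N.
have [M' h] := integral_clear il ilb (r n); exists (M + M')%N => i.
rewrite ltnS leq_eqVlt => /orP[/eqP ->|/IH {}IH]; first exact/h/leq_addl.
by rewrite addnC exprD -mulrA; apply: integral_mul => //; exact: integral_exp.
Qed.

(** A monic equation of [y] of degree [m], multiplied by [l ^+ (M * m)], becomes one of
    [l ^+ M * y]. Its lower coefficients contain a factor [l ^+ M], which makes them integral over
    [A]; the top one stays 1. *)
Lemma integral_step_trans (l y : K) : integralOver f l -> integralOver f (l * b) ->
  integralOver f' y -> exists M, integralOver f (l ^+ M * y).
Proof.
move=> il ilb [p mp ry]; pose m := (size p).-1.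
have sp : (0 < size p)%N by rewrite size_poly_gt0 monic_neq0.
have [M hM] := integral_clear_seq il ilb (fun i => p`_i) (size p); exists M.
pose P := \poly_(i < size p) (l ^+ (M * (m - i)) * f' p`_i).
have pm : p`_m = 1 := monicP mp.
have Pm : P`_m = 1.
  by rewrite coef_poly prednK // leqnn subnn muln0 expr0 mul1r pm rmorph1.
have sP : size P = size p.
  apply/eqP; rewrite eqn_leq size_poly /= -(prednK sp) ltnNge.
  apply/negP => /leq_sizeP /(_ _ (leqnn _)) /eqP.
  by rewrite Pm oner_eq0.
apply: (@integral_root_monic _ _ _ _ P).
- by rewrite monicE /lead_coef sP Pm.
- rewrite /root horner_poly.
  suff -> : \sum_(i < size p) l ^+ (M * (m - i)) * f' p`_i * (l ^+ M * y) ^+ i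
    = l ^+ (M * m) * (map_poly f' p).[y] by rewrite (rootP ry) mulr0.
  rewrite (@horner_coef_wide _ (size p)) ?size_poly // mulr_sumr.
  apply: eq_bigr => i _; rewrite coef_map /=.
  have le : (i <= m)%N by rewrite -ltnS prednK.
  rewrite -{2}(subnK le) mulnDr exprD exprMn -exprM.
  by move: (l ^+ _) (l ^+ _) => u v; ring.
apply/integral_poly => i; rewrite coef_poly; case: ifP => [lt|_]; last exact: integral0.
have [->|ne] := eqVneq i m.
  by rewrite subnn muln0 expr0 mul1r pm rmorph1; exact: integral1.
have ltm : (i < m)%N by rewrite ltn_neqAle ne /= -ltnS prednK.
rewrite -(subnSK ltm) mulnS exprD mulrAC; apply: integral_mul; first exact: hM.
exact: integral_exp.
Qed.
End Step.

(* If [b ord0] is transcendental over [A], then [1 + X c] is not a unit and is coprime to [c],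
   so that no [c ^ N / (1 + X c)] can be integral. *)
Lemma zariski_alg n (A : comNzRingType) (K : fieldType) (f : {rmorphism A -> K})
    (b : 'I_n -> K) :
  generates f b ->
  exists a, f a != 0 /\ forall z, exists N, integralOver f (f a ^+ N * z).
Proof.
elim: n A f b => [|n IH] A f b gen.
  exists 1; rewrite rmorph1; split=> [|z]; first exact: oner_neq0.
  exists 0%N; rewrite expr0 mul1r; apply: (gen (fun z => integralOver f z)) => [x|x y|x y|[]//].
  - exact: integral_id.
  - exact: integral_add.
  - exact: integral_mul.
have cf : commr_rmorph f (b ord0) by move=> x; exact: mulrC.
pose f' : {rmorphism {poly A} -> K} := horner_morph cf.
have f'C a : f' a%:P = f a := horner_morphC cf a.
have f'X : f' 'X = b ord0 := horner_morphX cf.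
have [c [c0 hc]] : exists c, f' c != 0 /\ forall z, exists N, integralOver f' (f' c ^+ N * z).
  exact: (IH _ f' _ (generates_poly gen)).
have [[q [q0 rq]]|trans] := pselect (exists q, map_poly f q != 0 /\ root (map_poly f q) (b ord0)).
- have [a1 [a10 ilb]] := integral_lead q0 rq; set l := f a1 in a10 ilb.
  have il : integralOver f l by exact: integral_id.
  rewrite -f'X in ilb.
  have [M0 /(_ _ (leqnn _)) iw] := integral_clear f'C il ilb c.
  set w := l ^+ M0 * f' c in iw.
  have w0 : w != 0 by rewrite mulf_neq0 // expf_neq0.
  have [d [d0 iv]] := integral_inv w0 iw; set v := f d / w in iv.
  have fd : f d = v * l ^+ M0 * f' c by rewrite -mulrA divfK.
  (* [a1] clears the powers of [b], while [f d = v * l ^+ M0 * f' c] with [v] integral trades powers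
     of [f d] for the powers of [f' c] that [hc] asks for. *)
  exists (a1 * d); split=> [|z]; first by rewrite rmorphM mulf_neq0.
  have [N hN] := hc z; have [M iM] := integral_step_trans f'C il ilb hN.
  exists (M + N)%N; rewrite rmorphM -/l.
  have -> : (l * f d) ^+ (M + N) * z =
    l ^+ N * f d ^+ M * (v * l ^+ M0) ^+ N * (l ^+ M * (f' c ^+ N * z)).
    rewrite exprMn !exprD {2}fd !exprMn.
    move: (l ^+ M) (l ^+ N) (f d ^+ M) (v ^+ N) (_ ^+ N) (f' c ^+ N) => *; ring.
  apply: integral_mul => //; apply: integral_mul.
    by apply: integral_mul; apply: integral_exp => //; exact: integral_id.
  by apply/integral_exp/integral_mul => //; exact: integral_exp.
- have tr q : f' q = 0 -> map_poly f q = 0.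
    move=> h; apply/eqP; apply: contraT => q0; exfalso; apply: trans; exists q.
    by rewrite q0 /root -f'X -(stepE' f'C) h.
  pose u := 1 + 'X * c; pose cb := map_poly f c; pose U := map_poly f u.
  have UE : U = 1 + 'X * cb by rewrite /U /u rmorphD rmorphM /= rmorph1 map_polyX.
  have cb0 : cb != 0 by apply: contraNneq c0; rewrite (stepE' f'C) -/cb => ->; rewrite horner0.
  have sU : (1 < size U)%N.
    have s : (1 < size ('X * cb)%R)%N.
      by rewrite mulrC size_mulX // ltnS size_poly_gt0.
    by rewrite UE addrC size_polyDl // size_poly1.
  have u0 : f' u != 0.
    by apply/eqP => /tr uz; move: sU; rewrite /U uz size_poly0.
  have [N [p mp ry]] := hc (f' u)^-1; set y := _ / _ in ry.
  pose m := (size p).-1.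
  have sp : (0 < size p)%N by rewrite size_poly_gt0 monic_neq0.
  have pm : p`_m = 1 := monicP mp.
  (* The equation of [c ^+ N / u] multiplied by [u ^+ m]. All its terms except the top one are
     divisible by [u], so [u] divides the remaining power of [c] after mapping to [K]. *)
  pose T := \sum_(i < size p) p`_i * c ^+ (N * i) * u ^+ (m - i).
  have T0 : f' T = 0.
    rewrite -(mulr0 (f' u ^+ m)) -(rootP ry).
    rewrite (@horner_coef_wide _ (size p)) ?size_poly // mulr_sumr rmorph_sum.
    apply: eq_bigr => i _; rewrite coef_map !rmorphM !rmorphXn /= /y exprMn exprVn.
    have le : (i <= m)%N by rewrite -ltnS prednK.
    rewrite -{2}(subnK le) exprD exprM.
    move: (f' u ^+ _) (f' c ^+ N) (f' p`_i) => s t r.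
    have ui : f' u ^+ i != 0 by rewrite expf_neq0.
    by rewrite !mulrA; field.
  have dU : U %| cb ^+ (N * m).
    have := tr _ T0; rewrite rmorph_sum -(prednK sp) big_ord_recr /= -/m subnn pm.
    rewrite expr0 mulr1 mul1r rmorphXn -/cb => /eqP; rewrite addr_eq0 => /eqP e.
    rewrite -dvdpNr -e.
    elim/big_ind: _ => [|x y'|i _]; [exact: dvdp0|exact: dvdp_add|].
    rewrite !rmorphM !rmorphXn -/U; apply: dvdp_mull; apply: dvdp_exp => //.
    by rewrite subn_gt0.
  (* Modulo [U] the product ['X * cb] is [-1], so [U] divides a unit although its degree is
     positive. *)
  have d1 : U %| (- 1) ^+ (N * m).
    have : U %| ('X * cb) ^+ (N * m) by rewrite exprMn; exact: dvdp_mull.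
    have -> : 'X * cb = U - 1 by rewrite UE addrC addKr.
    rewrite -[X in _ %| X -> _](subrK ((- 1) ^+ (N * m))) dvdp_addr //.
    by rewrite subrXX opprK subrK dvdp_mulIl.
  have : U %| (- 1) ^+ (N * m) * (- 1) ^+ (N * m) by exact: dvdp_mulr.
  by rewrite -exprMn mulrNN mulr1 expr1n dvdp1 => /eqP e; rewrite e in sU.
Qed.

Lemma zariski n (F K : fieldType) (f : {rmorphism F -> K}) (b : 'I_n -> K) :
  generates f b ->
  forall z, integralOver f z.
Proof.
move=> /zariski_alg [a [a0 h]] z; have [N iz] := h z.
have -> : z = f (a^-1) ^+ N * (f a ^+ N * z).
  by rewrite mulrA -exprMn -rmorphM mulVf ?rmorph1 ?expr1n ?mul1r // -(fmorph_eq0 f).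
by apply: integral_mul => //; apply: integral_exp; exact: integral_id.
Qed.

(** Multiplying the equation by a power of [X] makes it available in every degree from [d] on, so
    that one exponent can serve several generators. *)
Lemma integral_power (F : fieldType) (K : comNzRingType) (f : {rmorphism F -> K}) z :
  integralOver f z -> exists d, forall D, (d <= D)%N ->
    exists r : nat -> F, z ^+ D = \sum_(t < D) f (r t) * z ^+ t.
Proof.
move=> [p mp /rootP rz]; exists (size p).-1 => D le.
pose q := p * 'X^(D - (size p).-1).
have mq : q \is monic by rewrite monicMr ?monicXn.
have sq : size q = D.+1.
  rewrite size_Mmonic ?monicXn ?monic_neq0 // size_polyXn addnS /=.
  by rewrite -{1}(prednK (_ : 0 < size p)%N) ?size_poly_gt0 ?monic_neq0 // addSn subnKC.
exists (fun t => - q`_t).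
have : (map_poly f q).[z] = 0 by rewrite rmorphM hornerM rz mul0r.
rewrite (@horner_coef_wide _ D.+1) -?sq ?size_poly // sq big_ord_recr /=.
have := monicP mq; rewrite /lead_coef sq /= coef_map => /= ->; rewrite rmorph1 mul1r.
rewrite addrC => /eqP; rewrite addr_eq0 => /eqP ->; rewrite -sumrN.
by apply: eq_bigr => i _; rewrite coef_map /= rmorphN mulNr.
Qed.

Lemma integral_span n (F : fieldType) (K : comNzRingType) (f : {rmorphism F -> K})
    (b : 'I_n -> K) :
  generates f b ->
  (forall i, integralOver f (b i)) ->
  exists (I : finType) (s : I -> K), forall z, exists c : I -> F, z = \sum_i f (c i) * s i.
Proof.
move=> gen ib.
have [d dE] := choice (fun i => integral_power (ib i)).
(* The successor makes [D] positive, so that the exponent 0 exists in ['I_D] and 1 is among the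
   monomials. *)
pose D := (\sum_i d i).+1.
have lD i : (d i <= D)%N by rewrite ltnW // ltnS (bigD1 i) //= leq_addr.
pose I : finType := {ffun 'I_n -> 'I_D}.
pose mon (a : I) : K := \prod_i b i ^+ a i.
pose S z := exists c : I -> F, z = \sum_i f (c i) * mon i.
have SD x y : S x -> S y -> S (x + y).
  move=> [c ->] [c' ->]; exists (fun i => c i + c' i).
  by rewrite -big_split; apply: eq_bigr => i _; rewrite rmorphD mulrDl.
have SZ u x : S x -> S (f u * x).
  move=> [c ->]; exists (fun i => u * c i); rewrite mulr_sumr.
  by apply: eq_bigr => i _; rewrite rmorphM mulrA.
have S0 : S 0 by exists (fun=> 0); rewrite big1 // => i _; rewrite rmorph0 mul0r.
have Ssum (J : finType) (F' : J -> K) : (forall i, S (F' i)) -> S (\sum_i F' i).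
  by move=> h; elim/big_ind: _.
have Smon a : S (mon a).
  exists (fun a' => (a' == a)%:R).
  rewrite (bigD1 a) //= eqxx rmorph1 mul1r big1 ?addr0 // => a' /negPf ->.
  by rewrite rmorph0 mul0r.
have Spow j (a : I) t : (t < D)%N -> S (b j ^+ t * \prod_(i | i != j) b i ^+ a i).
  move=> lt; have := Smon [ffun i => if i == j then Ordinal lt else a i].
  rewrite /mon (bigD1 j) //= ffunE eqxx; congr (S (_ * _)).
  by apply: eq_bigr => i /negPf h; rewrite ffunE h.
have Sb j x : S x -> S (b j * x).
  move=> [c ->]; rewrite mulr_sumr; apply: (Ssum) => a; rewrite mulrCA; apply: (SZ); rewrite /mon (bigD1 j) //= mulrA -exprS.
  have := ltn_ord (a j); rewrite leq_eqVlt => /orP[/eqP e|]; last exact: Spow.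
  have [r rE] := dE j D (lD j); rewrite e rE mulr_suml.
  by apply: (Ssum) => t; rewrite -mulrA; apply: (SZ); exact: Spow.
have SS : forall z x, S x -> S (z * x).
  apply: gen => [u x|x y hx hy z Sz|x y hx hy z Sz|i x]; [exact: SZ| | |exact: Sb].
    by rewrite mulrDl; apply: (SD); [exact: hx|exact: hy].
  by rewrite -mulrA; exact/hx/hy.
exists I, mon => z; have := SS z 1; rewrite mulr1; apply.
have := Smon [ffun=> ord0]; rewrite /mon big1 // => i _.
by rewrite ffunE expr0.
Qed.

Section FieldExt.
Variables (F K : fieldType) (f : {rmorphism F -> K}).
Variables (n : nat) (b : 'I_n -> K).
Hypothesis span : forall z, exists c : 'I_n -> F, z = \sum_i f (c i) * b i.
Hypothesis free : forall c : 'I_n -> F, \sum_i f (c i) * b i = 0 -> forall i, c i = 0.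

Definition fext_of (_ : forall z, exists c : 'I_n -> F, z = \sum_i f (c i) * b i)
  (_ : forall c : 'I_n -> F, \sum_i f (c i) * b i = 0 -> forall i, c i = 0) : Type := K.
Local Notation L := (fext_of span free).
HB.instance Definition _ := GRing.Field.on L.
Definition fext_scale (c : F) (x : L) : L := f c * (x : K).
Fact fext_scaleA c d v : fext_scale c (fext_scale d v) = fext_scale (c * d) v.
Proof. by rewrite /fext_scale rmorphM mulrA. Qed.
Fact fext_scale1 : left_id 1 fext_scale.
Proof. by move=> x; rewrite /fext_scale rmorph1 mul1r. Qed.
Fact fext_scaleDr : right_distributive fext_scale +%R.
Proof. by move=> c x y; rewrite /fext_scale mulrDr. Qed.
Fact fext_scaleDl v : {morph fext_scale^~ v : a b / a + b}.
Proof. by move=> c d; rewrite /fext_scale rmorphD mulrDl. Qed.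
HB.instance Definition _ := GRing.Zmodule_isLmodule.Build F L
  fext_scaleA fext_scale1 fext_scaleDr fext_scaleDl.
Fact fext_scaleAl (c : F) (u v : L) : c *: (u * v) = (c *: u) * v.
Proof. exact: mulrA. Qed.
HB.instance Definition _ := GRing.Lmodule_isLalgebra.Build F L fext_scaleAl.
Fact fext_scaleAr (c : F) (u v : L) : c *: (u * v) = u * (c *: v).
Proof. exact: mulrCA. Qed.
HB.instance Definition _ := GRing.Lalgebra_isAlgebra.Build F L fext_scaleAr.

Definition fext_coord (z : L) : 'rV[F]_n := \row_i projT1 (cid (span z)) i.
Lemma fext_coordE z : z = \sum_i f (fext_coord z ord0 i) * b i.
Proof.
rewrite {1}(projT2 (cid (span z))); apply: eq_bigr => i _.
by rewrite mxE.
Qed.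
Lemma fext_coord_unique (z : L) (c : 'rV[F]_n) :
  z = \sum_i f (c ord0 i) * b i -> fext_coord z = c.
Proof.
move=> e; apply/rowP => i; apply/eqP; rewrite -subr_eq0; apply/eqP.
move: i; apply: (free (c := fun i => fext_coord z ord0 i - c ord0 i)).
under eq_bigr do rewrite rmorphB mulrBl.
by rewrite sumrB -fext_coordE -e subrr.
Qed.
Fact fext_coord_linear : linear fext_coord.
Proof.
move=> c x y; apply: fext_coord_unique; rewrite {1}(fext_coordE x) {1}(fext_coordE y).
rewrite -[_ *: _]/(f c * _) mulr_sumr -big_split; apply: eq_bigr => i _.
by rewrite !mxE rmorphD rmorphM mulrDl mulrA.
Qed.
Fact fext_coord_bij : bijective fext_coord.
Proof.
exists (fun c : 'rV[F]_n => \sum_i f (c ord0 i) * b i) => [z|c]; first by rewrite -fext_coordE.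
exact: fext_coord_unique.
Qed.
Fact fext_vect : vector_axiom_def n L.
Proof.
exists fext_coord; [exact: fext_coord_linear | exact: fext_coord_bij].
Qed.
HB.instance Definition _ := Lmodule_hasFinDim.Build F L fext_vect.
End FieldExt.

(** A spanning family of minimal size is free, and [K] with this basis is the required extension. *)
Lemma fext_exists (F K : fieldType) (f : {rmorphism F -> K}) (I : finType) (s : I -> K) :
  (forall z, exists c : I -> F, z = \sum_i f (c i) * s i) ->
  exists (L : fieldExtType F) (h : {rmorphism K -> L}), forall c, h (f c) = c%:A.
Proof.
move=> span.
pose P n := exists b : 'I_n -> K, forall z, exists c : 'I_n -> F, z = \sum_i f (c i) * b i.
have exP : exists n, `[< P n >].
  exists #|I|; apply/asboolP; exists (fun i => s (enum_val i)) => z.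
  have [c ->] := span z; exists (fun i => c (enum_val i)).
  rewrite (reindex (@enum_val I I)) /=; last exact/onW_bij/enum_val_bij.
  by apply: eq_bigr.
case: (ex_minnP exP) => n /asboolP [b bspan] minn.
have bfree : forall c : 'I_n -> F, \sum_i f (c i) * b i = 0 -> forall i, c i = 0.
  case: n b bspan minn => [b _ _ c _ []//|n b bspan minn c e i].
  apply/eqP; apply: contraT => ci; suff /asboolP/minn : P n by rewrite ltnn.
  exists (fun j => b (lift i j)) => z; have [d ->] := bspan z.
  have fci : f (c i) != 0 by rewrite fmorph_eq0.
  have bi : b i = \sum_(j < n) f (- ((c i)^-1 * c (lift i j))) * b (lift i j).
    apply: (mulfI fci); move: e; rewrite (bigD1_ord i) //= => /eqP.
    rewrite addr_eq0 => /eqP ->; rewrite mulr_sumr -sumrN; apply: eq_bigr => j _.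
    by rewrite mulrA -rmorphM mulrN mulrA divff // mul1r rmorphN mulNr.
  exists (fun j => d (lift i j) - d i * ((c i)^-1 * c (lift i j))).
  rewrite (bigD1_ord i) //= {1}bi mulr_sumr -big_split; apply: eq_bigr => j _.
  by rewrite rmorphB mulrBl addrC mulrA -rmorphM mulrN rmorphN mulNr.
exists (fext_of bspan bfree), (idfun : {rmorphism K -> K}) => c.
by rewrite -[RHS]/(f c * 1) mulr1.
Qed.

Section MaximalQuotient.
Variables (T : comNzRingType) (M : T -> Prop).
Hypotheses (M0 : M 0) (M1 : ~ M 1) (MD : forall a x y, M x -> M y -> M (a * x + y))
  (Mmax : forall x, ~ M x -> exists y m, M m /\ 1 = y * x + m).

Definition mq_pred (_ : M 0) (_ : ~ M 1) (_ : forall a x y, M x -> M y -> M (a * x + y))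
  (_ : forall x, ~ M x -> exists y m, M m /\ 1 = y * x + m) : {pred T} := [pred x | `[< M x >]].
Local Notation P := (mq_pred M0 M1 MD Mmax).
Fact mq_closed : idealr_closed P.
Proof.
split; [exact/asboolP|exact/asboolP|].
by move=> a x y /asboolP hx /asboolP hy; apply/asboolP; exact: MD.
Qed.
HB.instance Definition _ := isIdealr.Build T P mq_closed.
Definition mq := {ideal_quot P}.
HB.instance Definition _ := GRing.ComNzRing.on mq.
Definition mq_pi : {rmorphism T -> mq} := \pi_(mq)%qT.

Lemma mq_pi0 x : mq_pi x = 0 <-> M x.
Proof.
rewrite -(rmorph0 mq_pi); split=> [/eqP|h].
  by rewrite -Quotient.idealrBE subr0 => /asboolP.
by apply/eqP; rewrite -Quotient.idealrBE subr0; exact/asboolP.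
Qed.
Lemma mq_pi_surj y : exists x, mq_pi x = y.
Proof. by exists (repr y); exact: reprK. Qed.
Lemma mq_inv_ex (y : mq) : exists z, y != 0 -> z * y = 1.
Proof.
have [x <-] := mq_pi_surj y.
have [h|/Mmax [u [m [Mm e]]]] := pselect (M x).
  by exists 0; rewrite (mq_pi0 x).2 // eqxx.
exists (mq_pi u) => _; rewrite -rmorphM -(rmorph1 mq_pi) e rmorphD.
by rewrite (mq_pi0 m).2 // addr0.
Qed.
Definition mq_inv (y : mq) : mq := if y == 0 then 0 else projT1 (cid (mq_inv_ex y)).
Fact mq_mulV y : y != 0 -> mq_inv y * y = 1.
Proof. by move=> y0; rewrite /mq_inv ifN //; case: cid => z /= ->. Qed.
Fact mq_inv0 : mq_inv 0 = 0. Proof. by rewrite /mq_inv ifT. Qed.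
HB.instance Definition _ := GRing.ComNzRing_isField.Build mq mq_mulV mq_inv0.
End MaximalQuotient.

(** The idempotent [d] is nonzero, so [1 - d] generates a proper ideal. The residue field at a
    maximal ideal containing it is finite over [k] by Zariski's lemma, and [d] becomes 1 there. *)
Lemma nullstellensatz (k : fieldType) (T : comAlgType k) (d : T) :
  finitely_generated T -> d * d = d -> d != 0 ->
  exists (L : fieldExtType k) (h : {lrmorphism T -> L}), h d = 1.
Proof.
move=> [n [b gen]] dd d0.
pose W (x : T^o) := exists y, x = y * (1 - d).
have sW : submod W.
  split; first by exists 0; rewrite mul0r.
  by move=> c x y [u ->] [v ->]; exists (c * u + v); rewrite mulrDl -mulrA.
have W1 : ~ W 1.
  move=> [y e]; move/eqP: d0; apply.
  by rewrite -[d]mul1r e -mulrA mulrBl mul1r dd subrr mulr0.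
have [M [sM WM M1 maxM]] := maximal_submod sW W1.
have MD a x y : M x -> M y -> M (a * x + y) by exact: sM.2.
have Mmax x : ~ M x -> exists y m, M m /\ 1 = y * x + m by exact: maxM.
pose K := mq sM.1 M1 MD Mmax; pose pi : {rmorphism T -> K} := mq_pi sM.1 M1 MD Mmax.
have surj : forall y, exists x, pi x = y by exact: mq_pi_surj.
pose f : {rmorphism k -> K} := pi \o in_alg T.
have genK : generates f (fun i => pi (b i)).
  move=> S Sf SD SM Sb y; have [x <-] := surj y.
  apply: (gen (fun x => S (pi x))) => [|c u v hu hv|u v hu hv|//].
  - by have := Sf 1; rewrite /f /= scale1r.
  - rewrite rmorphD -[c *: u]mulr_algl rmorphM; apply: SD => //; apply: SM => //.
    exact: Sf.
  - by rewrite rmorphM; exact: SM.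
have iK z := zariski genK z.
have [I [s span]] := integral_span genK (fun i => iK (pi (b i))).
have [L [h hE]] := fext_exists span.
have hlin : linear (h \o pi).
  move=> c x y; rewrite -[c *: x]mulr_algl /= !rmorphD !rmorphM /=.
  by rewrite -[pi _]/(f c) hE mulr_algl.
pose g : {lrmorphism T -> L} := HB.pack (h \o pi)
  (GRing.isLinear.Build k T L *:%R (h \o pi) hlin)
  (GRing.RMorphism.on (h \o pi)).
exists L, g; apply/eqP; rewrite -subr_eq0 -(rmorph1 g) -rmorphB.
apply/eqP; rewrite /= -[d - 1]opprB !rmorphN -[h _]/(h (pi (1 - d))).
rewrite [pi _](mq_pi0 _ _ _ _ _).2 ?rmorph0 ?oppr0 //.
by apply: WM; exists 1; rewrite mul1r.
Qed.

Lemma span_dependent (k : fieldType) (V : lmodType k) n (b : 'I_n -> V) (v : 'I_n.+1 -> V) :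
  (forall a, exists c : 'I_n -> k, a = \sum_(i < n) c i *: b i) ->
  exists c : 'I_n.+1 -> k, (exists i, c i != 0) /\ \sum_i c i *: v i = 0.
Proof.
move=> span; have [m mE] := choice (fun i => span (v i)).
pose M := \matrix_(i < n.+1, j < n) m i j.
have : kermx M != 0.
  rewrite -mxrank_eq0 mxrank_ker -lt0n subn_gt0.
  by rewrite (leq_ltn_trans (rank_leq_col _)).
case/rowV0Pn => u /sub_kermxP uM /rV0Pn [i ui].
exists (u ord0); split; first by exists i.
under eq_bigr do rewrite mE scaler_sumr.
rewrite exchange_big big1 // => j _.
under eq_bigr do rewrite scalerA.
rewrite -scaler_suml; have := congr1 (fun X : 'rV_n => X ord0 j) uM.
rewrite !mxE => e; rewrite (eq_bigr (fun l => u ord0 l * M l j)) ?e ?scale0r // => l _.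
by rewrite mxE.
Qed.

Lemma fieldExt_finite (k : fieldType) (L : fieldExtType k) : finite_dim (sa_even L).
Proof.
exists (\dim {:L}), (fun i => (vbasis {:L})`_i) => a.
by exists (fun i => coord (vbasis {:L}) i a); rewrite -coord_vbasis ?memvf.
Qed.

(** * Points and components *)

Section Indicator.
Variables (k : fieldType) (P : supergroup k) (e : coord_alg P).
Hypotheses (pe : parity false e) (ee : e * e = e) (epse : counit P e = 1)
  (absorb : forall x, x * e = (counit P x : k) *: e).

(* As [e] cuts out the identity component, [agree u v] is the idempotent of [A] cutting out
   the locus where [u] and [v] lie in the same component. *)
Definition agree A (u v : P A) : A := pt (u * v^-1)%g e.

Lemma agree_map A B (f : saHom A B) (u v : P A) :
  f (agree u v) = agree (gf_map f u) (gf_map f v).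
Proof. by rewrite /agree -gf_mapV -gf_mapM pt_nat. Qed.

Lemma agree_even A (u v : P A) : parity false (agree u v).
Proof. exact: sa_parity. Qed.

Lemma agree_idem A (u v : P A) : agree u v * agree u v = agree u v.
Proof. by rewrite -rmorphM ee. Qed.

Lemma agree_id A (u : P A) : agree u u = 1.
Proof. by rewrite /agree mulgV pt1E epse scale1r. Qed.

Lemma agree_sum n (a b : 'I_n -> coord_alg P) : comult P e = \sum_(i < n) kpur (a i) (b i) ->
  forall A (u v : P A), agree u v = \sum_(i < n) pt u (a i) * pt v^-1%g (b i).
Proof. by move=> ce A u v; rewrite /agree (ptME ce). Qed.

(** With [w = u v^-1] one has [u = w v], and absorption makes [w] trivial after multiplication by
    its value at [e]. *)
Lemma agreeP A (u v : P A) x : pt u x * agree u v = pt v x * agree u v.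
Proof.
have [n [a [b ab]]] := stensE (comult P x).
rewrite /agree; set w := (u * v^-1)%g.
have uE : u = (w * v)%g by rewrite /w mulgVK.
have we := @sa_parity _ _ _ (pt w) _ _ pe.
have -> : pt u x = \sum_(i < n) pt w (a i) * pt v (b i) by rewrite {1}uE (ptME ab).
have -> : pt v x = \sum_(i < n) (counit P (a i) : k)%:A * pt v (b i).
  rewrite -{1}[v]mul1g (ptME ab); apply: eq_bigr => i _; congr (_ * _).
  exact: pt1E.
rewrite !mulr_suml; apply: eq_bigr => i _.
rewrite -!mulrA -(even_central (pt v (b i)) we) !mulrA; congr (_ * _).
by rewrite -rmorphM /= absorb linearZ /= -scalerAl mul1r.
Qed.

Section FieldPoints.
Variable L : fieldExtType k.
Local Notation LS := (sa_even L).

Lemma agree_field (u v : P LS) : u <> v -> agree u v = 0.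
Proof.
move=> uv; apply/eqP; apply: contraT => d0; exfalso; apply: uv.
apply: pt_inj; apply: saHom_ext => x.
exact: (mulIf (d0 : (agree u v : L) != 0) (agreeP u v x)).
Qed.

(** Distinct points over a field are separated by an [x] at which their difference is a unit. On the
    product of the two idempotents [u] agrees with both, so this unit annihilates the product. *)
Lemma agree_orth A (f : saHom LS A) (u : P A) (v v' : P LS) : v <> v' ->
  agree u (gf_map f v) * agree u (gf_map f v') = 0.
Proof.
move=> vv'; have [x xP] : exists x, pt v x <> pt v' x.
  by apply: contrapT => /forallNP h; apply: vv'; apply: pt_inj; apply: saHom_ext => x;
    apply: contrapT; exact: h.
set d := agree u _; set d' := agree u _.
have e1 : pt u x * d = f (pt v x) * d by rewrite /d agreeP pt_nat.
have e2 : pt u x * d' = f (pt v' x) * d' by rewrite /d' agreeP pt_nat.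
have z : f (pt v x - pt v' x) * (d * d') = 0.
  rewrite raddfB mulrBl /= mulrA -e1 (even_central d' (agree_even _ _)) mulrA -e2.
  by rewrite -!mulrA (even_central d (agree_even _ _)) subrr.
have c0 : (pt v x - pt v' x : L) != 0 by rewrite subr_eq0; exact/eqP.
have fc : f ((pt v x - pt v' x : L)^-1 : LS) * f (pt v x - pt v' x) = 1.
  by rewrite -(rmorph1 f) -[RHS](congr1 f (mulVf c0)) rmorphM.
by rewrite -[LHS]mul1r -fc -mulrA z mulr0.
Qed.

(** The matrix of the values [agree (v i) (v j)] is the identity, and the coproduct of [e] factors
    it through dimension [n]. *)
Lemma points_bound n (a b : 'I_n -> coord_alg P) m (v : 'I_m -> P LS) :
  comult P e = \sum_(i < n) kpur (a i) (b i) -> injective v -> (m <= n)%N.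
Proof.
move=> ce iv; pose M := \matrix_(j < m, i < n) (pt (v j) (a i) : L).
pose N := \matrix_(i < n, j < m) (pt (v j)^-1%g (b i) : L).
have : M *m N = 1%:M.
  apply/matrixP => i j; rewrite !mxE; under eq_bigr do rewrite !mxE.
  transitivity (agree (v i) (v j)); first refine (esym (agree_sum ce (v i) (v j))).
  have [->|ij] := eqVneq i j.
    by rewrite mulr1n; refine (agree_id (v j)).
  by rewrite mulr0n; apply: agree_field => /iv h; rewrite h eqxx in ij.
move=> MN; have := mxrankM_maxl M N; rewrite MN mxrank1 => le.
exact: leq_trans le (rank_leq_col M).
Qed.
End FieldPoints.
End Indicator.

Section Glue.
Variables (k : fieldType) (A B : superAlgebra k) (m : nat) (d : 'I_m -> B).
Variable h : 'I_m -> saHom A B.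
Hypotheses (pd : forall i, parity false (d i)) (dd : forall i, d i * d i = d i)
  (dorth : forall i j, i != j -> d i * d j = 0) (dsum : \sum_i d i = 1).
Let g a := \sum_i d i * h i a.
Fact glue_linear : linear g.
Proof.
move=> c a b; rewrite /g scaler_sumr -big_split; apply: eq_bigr => i _ /=.
by rewrite linearP mulrDr scalerAr.
Qed.
Fact glue_monoid : monoid_morphism g.
Proof.
split=> [|a b]; first by rewrite /g -dsum; apply: eq_bigr => i _; rewrite rmorph1 mulr1.
rewrite /g mulr_suml; apply: eq_bigr => i _; rewrite mulr_sumr (bigD1 i) //= big1 ?addr0.
  by rewrite rmorphM /= -[RHS]mulrA [h i a * (_ * _)]mulrA -(even_central (h i a) (pd i)) !mulrA dd.
move=> j ij; rewrite mulrA -[d i * _ * _]mulrA -(even_central _ (pd j)).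
by rewrite mulrA dorth 1?eq_sym // !mul0r.
Qed.
Fact glue_parity i a : parity i a -> parity i (g a).
Proof.
move=> pa; apply: parity_sum => j _; exact: (parityM (pd j) (sa_parity (h j) pa)).
Qed.
Definition glue : saHom A B := SaHom glue_linear glue_monoid glue_parity.
End Glue.

Section TensorMisc.
Variable k : fieldType.
Lemma finite_fg (A : superAlgebra k) : finite_dim A -> finitely_generated A.
Proof.
move=> [n [b span]]; exists n, b => S S1 Sl SM Sb a.
have S0 : S 0 by have := Sl (-1) 1 1 S1 S1; rewrite scaleN1r addNr.
have [c ->] := span a; elim/big_ind: _ => // [x y hx hy|i _].
  by rewrite -[x]scale1r; exact: Sl.
by rewrite -[_ *: _]addr0; exact: Sl.
Qed.

Lemma ktens_fg (A B : superAlgebra k) :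
  finitely_generated A -> finitely_generated B -> finitely_generated (ktens A B).
Proof.
move=> [n [a ga]] [m [b gb]].
exists (n + m)%N, (fun i => match split i with inl j => kinl A B (a j) | inr j => kinr A B (b j) end).
move=> S S1 Sl SM Sb.
have Sa : forall x, S (kinl A B x).
  apply: ga => [|c x y hx hy|x y hx hy|i].
  - by rewrite rmorph1.
  - by rewrite linearP; exact: Sl.
  - by rewrite rmorphM; exact: SM.
  - by have := Sb (unsplit (inl i)); rewrite unsplitK.
have Sb' : forall x, S (kinr A B x).
  apply: gb => [|c x y hx hy|x y hx hy|i].
  - by rewrite rmorph1.
  - by rewrite linearP; exact: Sl.
  - by rewrite rmorphM; exact: SM.
  - by have := Sb (unsplit (inr i)); rewrite unsplitK.
have S0 : S 0 by have := Sl (-1) 1 1 S1 S1; rewrite scaleN1r addNr.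
apply: stens_ind => // [x y hx hy|x y].
  by rewrite -[x]scale1r; exact: Sl.
rewrite -[tpur _ _ _]/(kpur x y) kpurE; exact: SM.
Qed.

Lemma kinl_inj (A B : superAlgebra k) : injective (kinl A B).
Proof.
apply: raddf_inj => a e.
have [psi [_ psi1]] := separation (zero_submod B) (@one_not_zero k B).
have [h hE] := ktens_contrr A psi.
have := hE a 1; rewrite psi1 scale1r => <-.
by rewrite -[pur _ _ _ _]/(kinl A B a) e raddf0.
Qed.

Lemma saHom_field_inj (T : comAlgType k) (E : fieldExtType k)
  (f : saHom (sa_even E) (sa_even T)) : injective f.
Proof.
apply: raddf_inj => x fx; apply/eqP; apply: contraT => x0.
have fc : f ((x : E)^-1 : sa_even E) * f x = 1.
  by rewrite -(rmorph1 f) -[RHS](congr1 f (mulVf (x0 : (x : E) != 0))) rmorphM.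
by move/eqP: fc; rewrite fx mulr0 eq_sym oner_eq0.
Qed.
End TensorMisc.

Section ComponentAt.
Variables (k : fieldType) (G : supergroup k) (S : hopfSub G) (e : esub_sa S).
Local Notation P := (hsg S).
Variables (L : fieldExtType k) (m : nat) (g : 'I_m -> G (sa_even L)).
Local Notation LS := (sa_even L).

Lemma hsg_counit (x : esub_sa S) : counit P x = counit G (incl S x).
Proof. by rewrite -[LHS]/((counit G (incl S x) : k)%:A) [_%:A]mulr1. Qed.

(** The idempotent of [A (x) L] over which [x] lies in the component of the [j]-th chosen point. *)
Definition comp_at A (x : P A) j : ktens A LS :=
  agree (P := P) e (gf_map (kinl A LS) x) (gf_map (kinr A LS) (res S (g j) : P LS)).

Lemma comp_at_map A B (u : saHom A B) (x : P A) j :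
  ktmap u (sa_id LS) (comp_at x j) = comp_at (gf_map u x) j.
Proof.
rewrite /comp_at (agree_map (P := P)) -!(@gf_map_comp k P) ktmap_inl ktmap_inr.
by rewrite sa_comp1.
Qed.
End ComponentAt.

Section Lift.
Variables (k : fieldType) (G : supergroup k) (S : hopfSub G).
Local Notation O := (coord_alg G).
Local Notation E := (esub_sa S).
Local Notation P := (hsg S).
Variable e : E.
Hypotheses (ee : e * e = e) (epse : counit P e = 1)
  (absorb : forall x, x * e = (counit P x : k) *: e).
Variables (L : fieldExtType k) (m : nat) (g : 'I_m -> G (sa_even L)).
Local Notation LS := (sa_even L).
Hypothesis ig : injective (fun i => res S (g i)).
Hypothesis total : \sum_j comp_at e g (sa_id E : P E) j = 1.
Let pe : parity false e. Proof. by left. Qed.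

Section Point.
Variables (A : superAlgebra k) (x : P A).
Local Notation AL := (ktens A LS).

Local Notation comp_at := (comp_at e g x).

(** The hypothesis [total] concerns the universal point of [P]; every [x] is the image of that point
    under a homomorphism, which transports the sum. *)
Lemma comp_at_sum : \sum_j comp_at j = 1.
Proof.
rewrite -(rmorph1 (ktmap (x : saHom E A) (sa_id LS))) -total raddf_sum.
by apply: eq_bigr => j _; rewrite [RHS]comp_at_map [gf_map _ _]sa_comp1.
Qed.

Lemma comp_at_even j : parity false (comp_at j). Proof. exact: agree_even. Qed.
Lemma comp_at_idem j : comp_at j * comp_at j = comp_at j.
Proof. exact: agree_idem. Qed.
Lemma comp_at_orth i j : i != j -> comp_at i * comp_at j = 0.
Proof.
move=> ij; have h : (res S (g i) : P LS) <> res S (g j).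
  by move=> /ig h; rewrite h eqxx in ij.
exact: (agree_orth (P := P) pe absorb (kinr A LS) _ h).
Qed.

Lemma comp_atP j y : comp_at j * kinr A LS (pt (g j) (incl S y)) = comp_at j * kinl A LS (x y).
Proof.
have h := agreeP (P := P) pe absorb (gf_map (kinl A LS) x)
    (gf_map (kinr A LS) (res S (g j) : P LS)) y.
have c b := even_central b (comp_at_even j).
by rewrite !c; exact: (esym h).
Qed.

Definition lift_point : saHom O AL :=
  glue (fun j => sa_comp (kinr A LS) (pt (g j))) comp_at_even comp_at_idem comp_at_orth
    comp_at_sum.

Lemma lift_pointE : res S (elt lift_point) = sa_comp (kinl A LS) x.
Proof.
rewrite res_elt; apply: saHom_ext => y.
rewrite -[LHS]/(\sum_j comp_at j * kinr A LS (pt (g j) (incl S y))).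
by under eq_bigr do rewrite comp_atP; rewrite -mulr_suml comp_at_sum mul1r.
Qed.
End Point.

(** On the [j]-th piece the universal point takes at [y] the value of [g j], and the pieces add up
    to 1. *)
Lemma points_inj (y : E) : (forall j, res S (g j) y = 0) -> y = 0.
Proof.
move=> h; apply: (@kinl_inj k E LS); rewrite raddf0.
rewrite -[LHS]mul1r -(comp_at_sum (sa_id E : P E)) mulr_suml; apply: big1 => j _.
rewrite -[X in _ * X]/(kinl E LS (sa_id E y)) -comp_atP.
by rewrite -[pt _ _]/(res S (g j) y) h raddf0 mulr0.
Qed.

(** Over [L], the element [y] is the sum of its values at the points times the idempotents of the
    pieces. By the coproduct of [e] these idempotents lie in [W (x) L], with [W] the span of the
    [a i]; independence of 1 in [L] brings [y] itself into [W]. *)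
Lemma hsg_finite : sg_finite P.
Proof.
have [n [a [b ab]]] := stensE (comult P e).
exists n, a => y.
pose l i : L := \sum_j (pt ((res S (g j) : P LS)^-1)%g (b i) : L) * (res S (g j) y : L).
have ey : kpur y (1 : LS) = \sum_(i < n) kpur (a i) (l i : LS).
  rewrite -[LHS]/(kinl E LS y) -[LHS]mul1r -(comp_at_sum (sa_id E : P E)) mulr_suml.
  under eq_bigr => j _.
    rewrite -[X in _ * X]/(kinl E LS (sa_id E y)) -comp_atP.
    rewrite /comp_at (agree_sum (P := P) (ab : _ = \sum_(i < n) kpur (a i) (b i))) mulr_suml.
    over.
  rewrite exchange_big; apply: eq_bigr => i _.
  rewrite kpurE (_ : (l i : LS) = \sum_j (pt ((res S (g j) : P LS)^-1)%g (b i)) * (res S (g j) y)) //.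
  rewrite raddf_sum mulr_sumr; apply: eq_bigr => j _.
  rewrite -mulrA; congr (_ * _).
  rewrite [RHS]rmorphM; congr (_ * _).
have i1 : indep (fun _ : 'I_1 => (1 : LS)).
  move=> c; rewrite big_ord1 => /eqP; rewrite scaler_eq0 oner_eq0 orbF => /eqP h i.
  by rewrite (ord1 i).
pose W (z : E) := exists c : 'I_n -> k, z = \sum_(i < n) c i *: a i.
have sW : submod W.
  split; first by exists (fun=> 0); rewrite big1 // => i _; rewrite scale0r.
  move=> c _ _ [u ->] [v ->]; exists (fun i => c * u i + v i).
  rewrite scaler_sumr -big_split; apply: eq_bigr => i _.
  by rewrite scalerDl scalerA.
have Wa i : W (a i).
  exists (fun j => (j == i)%:R); rewrite (bigD1 i) //= eqxx scale1r big1 ?addr0 //.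
  by move=> j /negPf ->; rewrite scale0r.
apply: (@ktens_indep_r k E LS 1 (fun=> y) (fun=> 1) n a (fun i => l i) W i1 sW Wa _ ord0).
by rewrite big_ord1.
Qed.
End Lift.

(* Chinese remainder theorem for the images of [A], which are subfields of [L]. *)
Section Separable.
Variables (k : fieldType) (A : comAlgType k) (L : fieldExtType k).
Hypothesis sepL : forall K : fieldExtType k, separable 1%AS {:K}.
Variables (m : nat) (r : 'I_m -> {lrmorphism A -> L}).
Hypothesis rinj : forall a : A, (forall j, r j a = 0) -> a = 0.
Hypothesis fdA : finite_dim A.

Lemma hom_image_subfield (h : {lrmorphism A -> L}) :
  exists (U : {subfield L}), forall u : L, u \in U <-> exists a : A, h a = u.
Proof.
have [n [s span]] := fdA.
pose X := [tuple h (s i) | i < n].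
have inX a : h a \in <<X>>%VS.
  have [c ->] := span a; rewrite rmorph_sum /=; apply: rpred_sum => i _.
  rewrite linearZ /=; apply: rpredZ; apply: memv_span.
  by apply/mapP; exists i => //; rewrite mem_enum.
have Xin u : u \in <<X>>%VS -> exists a, h a = u.
  move=> /coord_span ->; exists (\sum_i coord X i u *: s i).
  rewrite rmorph_sum /=; apply: eq_bigr => i _.
  by rewrite linearZ /= nth_mktuple.
have hU : is_aspace <<X>>%VS.
  apply/andP; split; first by apply: has_algid1; rewrite -(rmorph1 h); exact: inX.
  apply/prodvP => u v /Xin [a <-] /Xin [b <-].
  by rewrite -rmorphM; exact: inX.
by exists (ASpace hU) => u; split=> [/Xin|[a <-]].
Qed.

Lemma hom_to_subfield (h : {lrmorphism A -> L}) (U : {subfield L}) :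
  (forall u : L, u \in U <-> exists a : A, h a = u) ->
  exists f : {lrmorphism A -> subvs_of U}, forall a, vsval (f a) = h a.
Proof.
move=> hU; have hin a : h a \in U by apply/hU; exists a.
pose f a : subvs_of U := vsproj U (h a).
have fE a : vsval (f a) = h a by rewrite vsprojK.
have fl : linear f.
  by move=> c a b; apply: subvs_inj; rewrite linearP /= !fE linearP.
have fm : monoid_morphism f.
  split=> [|a b]; apply: subvs_inj; first by rewrite rmorph1 fE rmorph1.
  by rewrite rmorphM /= !fE rmorphM.
pose F : {lrmorphism A -> subvs_of U} := HB.pack f
  (GRing.isLinear.Build k A (subvs_of U) *:%R f fl)
  (GRing.isMonoidMorphism.Build A (subvs_of U) f fm).
by exists F.
Qed.

Lemma separable_of_points : separable_algebra A.
Proof.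
(* Minimality separates the maps that are kept: if everything killed by [r i] were killed by [r j],
   then [j] could be dropped from [J]. *)
pose inj (J : {set 'I_m}) := forall a : A, (forall j, j \in J -> r j a = 0) -> a = 0.
have [J /minsetP [/asboolP iJ minJ]] : {J : {set 'I_m} | minset (fun J => `[< inj J >]) J}.
  apply: ex_minset; exists [set: 'I_m]; apply/asboolP => a h.
  by apply: rinj => j; apply: h.
have sep i j : i \in J -> j \in J -> i != j -> exists a, r i a = 0 /\ r j a <> 0.
  move=> iJ' jJ ij; apply: contrapT => h.
  suff e : J :\ j = J by move: jJ; rewrite -e !inE eqxx.
  apply: minJ; last exact: subD1set.
  apply/asboolP => a ha; apply: iJ => l lJ; have [->|lj] := eqVneq l j.
    by apply: contrapT => rj; apply: h; exists a; split=> //; apply: ha; rewrite !inE ij.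
  by apply: ha; rewrite !inE lj.
pose ix (i : 'I_#|J|) : 'I_m := enum_val i.
have ixJ i : ix i \in J := enum_valP i.
have ix_inj : injective ix := enum_val_inj.
have [U UP] := choice (fun i => hom_image_subfield (r (ix i))).
have fex i := hom_to_subfield (UP i).
pose f i := projT1 (cid (fex i)).
have fE i a : vsval (f i a) = r (ix i) a by rewrite /f; case: cid.
(* The product of the separating elements vanishes at every other map, and not at [j] because [L] is
   a field. *)
have bex j : exists b : A, r (ix j) b <> 0 /\ forall i, i != j -> r (ix i) b = 0.
  have c i : exists a, i != j -> r (ix i) a = 0 /\ r (ix j) a <> 0.
    have [->|ij] := eqVneq i j; first by exists 0.
    have [|a ha] := sep (ix i) (ix j) (ixJ i) (ixJ j); last by exists a.
    by apply: contra ij => /eqP /ix_inj ->.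
  have [a aP] := choice c.
  exists (\prod_(i | i != j) a i); split=> [|i ij].
    rewrite rmorph_prod /= => /eqP; rewrite prodf_seq_eq0.
    by case/hasP=> i _ /= /andP[ij /eqP]; have [] := aP _ ij.
  by rewrite (bigD1 i) //= rmorphM /= (aP _ ij).1 mul0r.
have [b bP] := choice bex.
exists #|J|, (fun i => subvs_of (U i)), f; split=> [i|y]; first exact: sepL.
have zex i : exists z : A, r (ix i) z = vsval (y i) / r (ix i) (b i).
  by apply/UP; apply: rpred_div; [exact: subvsP | apply/UP; exists (b i)].
have [z zE] := choice zex.
exists (\sum_j b j * z j); split=> [i|a ha].
  apply: subvs_inj; rewrite fE rmorph_sum /= (bigD1 i) //= big1 ?addr0.
    rewrite rmorphM /= zE mulrC mulfVK //; exact/eqP/(bP i).1.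
  by move=> j ji; rewrite rmorphM /= (bP j).2 ?mul0r // eq_sym.
apply/eqP; rewrite -subr_eq0; apply/eqP; apply: iJ => j jJ.
have [i ->] : exists i, j = ix i by exists (enum_rank_in jJ j); rewrite /ix enum_rankK_in.
rewrite rmorphB /= rmorph_sum /= (bigD1 i) //= big1 ?addr0.
  rewrite rmorphM /= zE mulrC mulfVK -?fE ?ha ?subrr //.
  by rewrite fE; exact/eqP/(bP i).1.
by move=> j' ji; rewrite rmorphM /= (bP j').2 ?mul0r // eq_sym.
Qed.
End Separable.

Definition even_lr (k : fieldType) (A B : comAlgType k) (h : saHom (sa_even A) (sa_even B)) :
    {lrmorphism A -> B} :=
  HB.pack (sa_fun h : A -> B)
    (GRing.isLinear.Build k A B *:%R (sa_fun h : A -> B) (sa_linear h))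
    (GRing.isMonoidMorphism.Build A B (sa_fun h : A -> B) (sa_monoid h)).

(** * Finite field extensions as fppf covers *)

Section TensorUniversal.
Variables (k : fieldType) (A B : superAlgebra k) (f : saHom A B).
Variables (M : lmodType A) (T : zmodType) (t : B -> M -> T).
Hypothesis tT : is_tensor f t.

Lemma is_tensor_ext (U : zmodType) (h h' : {additive T -> U}) :
  (forall b m, h (t b m) = h' (t b m)) -> h =1 h'.
Proof.
move=> e; case: tT => [[t1 t2 t3] univ].
have bu : balanced f (fun b m => h' (t b m)).
  by split=> *; rewrite ?t1 ?t2 ?t3 ?raddfD.
have [g [_ gu]] := univ _ _ bu => z.
by rewrite (gu h e) (gu h' (fun _ _ => erefl)).
Qed.
End TensorUniversal.

Section Free.
Variables (k : fieldType) (A B : superAlgebra k) (f : saHom A B).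
Variables (n : nat) (c : 'I_n.+1 -> B).
Hypotheses (pc : forall i, parity false (c i))
  (span : forall b, exists a : 'I_n.+1 -> A, b = \sum_i f (a i) * c i)
  (free : forall a : 'I_n.+1 -> A, \sum_i f (a i) * c i = 0 -> forall i, a i = 0).

Let co b := projT1 (cid (span b)).
Let coE b : b = \sum_i f (co b i) * c i. Proof. exact: projT2 (cid (span b)). Qed.
Let co_unique b a : b = \sum_i f (a i) * c i -> forall i, co b i = a i.
Proof.
move=> e i; apply/eqP; rewrite -subr_eq0; apply/eqP; move: i.
apply: (free (a := fun i => co b i - a i)).
under eq_bigr do rewrite raddfB /= mulrBl.
by rewrite sumrB -coE -e subrr.
Qed.
Let coD b b' i : co (b + b') i = co b i + co b' i.
Proof.
apply: (co_unique (a := fun i => co b i + co b' i)).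
under eq_bigr do rewrite raddfD /= mulrDl.
by rewrite big_split -!coE.
Qed.
Let coM b a i : co (b * f a) i = co b i * a.
Proof.
apply: (co_unique (a := fun i => co b i * a)); rewrite {1}(coE b) mulr_suml.
by apply: eq_bigr => j _; rewrite rmorphM /= -!mulrA (even_central (f a) (pc j)).
Qed.

Section CoMap.
Variables (M : lmodType A) (T : zmodType) (t : B -> M -> T).
Hypothesis tT : is_tensor f t.

(** Coordinates identify any tensor product of [B] and [M] with a power of [M]. An arbitrary [t]
    satisfying [is_tensor] is treated, as flatness quantifies over all of them. *)
Lemma free_coord : exists phi : {additive T -> {ffun 'I_n.+1 -> M}},
  (forall b m, phi (t b m) = [ffun i => co b i *: m]) /\
  forall z, z = \sum_i t (c i) (phi z i).
Proof.
have bu : balanced f (fun b m => [ffun i => co b i *: m] : {ffun 'I_n.+1 -> M}).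
  split=> *; apply/ffunP => i; rewrite !ffunE ?coD ?scalerDl ?scalerDr //.
  by rewrite coM scalerA.
case: (tT) => [[t1 t2 t3] univ]; have [phi [phiE _]] := univ _ _ bu.
exists phi; split=> // z.
have t0 b : t b 0 = 0 by apply/(addIr (t b 0)); rewrite -t2 !add0r.
pose g (z : T) := \sum_i t (c i) (phi z i).
have gz : zmod_morphism g.
  move=> x y; rewrite /g -sumrB; apply: eq_bigr => i _.
  by apply/eqP; rewrite eq_sym subr_eq -t2 raddfB !ffunE subrK.
pose G : {additive T -> T} := HB.pack g (GRing.isZmodMorphism.Build T T g gz).
apply: (is_tensor_ext tT (h := idfun) (h' := G)) => b m /=.
rewrite /g phiE {1}(coE b) (big_morph (t^~ m) (fun x y => t1 x y m) (_ : t 0 m = 0)).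
  apply: eq_bigr => i _.
  by rewrite -(even_central _ (pc i)) t3 ffunE.
by apply/(addIr (t 0 m)); rewrite -t1 !add0r.
Qed.
End CoMap.

(** In coordinates [h] is [j] applied to each entry, whence flatness. The basis is indexed by
    ['I_n.+1] and so is nonempty; the first coordinate of [c ord0 (x) m] is [m], whence
    faithfulness. *)
Lemma free_faithfully_flat : faithfully_flat f.
Proof.
split=> [M M' j jinj T T' t t' tT tT' h hE|M T t tT T0 m].
  apply: raddf_inj => z hz.
  have [phi [phiE phiS]] := free_coord tT.
  have [phi' [phiE' _]] := free_coord tT'.
  pose g (z : T) := [ffun i => j (phi z i)] : {ffun 'I_n.+1 -> M'}.
  have gz : zmod_morphism g.
    by move=> x y; apply/ffunP => i; rewrite !ffunE !raddfB !ffunE raddfB.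
  pose Gm : {additive T -> {ffun 'I_n.+1 -> M'}} :=
    HB.pack g (GRing.isZmodMorphism.Build _ _ g gz).
  pose H : {additive T -> {ffun 'I_n.+1 -> M'}} := phi' \o h.
  have e : H =1 Gm.
    apply: (is_tensor_ext tT) => b m /=; rewrite hE phiE' /g.
    by apply/ffunP => i; rewrite !ffunE phiE ffunE linearZ.
  have := e z; rewrite /= hz raddf0 => /ffunP ez.
  rewrite (phiS z) big1 // => i _.
  have -> : phi z i = 0 by apply: jinj; rewrite raddf0; have := ez i; rewrite !ffunE => <-.
  by case: tT => [[_ t2 _] _]; apply/(addIr (t (c i) 0)); rewrite -t2 !add0r.
have [phi [phiE _]] := free_coord tT.
have := phiE (c ord0) m; rewrite [t _ _]T0 raddf0 => /ffunP /(_ ord0).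
rewrite !ffunE (co_unique (a := fun i => (i == ord0)%:R)) ?eqxx ?scale1r //.
rewrite (bigD1 ord0) //= rmorph1 mul1r big1 ?addr0 // => i /negPf ->.
by rewrite rmorph0 mul0r.
Qed.
End Free.

Section SuperPoly.
Variable k : fieldType.
Local Notation KX := (sa_even {poly k}).

Section Eval.
Variables (C : superAlgebra k) (c : C).
Hypothesis pc : parity false c.

Fact poly_eval_linear : linear (horner_alg c : KX -> C).
Proof.
move=> a x y; rewrite -[a *: x](mul_polyC a (x : {poly k})) rmorphD rmorphM /=.
by rewrite horner_algC -scalerAl mul1r.
Qed.
Fact poly_eval_monoid : monoid_morphism (horner_alg c : KX -> C).
Proof. by split=> [|a b]; [exact: rmorph1 | exact: rmorphM]. Qed.
Fact poly_eval_parity i (q : KX) : parity i q -> parity i (horner_alg c q).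
Proof.
case=> ->; last by rewrite raddf0; exact: parity0.
elim/poly_ind: (q : {poly k}) => [|r a IH]; first by rewrite raddf0; exact: parity0.
rewrite rmorphD rmorphM /= horner_algX horner_algC; apply: parityD.
  exact: (parityM IH pc).
exact/parityZ/parity1.
Qed.
Definition poly_eval : saHom KX C :=
  SaHom poly_eval_linear poly_eval_monoid poly_eval_parity.
Lemma poly_evalX : poly_eval 'X = c.
Proof. exact: horner_algX. Qed.
End Eval.

Lemma poly_hom_sum n (C : superAlgebra k) (h : saHom KX C) (q : {poly k}) :
  (size q <= n)%N -> h q = \sum_(i < n) q`_i *: h 'X ^+ i.
Proof.
move=> le; rewrite -[q in LHS]coefK poly_def raddf_sum.
rewrite (big_ord_widen n (fun i => h (q`_i *: 'X^i)) le) big_mkcond.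
apply: eq_bigr => i _; rewrite linearZ /= saHomX; case: ltnP => // h'.
by rewrite nth_default // scale0r.
Qed.

Lemma spoly_polynomial (A : superAlgebra k) : polynomial_superalgebra (kinl A KX)
  (fun _ : 'I_1 => kinr A KX 'X) (fun _ : 'I_0 => 0).
Proof.
split=> [i|[]//|C g c d pc _]; first by apply: sa_parity; left.
exists (kcopair g (poly_eval (pc ord0))); split.
  split=> [a|i|[]//]; first exact: kcopair_inlE.
  by rewrite (ord1 i) kcopair_inrE poly_evalX.
move=> h' [h1 h2 _] q; congr (sa_fun _ q); apply: ktens_hom_ext.
  by rewrite kcopair_inl; exact: saHom_ext.
rewrite kcopair_inr; apply: saHom_ext => r; have le := leqnn (size (r : {poly k})).
rewrite !(poly_hom_sum _ le) poly_evalX; apply: eq_bigr => j _.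
by rewrite -(h2 ord0).
Qed.
End SuperPoly.

(** [theta] is a primitive element. Its minimal polynomial [m], of degree [n + 1], will be the
    single relation of a finite presentation. *)
Lemma power_basis (k : fieldType) (L : fieldExtType k) : separable 1%AS {:L} ->
  exists (theta : L) (n : nat) (m : {poly k}),
  [/\ m \is monic /\ size m = n.+2, \sum_(i < n.+2) m`_i *: theta ^+ i = 0,
      forall l, exists c : 'I_n.+1 -> k, l = \sum_i c i *: theta ^+ i
    & forall c : 'I_n.+1 -> k, \sum_i c i *: theta ^+ i = 0 -> forall i, c i = 0].
Proof.
move=> /eq_adjoin_separable_generator /(_ (sub1v _)); set t := separable_generator _ _ => full.
have [n nE] : exists n, adjoin_degree 1%AS t = n.+1 by exists (adjoin_degree 1%AS t).-1.
have /polyOver1P [m mE] : minPoly 1%AS t \is a polyOver 1%VS by exact: minPolyOver.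
have sm : size m = n.+2.
  by have := size_minPoly 1%AS t; rewrite mE size_map_poly nE.
have mm : m \is monic by have := monic_minPoly 1%AS t; rewrite mE map_monic.
exists t, n, m; split=> //.
- have := root_minPoly 1%AS t; rewrite mE => /rootP.
  rewrite (@horner_coef_wide _ n.+2) ?size_map_poly ?sm // => e.
  rewrite -[RHS]e; apply: eq_bigr => i _.
  by rewrite coef_map /= -scalerAl mul1r.
- move=> l; have : l \in <<1; t>>%VS by rewrite -full memvf.
  move=> /Fadjoin_poly_eq; have := size_Fadjoin_poly 1%AS t l.
  have /polyOver1P [q ->] : Fadjoin_poly 1%AS t l \is a polyOver 1%VS.
    exact: Fadjoin_polyOver.
  rewrite nE size_map_poly => sq <-; exists (fun i => q`_i).
  rewrite (@horner_coef_wide _ n.+1) ?size_map_poly //.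
  by apply: eq_bigr => i _; rewrite coef_map /= -scalerAl mul1r.
move=> c e; pose q := \poly_(i < n.+1) c (inord i).
have rq : root (map_poly (in_alg L) q) t.
  rewrite /root (@horner_coef_wide _ n.+1) ?size_map_poly ?size_poly //.
  rewrite -[X in _ == X]e; apply/eqP; apply: eq_bigr => i _.
  by rewrite coef_map coef_poly ltn_ord inord_val /= -scalerAl mul1r.
have q0 : q = 0.
  apply/eqP; apply: contraT => qn0.
  have d : minPoly 1%AS t %| map_poly (in_alg L) q.
    by apply: minPoly_dvdp => //; apply/polyOver1P; exists q.
  have := dvdp_leq _ d; rewrite mE !size_map_poly sm map_poly_eq0 => /(_ qn0) h.
  by have := leq_trans h (size_poly _ _); rewrite ltnn.
by move=> i; have := congr1 (fun p : {poly k} => p`_i) q0;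
  rewrite coef0 coef_poly ltn_ord inord_val.
Qed.

Section FieldExtensionCover.
Variables (k : fieldType) (A : superAlgebra k) (L : fieldExtType k).
Hypothesis sepL : separable 1%AS {:L}.
Local Notation LS := (sa_even L).
Local Notation AL := (ktens A LS).

Lemma ext_fppf : fppf (kinl A LS).
Proof.
have [t [n [m [[mm sm] mt span free]]]] := power_basis sepL.
have pt : parity false (kinr A LS t) by apply: sa_parity; left.
pose c (i : 'I_n.+1) : AL := kinr A LS t ^+ i.
have cE (i : nat) : kinr A LS t ^+ i = kinr A LS (t ^+ i : L) by rewrite saHomX.
have free' a : \sum_i kinl A LS (a i) * c i = 0 -> forall i, a i = 0.
  move=> e i; have ind : indep (fun i : 'I_n.+1 => (t ^+ i : LS)) by exact: free.
  have h := @ktens_indep_r k A LS n.+1 a (fun i => (t ^+ i : L)) 0 (fun=> 0) (fun=> 0)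
    (fun x => x = 0) ind (zero_submod A).
  apply: h => [[]//|]; rewrite big_ord0 -[RHS]e; apply: eq_bigr => j _.
  by rewrite kpurE /c cE.
have span' b : exists a : 'I_n.+1 -> A, b = \sum_i kinl A LS (a i) * c i.
  elim/stens_ind: b => [|x y [a ->] [a' ->]|x l].
  - by exists (fun=> 0); rewrite big1 // => i _; rewrite raddf0 mul0r.
  - exists (fun i => a i + a' i); rewrite -big_split; apply: eq_bigr => i _.
    by rewrite raddfD /= mulrDl.
  - have [d dE] := span l; exists (fun i => d i *: x).
    rewrite -[LHS]/(kpur x (l : LS)) kpurE [X in kinr A LS X]dE.
    rewrite (saHom_sum (kinr A LS)) mulr_sumr; apply: eq_bigr => i _.
    by rewrite (saHomZ (kinr A LS)) (saHomZ (kinl A LS)) /c cE -scalerAl -scalerAr.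
have pc i : parity false (c i) by exact: parity_exp.
split; first exact: (free_faithfully_flat pc span' free').
pose KX := sa_even {poly k}; pose F := ktens A KX.
pose X : F := kinr A KX 'X.
have pt' : parity false (t : LS) by left.
pose v : saHom F AL := kcopair (kinl A LS) (sa_comp (kinr A LS) (poly_eval pt')).
have vl a : v (kinl A KX a) = kinl A LS a by exact: kcopair_inlE.
have vr q : v (kinr A KX q) = kinr A LS (poly_eval pt' q) by exact: kcopair_inrE.
have vX i : v (X ^+ i) = kinr A LS t ^+ i by rewrite saHomX vr poly_evalX.
exists F, (kinl A KX), 1%N, 0%N, (fun _ => X), (fun _ => 0), v.
split=> //; first exact: spoly_polynomial.
- move=> b; have [a ->] := span' b; exists (\sum_i kinl A KX (a i) * X ^+ i).
  by rewrite saHom_sum; apply: eq_bigr => i _; rewrite saHomM vl vX.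
have vm : v (kinr A KX m) = 0.
  rewrite vr (@poly_hom_sum _ n.+2) ?sm // poly_evalX.
  by rewrite [X in kinr A LS X](mt : _ = 0 :> L) raddf0.
(* Division with remainder by [m] in the factor [k[X]]. By freeness the remainder of an element of
   the kernel of [v] vanishes, so [m] alone generates the kernel. *)
have rep (z : F) : exists w (a : 'I_n.+1 -> A),
    z = w * kinr A KX m + \sum_i kinl A KX (a i) * X ^+ i.
  elim/stens_ind: z => [|z z' [w [a ->]] [w' [a' ->]]|x q].
  - exists 0, (fun=> 0); rewrite mul0r add0r big1 // => i _.
    by rewrite raddf0 mul0r.
  - exists (w + w'), (fun i => a i + a' i); rewrite mulrDl addrACA -big_split.
    by congr (_ + _); apply: eq_bigr => i _; rewrite saHomD mulrDl.
  move: (q : {poly k}) => {}q.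
  exists (kpur x ((q %/ m)%R : KX)), (fun i => (q %% m)`_i *: x).
  rewrite -[tpur _ _ _]/(kpur x (q : KX)) !kpurE -mulrA -saHomM.
  rewrite [X in kinr A KX X](divp_eq q m) saHomD mulrDr; congr (_ + _).
  rewrite (@poly_hom_sum _ n.+1); last by rewrite -ltnS -sm ltn_modp -size_poly_eq0 sm.
  rewrite mulr_sumr; apply: eq_bigr => i _.
  by rewrite saHomZ -scalerAl scalerAr.
exists 1%N, (fun=> kinr A KX m) => z; split=> [|[a ->]]; last first.
  by rewrite big_ord1 saHomM vm mulr0.
have [w [a ->]] := rep z; rewrite saHomD saHomM vm mulr0 add0r saHom_sum => e.
exists (fun=> w); rewrite big_ord1 [X in _ + X]big1 ?addr0 // => i _.
rewrite (free' a) ?raddf0 ?mul0r // -[RHS]e; apply: eq_bigr => j _.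
by rewrite saHomM vl vX.
Qed.
End FieldExtensionCover.

(* A linear dependence between the prefix products [u] of [f] has a first nonzero term [j];
   it reads [u j = u j * w] with [ev w = 0], hence [u j = 0]. *)
Lemma nil_ideal_nilpotent (k : fieldType) (A : superAlgebra k) (ev : saHom A (sa_base k)) :
  finite_dim A -> (forall z, ev z = 0 -> exists n, z ^+ n = 0) ->
  exists n, forall f : 'I_n -> A, (forall i, ev (f i) = 0) -> \prod_(i < n) f i = 0.
Proof.
move=> [D [b span]] nil; exists D => f hf.
pose F i : A := if insub i is Some j then f j else 0.
have Ff (i : 'I_D) : F i = f i by rewrite /F valK.
have evF i : ev (F i) = 0 by rewrite /F; case: insubP => [j _ _|_]; rewrite ?raddf0.
pose u j := \prod_(0 <= i < j) F i.
have <- : u D = \prod_(i < D) f i.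
  by rewrite /u big_mkord; apply: eq_bigr => i _; exact: Ff.
have [c [[i0 ci0] e]] := span_dependent (fun j : 'I_D.+1 => u j) span.
have exj : exists j, [exists i : 'I_D.+1, (i == j :> nat) && (c i != 0)].
  by exists i0; apply/existsP; exists i0; rewrite eqxx.
case: (ex_minnP exj) => j0 /existsP [j /andP[/eqP jj0 cj]] minj.
have lt0 (i : 'I_D.+1) : (i < j)%N -> c i = 0.
  move=> lt; apply/eqP; apply: contraT => ci.
  have := minj i; rewrite -jj0 leqNgt lt => h; apply: h.
  by apply/existsP; exists i; rewrite eqxx.
have uM (i : nat) : (j <= i)%N -> u i = u j * \prod_(j <= l < i) F l.
  by move=> le; rewrite -big_cat_nat.
pose w := \sum_(i < D.+1 | (j < i)%N) c i *: \prod_(j <= l < i) F l.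
have ew : u j * (c j *: 1 + w) = 0.
  rewrite -[RHS]e [RHS](bigID (fun i : 'I_D.+1 => (i < j)%N)) /=.
  rewrite [X in _ = X + _]big1 ?add0r; last by move=> i /lt0 ->; rewrite scale0r.
  rewrite [RHS](bigD1 j) ?ltnn //= mulrDr -scalerAr mulr1; congr (_ + _).
  rewrite mulr_sumr; apply: eq_big => [i|i ji].
    by rewrite -leqNgt ltn_neqAle -val_eqE eq_sym andbC.
  by rewrite -scalerAr -uM // ltnW.
have evw : ev w = 0.
  rewrite saHom_sum big1 // => i ji; rewrite saHomZ big_ltn // saHomM evF mul0r.
  exact: scaler0.
have [n wn] : exists n, (- ((c j)^-1 *: w)) ^+ n = 0.
  by apply: nil; rewrite raddfN /= (saHomZ ev) evw scaler0 oppr0.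
have uj : u j = u j * (- ((c j)^-1 *: w)).
  move/eqP: ew; rewrite mulrDr -scalerAr mulr1 addr_eq0 => /eqP h.
  apply: (scalerI cj); rewrite h mulrN -scalerAr scalerN scalerA divff // scale1r.
  by [].
have uj0 : u j = 0.
  suff h l : u j = u j * (- ((c j)^-1 *: w)) ^+ l by rewrite (h n) wn mulr0.
  by elim: l => [|l IH]; rewrite ?mulr1 // exprS mulrA -uj.
by rewrite uM ?uj0 ?mul0r // -ltnS.
Qed.

(** * Perfect base fields of characteristic p > 2 *)

Section PerfectField.
Variables (k : fieldType) (p : nat).
Hypotheses (kchar : p \in [pchar k]) (pgt2 : (2 < p)%N).
Hypothesis kperfect : forall x : k, exists y : k, y ^+ p = x.

Lemma pchar_alg (A : algType k) : p \in [pchar A].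
Proof.
apply/andP; split; first by case/andP: kchar.
by rewrite -(scaler_nat p (1 : A)) (pcharf0 kchar) scale0r.
Qed.

Lemma two_neq0 : (2 : k) != 0.
Proof.
rewrite -(dvdn_pcharf kchar); apply/negP => /dvdn_leq.
by move=> /(_ isT); rewrite leqNgt pgt2.
Qed.

Section Frobenius.
Variable A : superAlgebra k.

(** The even and odd parts commute, so the p-th power is additive on them, and the odd part squares
    to zero because 2 is invertible. *)
Lemma frob_even (a : A) : a ^+ p = spart false a ^+ p.
Proof.
rewrite [in LHS](spartE a).
have cm : GRing.comm (spart false a) (spart true a).
  by apply: even_central; exact: spart_parity.
have := pFrobenius_autD_comm (pchar_alg A) cm.
rewrite !pFrobenius_autE => ->.
rewrite -[RHS]addr0; congr (_ + _).
rewrite -(subnK (ltnW pgt2)) exprD expr2.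
by rewrite (odd_sqr two_neq0 (spart_parity _ _)) mulr0.
Qed.

Lemma frob_parity (a : A) : parity false (a ^+ p).
Proof. by rewrite frob_even; apply/parity_exp/spart_parity. Qed.

Lemma frobD (a b : A) : (a + b) ^+ p = a ^+ p + b ^+ p.
Proof.
rewrite frob_even raddfD [a ^+ p]frob_even [b ^+ p]frob_even.
have cm : GRing.comm (spart false a) (spart false b).
  by apply: even_central; exact: spart_parity.
by have := pFrobenius_autD_comm (pchar_alg A) cm; rewrite !pFrobenius_autE.
Qed.

Lemma p_gt0 : (0 < p)%N. Proof. exact: ltn_trans pgt2. Qed.

(** The even part of [a * b] is the product of the even parts plus the product [c] of the odd parts;
    as [c] squares to zero, the p-th power does not see it. *)
Lemma frobM (a b : A) : (a * b) ^+ p = a ^+ p * b ^+ p.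
Proof.
have pp := @spart_parity k A.
set c := spart true a * spart true b.
have cc : c * c = 0.
  rewrite /c mulrA -[X in X * _]mulrA (super_comm (pp true b) (pp true a)).
  by rewrite expr1 mulN1r mulrN mulrA (odd_sqr two_neq0 (pp _ _)) mul0r oppr0 mul0r.
have cp : c ^+ p = 0 by rewrite -(subnK (ltnW pgt2)) exprD expr2 cc mulr0.
have e : spart false (a * b) = spart false a * spart false b + c.
  rewrite [in LHS](spartE a) [in LHS](spartE b) mulrDl !mulrDr !raddfD /=.
  have q i j := parityM (pp i a) (pp j b).
  rewrite (spart_id (q false false)) (spart_neg (q false true)).
  by rewrite (spart_neg (q true false)) (spart_id (q true true)) addr0 add0r.
rewrite frob_even e frobD cp addr0 [a ^+ p]frob_even [b ^+ p]frob_even.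
by rewrite exprMn_comm //; apply: even_central.
Qed.

Lemma frob0 : (0 : A) ^+ p = 0.
Proof. by rewrite expr0n -[p]prednK ?p_gt0. Qed.

Lemma frobnD n (a b : A) : (a + b) ^+ (p ^ n) = a ^+ (p ^ n) + b ^+ (p ^ n).
Proof.
elim: n => [|n IH]; first by rewrite expn0 !expr1.
by rewrite expnSr !exprM IH frobD.
Qed.

Lemma frobnM n (a b : A) : (a * b) ^+ (p ^ n) = a ^+ (p ^ n) * b ^+ (p ^ n).
Proof.
elim: n => [|n IH]; first by rewrite expn0 !expr1.
by rewrite expnSr !exprM IH frobM.
Qed.

Lemma frob_sum (I : Type) (r : seq I) (P : pred I) (F : I -> A) :
  (\sum_(i <- r | P i) F i) ^+ p = \sum_(i <- r | P i) F i ^+ p.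
Proof. exact: (big_morph _ frobD frob0). Qed.

Lemma frobn0 n : (0 : A) ^+ (p ^ n) = 0.
Proof. by rewrite expr0n -[(p ^ n)%N]prednK ?expn_gt0 ?p_gt0. Qed.

Lemma frobn_sum n (I : Type) (r : seq I) (P : pred I) (F : I -> A) :
  (\sum_(i <- r | P i) F i) ^+ (p ^ n) = \sum_(i <- r | P i) F i ^+ (p ^ n).
Proof. by apply: (big_morph _ (frobnD n) (frobn0 n)). Qed.

End Frobenius.

Lemma perfect_iter n (x : k) : exists y : k, y ^+ (p ^ n) = x.
Proof.
elim: n x => [|n IH] x; first by exists x; rewrite expr1.
by have [y <-] := kperfect x; have [z <-] := IH y; exists z; rewrite expnSr exprM.
Qed.

Section Alg.
Variable A : superAlgebra k.

Definition ppow n (x : A) := exists y, x = y ^+ (p ^ n).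

(** Closure under scalars is where perfectness of [k] is used: a scalar is itself a [p ^ n]-th
    power. *)
Lemma ppow_submod n : submod (ppow n).
Proof.
split; first by exists 0; rewrite frobn0.
move=> c _ _ [y ->] [z ->]; have [d <-] := perfect_iter n c.
by exists (d *: y + z); rewrite frobnD exprZn.
Qed.
Lemma ppowM n x y : ppow n x -> ppow n y -> ppow n (x * y).
Proof. by move=> [a ->] [b ->]; exists (a * b); rewrite frobnM. Qed.
Lemma ppow1 n : ppow n 1. Proof. by exists 1; rewrite expr1n. Qed.
Lemma ppow_even n x : ppow n.+1 x -> parity false x.
Proof. by move=> [y ->]; rewrite expnSr exprM; exact: frob_parity. Qed.
Lemma ppow_le m n x : (m <= n)%N -> ppow n x -> ppow m x.
Proof.
move=> /subnK <- [y ->]; exists (y ^+ (p ^ (n - m))).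
by rewrite expnD exprM.
Qed.

Definition frob_sub n : evenSub A :=
  @EvenSub k A (ppow n.+1) (ppow1 _) (ppow_submod n.+1).2 (@ppowM n.+1)
    (@ppow_even n).

Definition pperf (x : A) := forall n, ppow n x.
Lemma pperf_submod : submod pperf.
Proof.
split=> [n|c x y hx hy n]; first exact: (ppow_submod n).1.
exact: (ppow_submod n).2.
Qed.
Definition perf_sub : evenSub A :=
  @EvenSub k A pperf (fun n => ppow1 n) pperf_submod.2
    (fun x y hx hy n => ppowM (hx n) (hy n)) (fun x hx => ppow_even (hx 1%N)).
End Alg.

(** * Hopf subalgebras of p-th powers and the Frobenius quotient *)

Section FrobeniusHopf.
Variable G : supergroup k.
Local Notation O := (coord_alg G).

Lemma kpurX (A B : superAlgebra k) (a : A) (b : B) n :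
  kpur a b ^+ (p ^ n) = kpur (a ^+ (p ^ n)) (b ^+ (p ^ n)).
Proof. by rewrite !kpurE frobnM !saHomX. Qed.

Lemma ppow_comult n (x : O) : ppow n x ->
  exists m (a b : 'I_m -> O), [/\ forall i, ppow n (a i),
      forall i, ppow n (b i) & comult G x = \sum_(i < m) kpur (a i) (b i)].
Proof.
move=> [y ->]; have [m [a [b e]]] := stensE (comult G y).
exists m, (fun i => a i ^+ (p ^ n)), (fun i => b i ^+ (p ^ n)).
split=> [i|i|]; [by exists (a i)|by exists (b i)|].
rewrite saHomX e frobn_sum; apply: eq_bigr => i _.
exact: kpurX.
Qed.

Lemma ppow_antipode n (x : O) : ppow n x -> ppow n (antipode G x).
Proof. by move=> [y ->]; exists (antipode G y); rewrite saHomX. Qed.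

Definition frob_hopf : hopfSub G :=
  @HopfSub k G (frob_sub O 0) (@ppow_comult 1) (@ppow_antipode 1).

(** A representation with independent factors is fixed before [n]; independence forces its factors
    into the [p ^ n]-th powers for every [n] simultaneously. *)
Lemma pperf_comult (x : O) : pperf x ->
  exists m (a b : 'I_m -> O), [/\ forall i, pperf (a i),
      forall i, pperf (b i) & comult G x = \sum_(i < m) kpur (a i) (b i)].
Proof.
move=> hx; have [m [a [b [e ia ib]]]] := ktens_min (comult G x).
exists m, a, b; split=> // i n;
have [m' [c [d [hc hd e']]]] := ppow_comult (hx n); rewrite e in e'.
  exact: (ktens_indep_r ib (ppow_submod O n) hc e').
exact: (ktens_indep_l ia (ppow_submod O n) hd e').
Qed.

Definition perf_hopf : hopfSub G :=
  @HopfSub k G (perf_sub O) pperf_comult (fun x hx n => ppow_antipode (hx n)).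

Lemma frob_kernelP A (g : G A) :
  res frob_hopf g = hone frob_hopf A <-> frobenius_kernel p g.
Proof.
split=> [h x [n [a [f [f0 ->]]]]|h].
  rewrite raddf_sum; apply: big1 => i _ /=; rewrite rmorphM /=.
  have [y ye] : exists y, incl frob_hopf y = f i ^+ p.
    by apply: incl_ex; exists (f i); rewrite expn1.
  rewrite -ye -[pt g (incl _ y)]/(res frob_hopf g y) h.
  rewrite -[X in _ * X]/((counit G (incl frob_hopf y) : k)%:A) ye saHomX f0.
  by rewrite frob0 scale0r mulr0.
apply: saHom_ext => x; rewrite -[LHS]/(pt g (incl _ x)).
rewrite -[RHS]/((counit G (incl frob_hopf x) : k)%:A).
have [y ->] := inclP x; rewrite expn1.
set c : k := counit G y.
(* Subtracting the counit moves [y] into the augmentation ideal, whose p-th powers are killed by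
   [g]; the scalar remainder contributes the counit. *)
have e : y = (y - c%:A) + c%:A by rewrite subrK.
rewrite e frobD !raddfD /=.
have c1 : counit G (y - c%:A) = 0.
  by rewrite raddfB /= linearZ /= rmorph1 [c *: _]mulr1 subrr.
have -> : pt g ((y - c%:A) ^+ p) = 0.
  apply: h; exists 1%N, (fun=> 1), (fun=> y - c%:A); split=> //.
  by rewrite big_ord1 mul1r.
rewrite [in RHS]saHomX c1 frob0 !add0r exprZn expr1n !linearZ /= !rmorph1.
by rewrite [_ *: (1 : k^o)]mulr1.
Qed.

Lemma frob_quotient : is_frobenius_quotient p (hproj frob_hopf).
Proof.
split.
- by move=> f; case.
- by move=> A g; exact: frob_kernelP.
- by rewrite hproj_comorphism; exact: incl_inj.
move=> x; rewrite hproj_comorphism; split=> [[a <-]|[f ->]].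
  by have [y ->] := inclP a; exists y; rewrite expn1.
by apply: incl_ex; exists f; rewrite expn1.
Qed.
End FrobeniusHopf.

(* A nontrivial relation between the iterated p-th powers of [w], of minimal length,
   has a nonzero first coefficient, and all its other terms are p-th powers. *)
Lemma frob_surj (A : superAlgebra k) (W : A -> Prop) : finite_dim A -> submod W ->
  (forall x, W x -> W (x ^+ p)) -> (forall x, W x -> x ^+ p = 0 -> x = 0) ->
  forall w, W w -> exists2 w', W w' & w = w' ^+ p.
Proof.
move=> [n [b span]] sW WF Finj w Ww.
have Wi i : W (w ^+ (p ^ i)).
  by elim: i => [|i IH]; [rewrite expn0 expr1|rewrite expnSr exprM; exact: WF].
pose P m := exists c : 'I_m.+1 -> k, (exists i, c i != 0) /\
  \sum_i c i *: w ^+ (p ^ i) = 0.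
have exP : exists m, `[< P m >].
  exists n; apply/asboolP; exact: (span_dependent (fun i : 'I_n.+1 => w ^+ (p ^ i)) span).
case: (ex_minnP exP) => m /asboolP [c [[i ci] e]] minm.
have [d dE] := choice (fun i => kperfect (c i)).
pose z := \sum_(j < m) d (lift ord0 j) *: w ^+ (p ^ j).
have e2 : \sum_(j < m) c (lift ord0 j) *: w ^+ (p ^ j.+1) = z ^+ p.
  by rewrite frob_sum; apply: eq_bigr => j _; rewrite exprZn dE expnSr exprM.
have Wz : W z by apply: (submod_sum sW) => j _; exact: submodZ.
rewrite big_ord_recl expr1 (eq_bigr (fun j : 'I_m => c (lift ord0 j) *: w ^+ (p ^ j.+1))) // e2 in e.
have [c0|c0] := eqVneq (c ord0) 0.
  rewrite c0 scale0r add0r in e; have z0 := Finj _ Wz e.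
  case: m c i ci c0 d dE @z {Wz} e e2 z0 minm => [|m] c i ci c0 d dE z e e2 z0 minm.
    by move: ci; rewrite (ord1 i) c0 eqxx.
  suff /asboolP/minm : P m by rewrite ltnn.
  exists (fun j => d (lift ord0 j)); split=> //.
  have [j ij|i0] := unliftP ord0 i; last by rewrite i0 c0 eqxx in ci.
  exists j; apply: contra ci => /eqP dj.
  by rewrite ij -dE dj expr0n -[p]prednK ?p_gt0.
have [t tE] := kperfect (- (c ord0)^-1).
exists (t *: z); first exact: submodZ.
rewrite exprZn tE scaleNr; apply: (scalerI c0); rewrite scalerN scalerA divff // scale1r.
by apply/eqP; rewrite -addr_eq0 e.
Qed.

Lemma fieldExt_perfect (L : fieldExtType k) (x : L) : exists y, y ^+ p = x.
Proof.
have [] := @frob_surj (sa_even L) (fun=> True) (fieldExt_finite L) _ _ _ x I; last by move=> y _ ->; exists y.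
- by split.
- by [].
- by move=> y _ /eqP; rewrite expf_eq0 => /andP[_ /eqP].
Qed.

Section PowAlgebra.
Variable A : superAlgebra k.
Local Notation T := (esub (frob_sub A 0)).

Fact pow_of_ex (x : A) : exists y : T, val y = x ^+ p.
Proof. by apply: incl_ex; exists x; rewrite expn1. Qed.
Definition pow_of x : T := projT1 (cid (pow_of_ex x)).
Lemma pow_ofE x : val (pow_of x) = x ^+ p. Proof. exact: projT2 (cid (pow_of_ex x)). Qed.
Lemma pow_of_surj (y : T) : exists x, pow_of x = y.
Proof.
have [x xE] := esubP y; exists x; apply: val_inj.
by rewrite pow_ofE xE expn1.
Qed.
Lemma pow_of1 : pow_of 1 = 1.
Proof. by apply: val_inj; rewrite pow_ofE expr1n. Qed.
Lemma pow_of_lin c x y : pow_of (c *: x + y) = c ^+ p *: pow_of x + pow_of y.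
Proof. by apply: val_inj; rewrite /= !pow_ofE frobD exprZn. Qed.
Lemma pow_ofM x y : pow_of (x * y) = pow_of x * pow_of y.
Proof. by apply: val_inj; rewrite /= !pow_ofE frobM. Qed.

(** The Frobenius is only semilinear, but a set closed under all scalars absorbs the twisted scalar
    [c ^+ p]. *)
Lemma pow_fg : finitely_generated A -> finitely_generated T.
Proof.
move=> [n [b gen]]; exists n, (fun i => pow_of (b i)) => S S1 Sl SM Sb y.
have [x <-] := pow_of_surj y; move: x; apply: gen => [|c x x'|x x'|//].
- by rewrite pow_of1.
- by rewrite pow_of_lin; exact: Sl.
- by rewrite pow_ofM; exact: SM.
Qed.

(** [A] is not commutative, so the Nullstellensatz is applied to its p-th powers. The point of [A]
    sends [x] to the p-th root of the value at [x ^+ p]; roots exist and are unique in the perfect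
    field [L], and they undo the twist of scalars. *)
Lemma super_point d : finitely_generated A -> parity false d -> d * d = d -> d != 0 ->
  exists (L : fieldExtType k) (h : saHom A (sa_even L)), h d = 1.
Proof.
move=> fg pd dd d0.
have dn n : d ^+ n.+1 = d by elim: n => [|n IH]; rewrite ?expr1 // exprS IH.
have dp : d ^+ p = d by rewrite -[p]prednK ?p_gt0 // dn.
have [||L [h hd]] := nullstellensatz (d := pow_of d) (pow_fg fg).
- by rewrite -pow_ofM dd.
- by apply: contra d0 => /eqP /(congr1 val); rewrite pow_ofE dp => ->.
exists L; have [g gE] := choice (fun x => fieldExt_perfect (h (pow_of x))).
have inj (x y : L) : x ^+ p = y ^+ p -> x = y.
  rewrite -!(pFrobenius_autE (pchar_alg L)); exact: fmorph_inj.
have gl : linear (g : A -> sa_even L).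
  move=> c x y; apply: inj; rewrite gE pow_of_lin linearP /=.
  by rewrite (@frobD (sa_even L)) exprZn !gE.
have gm : monoid_morphism (g : A -> sa_even L).
  split=> [|x y]; apply: inj; first by rewrite gE pow_of1 rmorph1 expr1n.
  by rewrite gE pow_ofM rmorphM exprMn !gE.
have gp i x : parity i x -> parity i (g x : sa_even L).
  case: i => px; last by left.
  right; apply: inj; rewrite gE (_ : pow_of x = 0) ?rmorph0 ?(frob0 (sa_even L)) //.
  apply: val_inj; rewrite pow_ofE frob_even (spart_neg px).
  by rewrite frob0.
exists (SaHom gl gm gp); apply: inj.
by rewrite /= gE hd expr1n.
Qed.
End PowAlgebra.

(** * The perfect part of a finitely generated superalgebra *)

Section PerfectClosure.
Variable A : superAlgebra k.
Hypothesis fgA : finitely_generated A.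

Local Notation T := (esub (frob_sub A 0)).
Local Notation TS := (esub_sa (frob_sub A 0)).

Lemma pow_noetherian : noetherian T.
Proof. exact/fg_noetherian/pow_fg. Qed.

Local Notation inc := (incl (frob_sub A 0)).
Lemma valX (x : T) n : val (x ^+ n) = val x ^+ n. Proof. exact: (rmorphXn inc). Qed.
Lemma valM (x y : T) : val (x * y) = val x * val y. Proof. exact: (rmorphM inc). Qed.

Lemma expn_pos n : (0 < p ^ n)%N. Proof. by rewrite expn_gt0 p_gt0. Qed.

(** Otherwise there are [y n] killed by the power [p ^ n.+1] and not by [p ^ n]. Noetherianity makes
    some [y n] a combination of earlier ones, all of which are killed by [p ^ n]. The shift from
    [n0] to [n0.+1] passes from [A] to its p-th powers. *)
Lemma frob_inj_ex : exists n0, forall x : A, ppow n0.+1 x -> x ^+ p = 0 -> x = 0.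
Proof.
suff [n0 h] : exists n0, forall y : TS, y ^+ (p ^ n0.+1) = 0 -> y ^+ (p ^ n0) = 0.
  exists n0 => _ [y ->] e.
  have [z ze] := pow_of_ex y.
  have z0 : z ^+ (p ^ n0) = 0 :> TS.
    apply: h; apply: (@incl_inj _ _ (frob_sub A 0)).
    by rewrite saHomX raddf0 [incl _ z]ze -exprM mulnC exprM e.
  rewrite expnS exprM -ze -[val z]/(incl (frob_sub A 0) z).
  by rewrite -saHomX z0 raddf0.
apply: contrapT => /forallNP nh.
have ex n : exists y : T, y ^+ (p ^ n.+1) = 0 /\ y ^+ (p ^ n) <> 0.
  by have /existsNP [y /not_implyP h] := nh n; exists y.
have [y yP] := choice ex.
have [n [h e]] := pow_noetherian y.
have [_] := yP n; apply; rewrite e.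
rewrite [LHS](@frobn_sum TS); apply: big1 => i _.
rewrite exprMn (_ : y i ^+ _ = 0) ?mulr0 //.
transitivity ((y i ^+ (p ^ i.+1)) ^+ (p ^ (n - i.+1))).
  by rewrite -exprM -expnD subnKC.
rewrite (yP i).1.
by rewrite expr0n -[(p ^ _)%N]prednK ?expn_pos.
Qed.

(** The candidate root is a high power of a high root of [x]. It is a [p ^ n]-th power for each [n],
    since any other such root of [x] differs from it by an element on which the Frobenius is already
    injective. *)
Lemma pperf_root (x : A) : pperf x -> exists2 z, pperf z & z ^+ p = x.
Proof.
have [n0 inj] := frob_inj_ex; move=> hx.
have [y ye] := hx n0.+2; exists (y ^+ (p ^ n0.+1)); last first.
  by rewrite -exprM -expnSr.
move=> n; have [le|lt] := leqP n n0.+1.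
  by apply: (ppow_le le); exists y.
have [u ue] := hx n.+1.
suff -> : y ^+ (p ^ n0.+1) = u ^+ (p ^ n) by exists u.
apply/eqP; rewrite -subr_eq0; apply/eqP; apply: inj.
  apply: (submodB (ppow_submod A n0.+1)); first by exists y.
  by apply: (ppow_le (ltnW lt)); exists u.
have -> : y ^+ (p ^ n0.+1) - u ^+ (p ^ n) = (-1 : k) *: u ^+ (p ^ n) + y ^+ (p ^ n0.+1).
  by rewrite scaleN1r addrC.
rewrite frobD exprZn -!exprM -!expnSr -ue -ye.
have -> : (-1 : k) ^+ p = -1.
  by have := pFrobenius_autN kchar 1; rewrite !pFrobenius_autE expr1n.
by rewrite scaleN1r addNr.
Qed.

Lemma pperf_frob0 (x : A) : pperf x -> x ^+ p = 0 -> x = 0.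
Proof. by have [n0 inj] := frob_inj_ex; move=> hx; exact: inj (hx _). Qed.

Lemma pperf_rootn n (x : A) : pperf x -> exists2 z, pperf z & z ^+ (p ^ n) = x.
Proof.
elim: n => [|n IH] hx; first by exists x; rewrite ?expr1.
have [z hz <-] := IH hx; have [u hu <-] := pperf_root hz.
by exists u => //; rewrite expnS exprM.
Qed.

Lemma idem_exp (f : A) n : f * f = f -> (0 < n)%N -> f ^+ n = f.
Proof.
by move=> ff; case: n => // n _; elim: n => [|n IH]; rewrite ?expr1 // exprS IH.
Qed.

Lemma idem_pperf (f : A) : f * f = f -> pperf f.
Proof. by move=> ff n; exists f; rewrite idem_exp // expn_pos. Qed.

Lemma pperf_T (x : A) : pperf x -> exists y : T, val y = x.
Proof. by move=> hx; apply: (incl_ex (S := frob_sub A 0)); exact: hx. Qed.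

(* The ideals generated by the successive p-th roots of [x] increase; once they
   stabilise, a root [y] satisfies [y = h y^p] and [h y^(p-1)] is idempotent. *)
Lemma pperf_idem (ev : saHom A (sa_base k)) (x : A) : pperf x -> ev x = 0 ->
  exists f, [/\ f * f = f, parity false f, ev f = 0 & f * x = x].
Proof.
move=> hx ex.
have step (y : {y : T | pperf (val y)}) : exists z : {y : T | pperf (val y)},
    val (sval z) ^+ p = val (sval y).
  case: y => y hy /=; have [z hz e] := pperf_root hy.
  have [t te] := pperf_T hz; rewrite -te in hz.
  by exists (exist _ t hz); rewrite /= te.
have [nx nxP] := choice step.
have [x0 x0e] := pperf_T hx; have hx0 := hx; rewrite -x0e in hx0.
pose s n := iter n nx (exist _ x0 hx0).
pose xs n : T := sval (s n).
have xsP n : xs n.+1 ^+ p = xs n by apply: val_inj; rewrite valX; exact: nxP.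
have xsj m i : xs i = xs (m + i)%N ^+ (p ^ m).
  by elim: m => [|m IH]; [rewrite expr1|rewrite addSn expnS exprM xsP].
have xs0 n : xs n ^+ (p ^ n) = x0.
  elim: n => [|n IH]; first by rewrite expr1.
  by rewrite expnS exprM xsP.
have evX n (a : A) : ev (a ^+ n) = ev a ^+ n by exact: rmorphXn.
have exs n : ev (val (xs n)) = 0.
  have := congr1 (fun t => ev (val t)) (xs0 n); rewrite /= x0e ex valX evX => /eqP.
  by rewrite expf_eq0 => /andP[_ /eqP].
have [n cn] := pow_noetherian xs.
have [h hE] : exists h, xs n = h * xs n ^+ p.
  case: n cn => [|n] cn.
    by exists 0; case: cn => c ->; rewrite big_ord0 mul0r.
  rewrite xsP; apply: comb_chain cn => i le.
  exists (xs n ^+ (p ^ (n - i)).-1); rewrite -exprSr prednK ?expn_pos //.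
  by have := xsj (n - i)%N i; rewrite subnK.
pose y := xs n; pose f := h * y ^+ p.-1.
have fy : f * y = y.
  by rewrite /f -mulrA -exprSr prednK ?p_gt0 // -hE.
have ff : f * f = f.
  have p2 : p.-1 = p.-2.+1 by case: (p) pgt2 => [|[|[]]].
  by rewrite {2}/f mulrCA p2 exprSr [f * _]mulrCA fy -exprSr -p2.
exists (val f); split.
- by rewrite -valM ff.
- exact/es_even/esubP.
- have p2 : p.-1 = p.-2.+1 by case: (p) pgt2 => [|[|[]]].
  by rewrite /f p2 exprSr !valM !rmorphM /= exs !mulr0.
rewrite -x0e -(xs0 n) -valM -/y.
have -> : f * y ^+ (p ^ n) = y ^+ (p ^ n).
  by rewrite -(prednK (expn_pos n)) exprS mulrA fy.
by [].
Qed.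

(* [e = 1 - f], where [f] is maximal among the idempotents killed by [ev]: it exists because
   a strictly increasing sequence of idempotents generates a strictly increasing sequence of
   ideals. *)
Lemma counit_idem (ev : saHom A (sa_base k)) :
  exists e, [/\ pperf e, e * e = e, ev e = 1
    & forall x, pperf x -> x * e = (ev x : k) *: e].
Proof.
pose good (f : T) := f * f = f /\ ev (val f) = 0.
suff [f [ff ef] fx] : exists2 f : T, good f &
    forall x, pperf x -> ev x = 0 -> val f * x = x.
  have vff : val f * val f = val f by rewrite -valM ff.
  have pf : parity false (val f) by exact/es_even/esubP.
  have ee : (1 - val f) * (1 - val f) = 1 - val f.
    by rewrite mulrBl mul1r mulrBr mulr1 vff subrr subr0.
  exists (1 - val f); split=> //.
  - exact: idem_pperf.
  - by rewrite rmorphB rmorph1 /= ef subr0.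
  move=> x hx; pose x' := x - (ev x : k)%:A.
  have ex' : ev x' = 0.
    by rewrite raddfB /= linearZ /= rmorph1 [_ *: (1 : k^o)]mulr1 subrr.
  have hx' : pperf x'.
    apply: (submodB (pperf_submod A)) => //.
    apply: (submodZ (pperf_submod A)).
    by apply: idem_pperf; rewrite mulr1.
  have z : x' * (1 - val f) = 0.
    by rewrite mulrBr mulr1 -(even_central x' pf) fx // subrr.
  by move/eqP: z; rewrite mulrBl subr_eq0 -scalerAl mul1r => /eqP.
apply: contrapT => nf.
have step (f : {f : T | good f}) : exists gx : {f : T | good f} * T,
    [/\ sval gx.1 * sval f = sval f, sval gx.1 * gx.2 = gx.2 & sval f * gx.2 != gx.2].
  case: f => f [ff ef] /=.
  have [x [hx ex fx]] : exists x, [/\ pperf x, ev x = 0 & val f * x <> x].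
    apply: contrapT => h; apply: nf; exists f => // x hx ex; apply: contrapT => fx.
    by apply: h; exists x.
  have [g' [gg pg eg gx]] := pperf_idem hx ex.
  have [g ge] := pperf_T (idem_pperf gg); have [t te] := pperf_T hx.
  have {}gg : g * g = g by apply: val_inj; rewrite valM ge.
  have {}gx : g * t = t by apply: val_inj; rewrite valM ge te.
  (* The join of the two idempotents: it fixes everything fixed by [f] or by [g]. *)
  have gd : good (f + g - f * g).
    split; last by rewrite -[val _]/(val f + val g - val f * val g) raddfB raddfD /= rmorphM /= ef ge eg mul0r subr0 addr0.
    transitivity (f * f + g * g + f * f * (g * g) + 2 * f * g - 2 * (f * f) * g - 2 * f * (g * g)).
      ring.
    by rewrite ff gg; ring.
  exists (exist _ _ gd, t) => /=; split.
  - by rewrite mulrBl mulrDl ff [f * g * f]mulrAC ff (mulrC g) addrK.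
  - by rewrite mulrBl mulrDl gx -mulrA gx addrAC subrr add0r.
  - by apply/eqP => /(congr1 val); rewrite valM te.
have [nx nxP] := choice step.
have good0 : good 0 by split; rewrite ?mulr0 // !raddf0.
pose s n := iter n (fun f => (nx f).1) (exist _ 0 good0).
pose fs n : T := sval (s n); pose xs n : T := (nx (s n)).2.
have fsP n : [/\ fs n.+1 * fs n = fs n, fs n.+1 * xs n = xs n & fs n * xs n != xs n].
  exact: nxP.
have fle i n : (i <= n)%N -> fs n * fs i = fs i.
  move=> /subnK <-; elim: (n - i)%N => [|m IH].
    by have [] := svalP (s i).
  by have [h _ _] := fsP (m + i)%N; rewrite addSn -IH mulrA h IH.
have [n cn] := pow_noetherian (fun n => fs n.+1).
case: n cn => [|n] cn.
  have [_ h] := fsP 0%N; case/negP.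
  have f10 : fs 1%N = 0 by case: cn => c ->; rewrite big_ord0.
  by rewrite -h f10 !mul0r ?mulr0.
have [|h hE] := comb_chain _ cn.
  by move=> i le; exists (fs i.+1); rewrite mulrC fle.
(* Divisibility of [fs n.+2] by [fs n.+1] would make [fs n.+1] fix [xs n.+1], against the choice of
   the latter. *)
have [_ h1] := fsP n.+1; case/negP; apply/eqP.
rewrite -{1}h1 hE mulrA -[RHS]h1 hE; congr (_ * _).
by rewrite mulrCA fle.
Qed.
End PerfectClosure.

(** * Finding a point in every component *)

Section Components.
Variables (G : supergroup k) (Galg : sg_algebraic G).
Local Notation O := (coord_alg G).
Local Notation S := (perf_hopf G).
Local Notation E := (esub_sa S).
Local Notation P := (hsg S).

Lemma comp_idem : exists e : E, [/\ e * e = e, counit P e = 1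
  & forall x, x * e = (counit P x : k) *: e].
Proof.
have [e [he ee e1 eabs]] := counit_idem Galg (counit G).
have [e' e'E] := incl_ex (S := S) he.
have e'V : val e' = e := e'E.
exists e'; split.
- by apply: (@incl_inj _ _ S); rewrite rmorphM /= e'V.
- by rewrite hsg_counit e'E.
move=> x; apply: (@incl_inj _ _ S); rewrite rmorphM linearZ /= e'V eabs; last exact: (inclP x).
by congr (_ *: _); rewrite -[LHS]/(counit G (incl S x)) -hsg_counit [RHS]mulr1.
Qed.

Variable e : E.
Hypotheses (ee : e * e = e) (epse : counit P e = 1)
  (absorb : forall x, x * e = (counit P x : k) *: e).
Let pe : parity false e. Proof. by left. Qed.

Definition npoints m := exists (L : fieldExtType k) (g : 'I_m -> G (sa_even L)),
  injective (fun i => res S (g i)).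

Section OneStep.
Variables (L : fieldExtType k) (m : nat) (g : 'I_m -> G (sa_even L)).
Hypothesis ig : injective (fun i => res S (g i)).
Local Notation OL := (ktens O (sa_even L)).

(* Otherwise the complementary idempotent would carry a point over a larger field, lying in
   none of the components of the [g j]. *)
Lemma tensor_point_total : ~ npoints m.+1 ->
  \sum_j comp_at e g (incl S : P O) j = 1.
Proof.
move=> nm; pose u : P OL := gf_map (kinl O (sa_even L)) (incl S : P O).
pose d := comp_at e g (incl S : P O).
apply/eqP; rewrite eq_sym -subr_eq0; apply: contraT => d0; exfalso; apply: nm.
have dd j : d j * d j = d j by exact: agree_idem.
have pd j : parity false (d j) by exact: agree_even.
have dorth i j : i != j -> d i * d j = 0.
  move=> ij; have h : (res S (g i) : P (sa_even L)) <> res S (g j).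
    by move=> /ig h; rewrite h eqxx in ij.
  exact: (agree_orth (P := P) pe absorb (kinr O (sa_even L)) u h).
set D := 1 - _ in d0.
have pD : parity false D.
  by apply: parityD; [exact: parity1 | apply: parityN; apply: parity_sum].
have dD j : d j * D = 0.
  rewrite mulrBr mulr1 mulr_sumr (bigD1 j) //= dd big1 ?addr0 ?subrr // => i ij.
  by rewrite dorth // eq_sym.
have DD : D * D = D.
  rewrite {1}/D mulrBl mul1r mulr_suml big1 ?subr0 // => j _; exact: dD.
have fgOL : finitely_generated OL.
  by apply: ktens_fg => //; apply/finite_fg/fieldExt_finite.
have [K [h hD]] := super_point fgOL pD DD d0.
pose hr := sa_comp h (kinr O (sa_even L)).
have ihr : injective hr by exact: saHom_field_inj.
exists K, (fun i => if unlift ord_max i is Some j then gf_map hr (g j)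
  else elt (sa_comp h (kinl O (sa_even L)))).
have old j : res S (gf_map hr (g j)) = gf_map (hr : saHom (sa_even L) (sa_even K)) (res S (g j) : P _).
  exact: res_map.
have new : res S (elt (sa_comp h (kinl O (sa_even L)))) = gf_map h u.
  by rewrite res_elt -sa_compA.
(* If the new point met the component of [g j], then [h] would send both [d j] and [D] to 1,
   although their product is 0. *)
have ne j : gf_map h u <> gf_map hr (res S (g j) : P _).
  move=> ehu; have hd : h (d j) = 1.
    by rewrite /d /comp_at -/u agree_map -[X in agree _ _ X]gf_map_comp -/hr -ehu agree_id.
  have := congr1 h (dD j); rewrite rmorphM /= hd hD mulr1 raddf0 => /eqP.
  by rewrite oner_eq0.
move=> i i' /=; case: (unliftP ord_max i) => [j ->|->];
  case: (unliftP ord_max i') => [j' ->|->]; rewrite ?old ?new //.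
- move=> /(sa_comp_inj ihr) /ig -> //.
- by move=> /esym /ne.
- by move=> /ne.
Qed.
End OneStep.

(** The number of points is bounded, so a maximal family exists. Totality is first shown in
    [O (x) L], because the existence of new points needs a finitely generated algebra and [E] is not
    yet known to be one; injectivity of [E (x) L] into [O (x) L] brings it back. *)
Lemma enough_points : exists (L : fieldExtType k) (m : nat) (g : 'I_m -> G (sa_even L)),
  injective (fun i => res S (g i)) /\
  \sum_j comp_at e g (sa_id E : P E) j = 1.
Proof.
have [n [a [b ab]]] := stensE (comult P e).
have [L0 [h0 _]] : exists (L : fieldExtType k) (h : saHom O (sa_even L)), h 1 = 1.
  apply: (super_point Galg (parity1 O)); rewrite ?mulr1 //.
  exact: oner_neq0.
have ex : exists m, `[< npoints m >].
  by exists 0%N; apply/asboolP; exists L0, (fun=> elt h0); case.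
have bound m : `[< npoints m >] -> (m <= n)%N.
  move=> /asboolP [L [g ig]].
  have ab' : comult P e = \sum_(i < n) kpur (a i) (b i) := ab.
  have ig' : injective (fun j => res S (g j) : P (sa_even L)) := ig.
  exact: (points_bound (P := P) pe epse absorb ab' ig').
case: (ex_maxnP ex bound) => m /asboolP [L [g ig]] maxm.
exists L, m, g; split=> //.
have nm : ~ npoints m.+1 by move=> /asboolP /maxm; rewrite ltnn.
have ij : injective (ktmap (incl S) (sa_id (sa_even L))).
  by apply: ktmap_inj; [exact: incl_inj|].
apply: ij; rewrite rmorph1 -(tensor_point_total ig nm) raddf_sum.
by apply: eq_bigr => i _; rewrite [LHS]comp_at_map [X in comp_at _ _ X]sa_comp1.
Qed.
End Components.

(** The Frobenius is onto on [k(x)], so [x] is the p-th power of a polynomial in [x], hence a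
    polynomial in [x ^+ p]; this is the separability criterion. *)
Lemma fieldExt_separable (L : fieldExtType k) : separable 1%AS {:L}.
Proof.
apply/separableP => x _; rewrite (pcharf_p_separable _ _ 0 (pchar_alg L)) expn1.
pose W (z : sa_even L) := (z : L) \in <<1; x>>%VS.
have [] := @frob_surj (sa_even L) W (fieldExt_finite L) _ _ _ x.
- split; first exact: mem0v.
  by move=> c u v hu hv; apply: memvD => //; exact: memvZ.
- by move=> z hz; exact: rpredX.
- by move=> z _ /eqP; rewrite [_ == _]expf_eq0 => /andP[_ /eqP].
- exact: memv_adjoin.
move=> w hw e; rewrite {1}e.
have /Fadjoin_polyP [q /polyOverP qP ->] := hw.
rewrite horner_coef.
rewrite [_ ^+ p](@frob_sum (sa_even L)).
apply: rpred_sum => i _; rewrite exprMn exprAC; apply: rpredM.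
  by apply: (subvP (subv_adjoin 1%AS _)); apply: rpredX; exact: qP.
by apply: rpredX; exact: memv_adjoin.
Qed.

(** * Descent of p-th powers to a representing quotient *)

Section Descent.
Variables (G Q : supergroup k) (q : sgHom G Q).
Local Notation O := (coord_alg G).
Local Notation C := (coord_alg Q).
Local Notation c := (comorphism q).
Local Notation S := (frob_hopf G).

(** The points differ by an element of the Frobenius kernel, which restricts trivially to the
    algebra of p-th powers. *)
Lemma frob_val_eq D (u v : G D) f : q D u = q D v ->
  (forall n : G D, q D n = 1%g -> frobenius_kernel p n) -> pt u (f ^+ p) = pt v (f ^+ p).
Proof.
move=> quv ker.
have hn : res S (v^-1 * u)%g = hone S D.
  by apply/frob_kernelP/ker; rewrite sg_appM quv -sg_appM mulVg; apply: (mulgI (q D 1%g));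
    rewrite -sg_appM !mulg1.
have [y ye] : exists y, incl S y = f ^+ p by apply: incl_ex; exists f; rewrite expn1.
have e : res S u = res S v.
  rewrite -[u](mulVKg v) resM hn; exact: hmulr1.
rewrite -ye -[LHS]/(res S u y) e; exact: erefl.
Qed.

Hypothesis quot : is_quotient (@frobenius_kernel k p G) q.

Lemma quotient_comorphism : injective c /\ forall f : O, exists a, c a = f ^+ p.
Proof.
have [ker surj] := quot.
have kerP D (n : G D) : q D n = 1%g -> frobenius_kernel p n by move/ker.
have [B [phi [g [[ff _] qg]]]] := surj _ (elt (sa_id C)).
have cg : sa_comp (pt g) c = phi.
  by rewrite -pt_comorphism qg gf_map_elt eltK sa_comp1.
have cgE a : pt g (c a) = phi a by rewrite -cg.
have iphi := faithfully_flat_injective ff.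
split.
  apply: raddf_inj => a ca; apply: iphi; rewrite raddf0 -cgE.
  by rewrite -[c a]/(c a) ca raddf0.
move=> f.
(* [pt g (f ^+ p)] descends along [phi]: its two images in [B (x)_C B] come from points of
   [G] that differ by an element of the Frobenius kernel. *)
have [c' c'E] : exists c', phi c' = pt g (f ^+ p).
  set y := pt g (f ^+ p).
  pose nz := sone_neq0_diag phi.
  have e : sinl nz y = sinr nz y.
    rewrite /y -[LHS]/(sa_comp (sinl nz) (pt g) (f ^+ p)) -[RHS]/(sa_comp (sinr nz) (pt g) (f ^+ p)).
    rewrite -!pt_nat; apply: frob_val_eq => //; last exact: kerP.
    rewrite !sg_app_nat qg -!gf_map_comp; congr (gf_map _ _).
    by apply: saHom_ext => a; exact: sinl_sinr.
  have sW : submod (fun x : restr phi => exists a, x = phi a).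
    split; first by exists 0; rewrite raddf0.
    move=> a _ _ [u ->] [v ->]; exists (a * u + v).
    by rewrite saHomD saHomM.
  (* Applying [pi], which kills the image of [phi], to the second factor of [y (x) 1 = 1 (x) y]
     gives [1 (x) pi y = 0], so [pi y = 0] by faithful flatness. *)
  have [pi [pi0 _]] := qmod_ex sW.
  have bu : balanced phi (fun b (m : restr phi) => tens phi b (pi m)).
    case: (balanced_tens phi (qmod sW)) => h1 h2 h3.
    by split=> *; rewrite ?raddfD ?linearZ ?h1 ?h2 ?h3.
  have [T TE] := tlift_additive bu.
  have := congr1 T e; rewrite /sinl /sinr /= !TE !tlift_tens // => e'.
  have p1 : pi (1 : B) = 0 by apply/pi0; exists 1; rewrite rmorph1.
  rewrite p1 (balanced0r _ (balanced_tens phi _)) in e'.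
  have := faithfully_flat_inj ff (esym e'); move=> /pi0 [a ->].
  by exists a.
exists c'.
(* In [B (x) O] over [C] the lift [g] and the universal point of [G] have the same image in [Q], so
   [f ^+ p] and [c c'] agree there; [O] embeds by faithful flatness. *)
have nz : sone phi c != 0.
  apply/eqP => e; have := faithfully_flat_inj (V := restr c) ff e.
  by move=> h; have := oner_neq0 O; rewrite -[1]/((1 : restr c) : O) h eqxx.
have e : sinr nz (f ^+ p) = sinr nz (c c').
  rewrite -sinl_sinr c'E.
  rewrite -[LHS]/(sa_comp (sinr nz) (sa_id O) (f ^+ p)) -[RHS]/(sa_comp (sinl nz) (pt g) (f ^+ p)).
  have -> : sa_comp (sinr nz) (sa_id O) = pt (gf_map (sinr nz) (elt (sa_id O))).
    by rewrite gf_map_elt eltK.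
  rewrite -pt_nat; apply: frob_val_eq => //; last exact: kerP.
  rewrite !sg_app_nat qg; apply: pt_inj; rewrite !pt_nat eltK sa_comp1.
  apply: saHom_ext => a; rewrite -[RHS]/(sinl nz (phi a)) sinl_sinr.
  exact: erefl.
apply/eqP; rewrite eq_sym -subr_eq0; apply/eqP.
apply: (faithfully_flat_inj (V := restr c) ff).
have := e => /eqP; rewrite -subr_eq0 -raddfB => /eqP; exact.
Qed.
End Descent.

Section ComponentGroup.
Variables (G : supergroup k).
Local Notation S := (perf_hopf G).

(** Roots are taken in the factors, which are perfect fields, and the bijection with the product
    turns them into roots in [A]. *)
Lemma separable_frob_surj (A : algType k) : separable_algebra A ->
  forall n (a : A), exists b, b ^+ (p ^ n) = a.
Proof.
move=> [m [L [f [_ crt]]]].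
have root (a : A) : exists b, b ^+ p = a.
  have ex i : exists y : L i, y ^+ p = f i a by exact: fieldExt_perfect.
  have [y yE] : exists y : (forall i, L i), forall i, y i ^+ p = f i a.
    by exists (fun i => projT1 (cid (ex i))) => i; case: cid.
  have [b [bE _]] := crt y; exists b.
  have [d [_ du]] := crt (fun i => f i a).
  rewrite -(du a (fun i => erefl)); apply/esym/du => i.
  by rewrite rmorphXn /= bE yE.
elim=> [|n IH] a; first by exists a; rewrite expr1.
have [b <-] := root a; have [d <-] := IH b.
by exists d; rewrite expnSr exprM.
Qed.

Lemma component_group (Q : supergroup k) (q : sgHom G Q) :
  etale (hsg S) -> injective (comorphism q) ->
  (forall f : coord_alg G, exists a, comorphism q a = f ^+ p) ->
  exists r : sgHom Q (hsg S), is_component_group r /\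
    forall A (g : G A), hproj S A g = r A (q A g).
Proof.
move=> et iq im.
have Sq x : S x -> exists a, comorphism q a = x.
  by move=> /(_ 1%N) [y ->]; rewrite expn1; exact: im.
exists (through iq Sq); split; last by move=> A g; apply: esym; exact: through_q.
split=> // [x y e|A s sepA _ a].
  by apply: (@incl_inj _ _ S); rewrite -!(through_comorphism iq Sq) e.
have hS : S (comorphism q (s a)).
  move=> n; have [b <-] := separable_frob_surj sepA n a.
  by exists (comorphism q (s b)); rewrite rmorphXn saHomX.
have [b bE] := incl_ex hS; exists b.
by apply: (iq); rewrite through_comorphism bE.
Qed.
End ComponentGroup.

(** * Splitting in the finite case *)

Section Retraction.

Definition frob_injective (D : superAlgebra k) := forall x : D, x ^+ p = 0 -> x = 0.

Lemma frob_injectiveP D : frob_injective D -> forall n (x y : D),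
  x ^+ (p ^ n) = y ^+ (p ^ n) -> x = y.
Proof.
move=> inj n x y e; apply/eqP; rewrite -subr_eq0; apply/eqP.
have : (x - y) ^+ (p ^ n) = 0.
  apply/eqP; rewrite -(inj_eq (addIr (y ^+ (p ^ n)))) -frobnD subrK e add0r.
  by [].
elim: n {e} (x - y) => [|n IH] z; first by rewrite expr1.
by rewrite expnS exprM => /IH /inj.
Qed.

(** Take both families independent. As [k] is perfect, a relation between the [b i ^+ p] is the p-th
    power of one between the [b i], so the [b i ^+ p] are independent and every [a i ^+ p]
    vanishes. *)
Lemma ktens_frob_injective A B : frob_injective A -> frob_injective B ->
  frob_injective (ktens A B).
Proof.
move=> iA iB x; have [n [a [b [-> ia ib]]]] := ktens_min x.
rewrite frob_sum => e; apply: big1 => i _.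
have ibp : indep (fun i => b i ^+ p).
  move=> c ec j; have [d dE] := choice (fun i => kperfect (c i)).
  rewrite -dE; suff -> : d j = 0 by rewrite expr0n -[p]prednK ?p_gt0.
  apply: (ib d); apply: iB.
  rewrite frob_sum -[RHS]ec; apply: eq_bigr => l _.
  by rewrite exprZn dE.
have h := @ktens_indep_r k A B n (fun i => a i ^+ p) (fun i => b i ^+ p) 0 (fun=> 0)
  (fun=> 0) (fun x => x = 0) ibp (zero_submod A).
have ai : a i = 0.
  apply: iA; apply: h => [[]//|]; rewrite big_ord0 -[RHS]e; apply: eq_bigr => j _.
  by have := kpurX (a j) (b j) 1; rewrite expn1.
by rewrite ai kpurE raddf0 mul0r.
Qed.

Variables (G : supergroup k) (Galg : sg_algebraic G) (Gfin : sg_finite G).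
Local Notation O := (coord_alg G).
Local Notation S := (perf_hopf G).
Local Notation E := (esub_sa S).

Lemma esub_frob_injective : frob_injective E.
Proof.
move=> x xp; apply: (@incl_inj _ _ S); rewrite raddf0.
apply: (pperf_frob0 Galg (inclP x)).
by rewrite -saHomX xp raddf0.
Qed.

(** The descending powers of [O] stop: where the Frobenius is injective it is also onto, by finite
    dimension and [frob_surj]. *)
Lemma ppow_pperf : exists N, forall x : O, ppow N.+1 x -> pperf x.
Proof.
have [n0 inj] := frob_inj_ex Galg.
exists n0; have WF (x : O) : ppow n0.+1 x -> ppow n0.+1 (x ^+ p).
  by move=> [y ->]; exists (y ^+ p); rewrite -!exprM mulnC.
have surj := frob_surj Gfin (ppow_submod O n0.+1) WF inj.
move=> x hx n; suff [y _ ->] : exists2 y, ppow n0.+1 y & x = y ^+ (p ^ n) by exists y.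
elim: n => [|n [y /surj [z hz ->] ->]]; first by exists x; rewrite ?expr1.
by exists z => //; rewrite -exprM expnS.
Qed.

(** [f ^+ (p ^ N.+1)] lies in the perfect part and has a [p ^ N.+1]-th root there. Uniqueness of
    this root makes [rho] compatible with all operations, and twisting scalars by the power is
    undone by the root. *)
Lemma retraction : exists N (rho : saHom O E),
  forall f, incl S (rho f) ^+ (p ^ N.+1) = f ^+ (p ^ N.+1).
Proof.
have [N hN] := ppow_pperf; exists N.
have ex f : exists t : E, incl S t ^+ (p ^ N.+1) = f ^+ (p ^ N.+1).
  have hf : pperf (f ^+ (p ^ N.+1)) by apply: hN; exists f.
  have [z hz <-] := pperf_rootn Galg N.+1 hf.
  by have [t <-] := incl_ex (S := S) hz; exists t.
have [rho rhoE] := choice ex.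
have inj (x y : E) : incl S x ^+ (p ^ N.+1) = incl S y ^+ (p ^ N.+1) -> x = y.
  rewrite -!saHomX => /incl_inj; exact: (frob_injectiveP esub_frob_injective).
have rl : linear (rho : O -> E).
  move=> c x y; apply: inj; rewrite rhoE linearP /= !frobnD !exprZn.
  by rewrite -[val (rho x)]/(incl S (rho x)) -[val (rho y)]/(incl S (rho y)) !rhoE.
have rm : monoid_morphism (rho : O -> E).
  split=> [|x y]; apply: inj; first by rewrite rhoE rmorph1 !expr1n.
  by rewrite rhoE saHomM !frobnM !rhoE.
have rp i f : parity i f -> parity i (rho f : E).
  case: i => pf; last by left.
  right; apply: inj; rewrite rhoE raddf0 expnS !exprM frob_even (spart_neg pf).
  by rewrite frob0.
by exists (SaHom rl rm rp).
Qed.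
End Retraction.

Section Semidirect.
Variables (G : supergroup k) (Galg : sg_algebraic G).
Local Notation O := (coord_alg G).
Local Notation S := (perf_hopf G).
Local Notation E := (esub_sa S).
Local Notation P := (hsg S).
Variables (N : nat) (rho : saHom O E).
Hypothesis rhoE : forall f, incl S (rho f) ^+ (p ^ N.+1) = f ^+ (p ^ N.+1).

Definition section A (x : P A) : G A := elt (sa_comp (x : saHom E A) rho).

Lemma section_nat A B (f : saHom A B) (x : P A) :
  gf_map f (section x) = section (gf_map f x).
Proof. by rewrite gf_map_elt sa_compA. Qed.

Lemma rho_incl : sa_comp rho (incl S) = sa_id E.
Proof.
apply: saHom_ext => y.
apply: (frob_injectiveP (esub_frob_injective Galg) (n := N.+1)).
by apply: (@incl_inj _ _ S); rewrite !saHomX rhoE.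
Qed.

Lemma res_section A (x : P A) : res S (section x) = x.
Proof. by rewrite res_elt -sa_compA rho_incl sa_comp1. Qed.

(* The Frobenius is injective on [E (x) E] and becomes compatible with the comultiplications
   after a power, hence the section is multiplicative on the universal pair of points. *)
Lemma sectionM A (x y : P A) : section (x * y)%g = (section x * section y)%g.
Proof.
pose ux : P (ktens E E) := kinl E E; pose uy : P (ktens E E) := kinr E E.
have inj : frob_injective (ktens E E).
  by apply: ktens_frob_injective => //; exact: esub_frob_injective.
have univ : section (ux * uy)%g = (section ux * section uy)%g.
  apply: pt_inj; apply: saHom_ext => f.
  apply: (frob_injectiveP inj (n := N.+1)).
  rewrite -!saHomX -rhoE -saHomX.
  move: (rho f ^+ _) => t.
  rewrite -[LHS]/(res S (section (ux * uy)%g) t) -[RHS]/(res S (section ux * section uy)%g t).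
  by rewrite resM !res_section.
pose h : saHom (ktens E E) A := kcopair (x : saHom E A) (y : saHom E A).
have hx : gf_map h ux = x by exact: kcopair_inl.
have hy : gf_map h uy = y by exact: kcopair_inr.
have := congr1 (gf_map h) univ.
by rewrite gf_mapM !section_nat gf_mapM hx hy.
Qed.

Lemma section1 A : section (1%g : P A) = 1%g.
Proof. by apply: (mulgI (section (1%g : P A))); rewrite -sectionM !mulg1. Qed.

Variables (N0 : supergroup k) (i : sgHom N0 G).
Hypotheses (inorm : normal_sub i) (iinj : forall A, injective (i A))
  (iker : forall A (g : G A), hproj S A g = 1%g <-> hom_image i g).

(** The action is conjugation through the section; the kernel component of [g] is [g] times the
    inverse of the section of its image. *)
Lemma section_semidirect : is_semidirect_product i (hproj S).
Proof.
have cex A (g : G A) (n : N0 A) : exists n', i A n' = (g * i A n * g^-1)%g.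
  exact: inorm.2.
pose act A (h : P A) (n : N0 A) : N0 A := projT1 (cid (cex A (section h) n)).
have actE A (h : P A) (n : N0 A) :
    i A (act A h n) = (section h * i A n * (section h)^-1)%g.
  exact: projT2 (cid (cex A (section h) n)).
pose theta A (x : N0 A * P A) : G A := (i A x.1 * section x.2)%g.
have qi A (n : N0 A) : hproj S A (i A n) = 1%g by apply/iker; exists n.
have qs A (h : P A) : hproj S A (section h) = h by exact: res_section.
exists act, theta; split.
- split.
  + by move=> A n; apply: iinj; rewrite actE section1 mul1g invg1 mulg1.
  + move=> A h h' n; apply: iinj; rewrite !actE sectionM invgM.
    by rewrite !mulgA.
  + move=> A h n n'; apply: iinj; rewrite sg_appM !actE sg_appM.
    by rewrite !mulgA mulgVK.
  + move=> A B f h n; apply: iinj.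
    by rewrite sg_app_nat !actE !gf_mapM gf_mapV section_nat sg_app_nat.
- split.
  + move=> A; have hker (g : G A) : exists n, i A n = (g * (section (hproj S A g))^-1)%g.
      apply/iker; rewrite sg_appM; set h := hproj S A g.
      by apply: (mulIg (hproj S A (section h))); rewrite -mulgA -sg_appM mulVg mul1g qs
        -[X in (_ * X)%g](_ : 1%g = _) ?mulg1 //; apply: (mulgI (hproj S A 1%g)); rewrite -sg_appM !mulg1.
    have [n nE] := choice hker.
    exists (fun g => (n g, hproj S A g)) => [[m h]|g]; rewrite /theta /=.
      have e : hproj S A (i A m * section h)%g = h by rewrite sg_appM qi qs mul1g.
      congr (_, _) => //; apply: iinj; rewrite nE e.
      by rewrite -mulgA mulgV mulg1.
    by rewrite nE mulgVK.
  + by move=> A B f n h; rewrite /theta gf_mapM section_nat sg_app_nat.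
  + move=> A n n' h h'; rewrite /theta /= sg_appM actE sectionM !mulgA.
    by rewrite mulgVK.
- by move=> A n; rewrite /theta /= section1 mulg1.
- by move=> A n h; rewrite /theta sg_appM qi qs mul1g.
Qed.
End Semidirect.

End PerfectField.

Theorem lemma5p3p1 (k : fieldType) (p : nat)
    (kchar : p \in [pchar k]) (pgt2 : (2 < p)%N)
    (kperfect : forall x : k, exists y : k, y ^+ p = x)
    (G : supergroup k) (Galg : sg_algebraic G) :
  exists (P G0 : supergroup k) (i : sgHom G0 G) (pi : sgHom G P),
    [/\ etale P,
        exists (Q : supergroup k) (q : sgHom G Q) (r : sgHom Q P),
          [/\ is_frobenius_quotient p q, is_component_group r
            & forall A (g : G A), pi A g = r A (q A g)],
        forall (Q : supergroup k) (q : sgHom G Q),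
          is_quotient (@frobenius_kernel k p G) q ->
          exists r : sgHom Q P,
            is_component_group r /\ forall A (g : G A), pi A g = r A (q A g),
        normal_sub i /\ is_quotient (hom_image i) pi
      & sg_finite G -> is_semidirect_product i pi /\ infinitesimal G0].
Proof.
pose S := perf_hopf kchar pgt2 kperfect G; pose P := hsg S.
have [e [ee e1 eabs]] := comp_idem kchar pgt2 kperfect Galg.
have [L [m [g [ig total]]]] := enough_points Galg ee e1 eabs.
have Se := inclP e.
have iee : incl S e * incl S e = incl S e by rewrite -saHomM ee.
have ie1 : counit G (incl S e) = 1 by rewrite -hsg_counit.
have iabs x : S x -> x * incl S e = (counit G x : k) *: incl S e.
  move=> /incl_ex [y <-]; rewrite -saHomM eabs saHomZ.
  by rewrite hsg_counit.
have sep := fieldExt_separable kchar pgt2 kperfect.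
have fin := hsg_finite eabs total.
have et : etale P.
  split=> //; first by move=> f; case.
  apply: (separable_of_points sep (r := fun j => even_lr (res S (g j) : saHom (sa_even (esub S)) (sa_even L)))) => //.
  move=> a h; exact: (points_inj eabs total (y := a) h).
pose G0 := ker_sg Se iee ie1 iabs; pose i := ker_incl Se iee ie1 iabs.
exists P, G0, i, (hproj S); split=> //.
- have fq := frob_quotient kchar pgt2 kperfect G; have [_ _ iq im] := fq.
  have [|r [hr hE]] := component_group (q := hproj (frob_hopf kchar pgt2 kperfect G)) et iq.
    by move=> f; apply/im; exists f.
  by exists (hsg (frob_hopf kchar pgt2 kperfect G)), (hproj _), r.
- move=> Q q /(quotient_comorphism kchar pgt2 kperfect) [iq im].
  exact: component_group.
- split; first exact: ker_normal.
  split=> [A x|A x]; first exact: ker_hproj.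
  exists (ktens A (sa_even L)), (kinl A (sa_even L)), (elt (lift_point ee eabs ig total x)).
  split; first exact: ext_fppf.
  exact: lift_pointE.
move=> Gfin; have [N [rho rhoE]] := retraction kchar pgt2 kperfect Galg Gfin.
split.
  apply: (section_semidirect Galg rhoE); [exact: ker_normal|by move=> A; exact: val_inj|].
  exact: ker_hproj.
have finG0 : sg_finite G0.
  have [n [b span]] := Gfin; exists n, (fun j => cut_proj _ _ _ (b j)) => a.
  have [c cE] := span (val a); exists c; rewrite -[LHS]cut_proj_val cE saHom_sum.
  by apply: eq_bigr => j _; rewrite saHomZ.
(* By [rhoE] the elements [val z] and [rho (val z)] have the same [p ^ N.+1]-th power. The latter
   lies in the augmentation ideal of [S], hence is killed by the idempotent [incl S e]. *)
split=> //; apply: nil_ideal_nilpotent => // z z0; exists (p ^ N.+1)%N.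
have zE : z = cut_proj _ _ _ (val z) by rewrite cut_proj_val.
have gz : counit G (val z) = 0 by rewrite -[RHS]z0.
have r0 : counit G (incl S (rho (val z))) = 0.
  have := congr1 (counit G) (rhoE (val z)); rewrite !saHomX gz (frobn0 pgt2).
  by move=> /eqP; rewrite [_ == _]expf_eq0 => /andP[_ /eqP].
rewrite zE -saHomX -rhoE saHomX (_ : cut_proj _ _ _ (incl S (rho (val z))) = 0) ?(frobn0 pgt2) //.
by apply: val_inj; rewrite cut_projE iabs ?r0 ?scale0r //; exact: inclP.
Qed.
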